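(* Let $\varphi:\Sigma\to\mathbb{R}$ be continuous. Then for every $\alpha\in[\alpha_{\min}(\varphi),\alpha_{\max}(\varphi)]$, \[\dim \Lambda^{\varphi}_{\alpha}=\sup\Big\{D_{LY}(\mu):\ \mu\in\mathcal{M}_{\sigma}(\Sigma),\ \int\varphi\,d\mu=\alpha\Big\}.\] In particular the map $\alpha\mapsto \dim\Lambda^{\varphi}_{\alpha}$ is continuous on $[\alpha_{\min}(\varphi),\alpha_{\max}(\varphi)]$.
   Context: Standing setting (Lalley–Gatzouras system). Let $p\ge 1$ and $m_1,\dots,m_p\ge1$ be integers and $\mathcal{D}=\{(i,j):1\le i\le p,\ 1\le j\le m_i\}$. For $(i,j)\in\mathcal{D}$ let $S_{ij}:[0,1]^2\to[0,1]^2$, $S_{ij}(x)=\begin{pmatrix}a_{ij}&0\\0&b_i\end{pmatrix}x+\begin{pmatrix}c_{ij}\\ d_i\end{pmatrix}$, where $a_{ij},b_i,c_{ij},d_i\in[0,1]$, $0<a_{ij}\le b_i<1$, $0\le d_1\le\dots\le d_p<1$, $d_{i+1}-d_i\ge b_i$, $b_p+d_p\le 1$, and for each $i$: $0\le c_{i1}\le\dots\le c_{im_i}<1$, $c_{i(j+1)}-c_{ij}\ge a_{ij}$, $a_{im_i}+c_{im_i}\le1$. Let $\Sigma=\mathcal{D}^{\mathbb{N}}$ with left shift $\sigma$, $\Sigma_v=\{1,\dots,p\}^{\mathbb{N}}$ with left shift $\sigma_v$, and $\pi:\Sigma\to\Sigma_v$, $((i_n,j_n))_n\mapsto(i_n)_n$.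 Write $\omega=(\omega_\nu)_{\nu\ge1}=((i_\nu,j_\nu))_{\nu\ge1}$ and $a_{\omega_\nu}=a_{i_\nu j_\nu}$. Let $\Pi:\Sigma\to\mathbb{R}^2$, $\Pi(\omega)=\lim_{n\to\infty}S_{\omega_1}\circ\cdots\circ S_{\omega_n}([0,1]^2)$ (a single point), and $\Lambda=\Pi(\Sigma)$. $\mathcal{M}_{\sigma^n}(\Sigma)$ denotes the $\sigma^n$-invariant Borel probability measures on $\Sigma$. For $\mu\in\mathcal{M}_{\sigma^n}(\Sigma)$: $\lambda(\mu,\sigma^n)=-\int\log(a_{\omega_1}\cdots a_{\omega_n})\,d\mu(\omega)$, $\lambda^v(\mu,\sigma^n)=-\int\log(b_{i_1}\cdots b_{i_n})\,d\mu(\omega)$, $h(\mu,\sigma^n)$ is the Kolmogorov–Sinai entropy of $\mu$ w.r.t. $\sigma^n$, $h^v(\mu,\sigma^n)$ is the entropy of $\mu\circ\pi^{-1}$ w.r.t. $\sigma_v^n$, and \[D^n_{LY}(\mu)=\frac{h(\mu,\sigma^n)}{\lambda(\mu,\sigma^n)}+\Big(\frac{1}{\lambda^v(\mu,\sigma^n)}-\frac{1}{\lambda(\mu,\sigma^n)}\Big)h^v(\mu,\sigma^n),\qquad D_{LY}:=D^1_{LY}.\] For continuous $\varphi:\Sigma\to\mathbb{R}$ and $\alpha\in\mathbb{R}$: $\Sigma^{\varphi}_{\alpha}=\{\omega\in\Sigma:\lim_{n\to\infty}\frac1n\sum_{l=0}^{n-1}\varphi(\sigma^l\omega)=\alpha\}$,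 $\Lambda^{\varphi}_{\alpha}=\Pi(\Sigma^{\varphi}_{\alpha})$, $\alpha_{\min}(\varphi)=\inf\{\int\varphi\,d\mu:\mu\in\mathcal{M}_\sigma(\Sigma)\}$, $\alpha_{\max}(\varphi)=\sup\{\int\varphi\,d\mu:\mu\in\mathcal{M}_\sigma(\Sigma)\}$. $\dim$ denotes Hausdorff dimension. *)

(* Defs.v *)
From HB Require Import structures.
From mathcomp Require Import all_boot all_order all_algebra.
From mathcomp Require Import all_classical all_reals all_analysis.
Set Implicit Arguments. Unset Strict Implicit. Unset Printing Implicit Defensive.
Import Order.TTheory GRing.Theory Num.Theory.
Import numFieldNormedType.Exports.
Local Open Scope classical_set_scope.
Local Open Scope ring_scope.

(* One-sided full shift  A^N  over a (finite, nonempty) pointed alphabet  *)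
(* A, with the Borel sigma-algebra of the product topology, i.e. the      *)
(* sigma-algebra generated by the cylinder sets.                          *)

Definition cylinders (A : pointedType) : set (set (nat -> A)) :=
  [set C | exists (n : nat) (w : nat -> A),
      C = [set x | forall k, (k < n)%N -> x k = w k]].

Definition shiftspace (A : pointedType) := g_sigma_algebraType (@cylinders A).

Definition sshift {A : pointedType} (x : shiftspace A) : shiftspace A :=
  fun k => x k.+1.

(* continuity of phi : A^N -> R for the product of discrete topologies
   (the basic neighbourhoods of x are the cylinders [x_0 ... x_{n-1}]) *)
Definition seq_continuous {R : realType} {A : pointedType}
    (phi : shiftspace A -> R) : Prop :=
  forall (x : shiftspace A) (eps : R), 0 < eps ->
    exists n : nat, forall y : shiftspace A,
      (forall k, (k < n)%N -> y k = x k) -> `|phi y - phi x| < eps.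

Definition is_invariant {R : realType} {d} {T : measurableType d}
    (mu : probability T R) (f : T -> T) : Prop :=
  forall B : set T, measurable B -> mu (f @^-1` B) = mu B.

Section Entropy.
Context {R : realType} {d} {T : measurableType d}.

Definition is_finite_partition (P : seq (set T)) : Prop :=
  [/\ forall B, B \in P -> measurable B,
      (forall i j, (i < size P)%N -> (j < size P)%N -> i != j ->
          nth set0 P i `&` nth set0 P j = set0)
    & \big[setU/set0]_(B <- P) B = setT].

Definition part_entropy (nu : set T -> R) (P : seq (set T)) : R :=
  - \sum_(B <- P) nu B * ln (nu B).

Fixpoint join_iter (f : T -> T) (P : seq (set T)) (k : nat) : seq (set T) :=
  match k with
  | 0 => [:: setT]
  | k'.+1 => [seq B `&` (iter k' f @^-1` C) | B <- join_iter f P k', C <- P]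
  end.

Definition entropy_wrt (nu : set T -> R) (f : T -> T) (P : seq (set T)) : R :=
  limn (fun k : nat => k%:R^-1 * part_entropy nu (join_iter f P k)).

Definition ks_entropy (nu : set T -> R) (f : T -> T) : R :=
  fine (ereal_sup [set (entropy_wrt nu f P)%:E | P in is_finite_partition]).

End Entropy.

Section Hausdorff.
Context {R : realType}.

Definition dist2 (z w : R * R) : R :=
  Num.sqrt ((z.1 - w.1) ^+ 2 + (z.2 - w.2) ^+ 2).

Definition diam2 (U : set (R * R)) : \bar R :=
  ereal_sup [set (dist2 z w)%:E | z in U & w in U].

Definition diam_pow (U : set (R * R)) (s : R) : R :=
  if `[< U = set0 >] then 0 else fine (diam2 U) `^ s.

Definition hausdorff_delta (s delta : R) (E : set (R * R)) : \bar R :=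
  ereal_inf [set (\sum_(k <oo) (diam_pow (U k) s)%:E)%E
            | U in [set U : nat -> set (R * R) |
                     E `<=` \bigcup_k U k /\ forall k, (diam2 (U k) <= delta%:E)%E]].

Definition hausdorff_measure (s : R) (E : set (R * R)) : \bar R :=
  ereal_sup [set hausdorff_delta s delta E | delta in [set delta : R | 0 < delta]].

Definition hausdorff_dim (E : set (R * R)) : \bar R :=
  ereal_inf [set s%:E | s in [set s : R | 0 <= s /\ hausdorff_measure s E = 0%E]].

End Hausdorff.

(* Lalley--Gatzouras carpets.                                             *)
(* Indices are 0-based: the rows are i : 'I_p.+1 (i.e. p.+1 >= 1 rows),   *)
(* row i has the columns j : 'I_(m i).+1 (i.e. (m i).+1 >= 1 columns).   *)

Definition LGdigit (p : nat) (m : 'I_p.+1 -> nat) :=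
  {i : 'I_p.+1 & 'I_(m i).+1}.
HB.instance Definition _ p m := Choice.on (@LGdigit p m).
HB.instance Definition _ p m :=
  isPointed.Build (@LGdigit p m) (@Tagged 'I_p.+1 ord0 (fun i => 'I_(m i).+1) ord0).

Definition vrow (p : nat) := 'I_p.+1.
HB.instance Definition _ p := Choice.on (vrow p).
HB.instance Definition _ p := isPointed.Build (vrow p) (@ord0 p).

Section LG.
Context {R : realType} {p : nat} {m : 'I_p.+1 -> nat}.
Variables (a c : LGdigit m -> R) (b d : 'I_p.+1 -> R).

Definition LG_hyp : Prop :=
  (forall ij : LGdigit m, 0 <= a ij <= 1 /\ 0 <= c ij <= 1) /\
  (forall i, 0 <= b i <= 1 /\ 0 <= d i <= 1) /\
  (forall ij : LGdigit m, 0 < a ij <= b (tag ij) /\ b (tag ij) < 1) /\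
  (forall i j : 'I_p.+1, (i <= j)%N -> d i <= d j) /\
  (forall i : 'I_p.+1, d i < 1) /\
  (forall i j : 'I_p.+1, val j = (val i).+1 -> b i <= d j - d i) /\
  b ord_max + d ord_max <= 1 /\
  (forall i : 'I_p.+1,
     (forall j k : 'I_(m i).+1, (j <= k)%N ->
         c (Tagged _ j) <= c (Tagged _ k)) /\
     (forall j : 'I_(m i).+1, c (Tagged _ j) < 1) /\
     (forall j k : 'I_(m i).+1, val k = (val j).+1 ->
         a (Tagged _ j) <= c (Tagged _ k) - c (Tagged _ j)) /\
     a (Tagged _ (@ord_max (m i))) + c (Tagged _ (@ord_max (m i))) <= 1).

Definition Sigma := shiftspace (LGdigit m).
Definition Sigma_v := shiftspace (vrow p).

Definition piv (w : Sigma) : Sigma_v := fun k => tag (w k).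

Definition Smap (ij : LGdigit m) (z : R * R) : R * R :=
  (a ij * z.1 + c ij, b (tag ij) * z.2 + d (tag ij)).

Fixpoint Scomp (w : Sigma) (n : nat) (z : R * R) : R * R :=
  match n with
  | 0 => z
  | n'.+1 => Scomp w n' (Smap (w n') z)
  end.

Definition unit_square : set (R * R) :=
  [set z | 0 <= z.1 <= 1 /\ 0 <= z.2 <= 1].

(* Pi w = the (unique) point of  /\_n S_{w_0} o ... o S_{w_(n-1)}([0,1]^2) *)
Definition Pi (w : Sigma) : R * R :=
  xget (0, 0) [set z | forall n, z \in Scomp w n @` unit_square].

Definition lyap (mu : probability Sigma R) (n : nat) : R :=
  - fine (\int[mu]_w (ln (\prod_(k < n) a (w k)))%:E)%E.
Definition lyap_v (mu : probability Sigma R) (n : nat) : R :=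
  - fine (\int[mu]_w (ln (\prod_(k < n) b (tag (w k))))%:E)%E.

Definition ent (mu : probability Sigma R) (n : nat) : R :=
  ks_entropy (fun B : set Sigma => fine (mu B)) (iter n sshift).
Definition ent_v (mu : probability Sigma R) (n : nat) : R :=
  ks_entropy (fun B : set Sigma_v => fine (mu (piv @^-1` B))) (iter n sshift).

Definition DLYn (mu : probability Sigma R) (n : nat) : R :=
  ent mu n / lyap mu n + ((lyap_v mu n)^-1 - (lyap mu n)^-1) * ent_v mu n.
Definition DLY (mu : probability Sigma R) : R := DLYn mu 1.

Definition level_set (phi : Sigma -> R) (alpha : R) : set Sigma :=
  [set w | (fun n : nat => n%:R^-1 * \sum_(l < n) phi (iter l sshift w))
             @ \oo --> alpha].
Definition Lambda_level (phi : Sigma -> R) (alpha : R) : set (R * R) :=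
  Pi @` level_set phi alpha.

Definition alpha_min (phi : Sigma -> R) : \bar R :=
  ereal_inf [set (\int[mu]_w (phi w)%:E)%E
            | mu in [set mu : probability Sigma R | is_invariant mu sshift]].
Definition alpha_max (phi : Sigma -> R) : \bar R :=
  ereal_sup [set (\int[mu]_w (phi w)%:E)%E
            | mu in [set mu : probability Sigma R | is_invariant mu sshift]].

End LG.

(* Main.v *)
Require Import Defs.
From HB Require Import structures.
From mathcomp Require Import all_boot all_order all_algebra.
From mathcomp Require Import all_classical all_reals all_analysis.
From mathcomp Require Import measurable_realfun.
From mathcomp Require Import ring lra zify.
Set Implicit Arguments.
Unset Strict Implicit.
Unset Printing Implicit Defensive.
Import Order.TTheory GRing.Theory Num.Theory.
Import numFieldNormedType.Exports.
Local Open Scope classical_set_scope.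
Local Open Scope ring_scope.

(** A shift-invariant measure is encoded by the weights [q w] it gives to the cylinders [w]; the invariant weights
    form a compact convex set.  The entropy of the shift is the limit of [Hent q n / n], and [D_LY] becomes
    [Dim q = relh q / lambda + hv / lambda_v], where [relh] is the entropy relative to the row factor.  Along powers
    of two [Dim] is the decreasing limit of the continuous functionals [Dk q k], so it is upper semicontinuous.

    Upper bound: the empirical weights of a point of the level set accumulate only at invariant weights of integral
    [alpha], so [Dk] of them is eventually below any [s > sup Dim].  Products of the finitely many empirical block
    kernels of length [n] give the approximate square of the point a weight of about [exp (- s Lam n)], up to the
    change of the row entropy between the width index [n] and the height index [stop n]; that change is at most
    [eps] for infinitely many [n].  Covering by these squares shows that the [s]-dimensional measure is [0].

    Lower bound: conditioning a product of block laws of [q] on the event of Chebyshev's inequality gives long words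
    with the entropies and all Birkhoff sums of [q] up to [eps].  Concatenating such words independently, with [eps]
    tending to [0] slowly, gives a measure on the level set for which an approximate square of size [r] has mass at
    most [r ^ (Dim q - o(1))], and the mass distribution principle applies.

    Continuity: upper semicontinuity by compactness; lower semicontinuity because [(1 - t) q0 + t q1] has at least
    [1 - t] times the entropies of [q0]. *)

(** * Words and weights *)

(** A measure with integral [alpha] need not be ergodic, and the Birkhoff averages of its typical
    points may differ from [alpha]. The lower bound therefore uses only finite block laws of [q]:
    independent blocks obey the law of large numbers whatever [q] is, and the entropy of a block of
    length [k] is at least [k] times the entropy of [q]. No ergodic approximation has to be found.

    The obstacle of the upper bound is that an approximate square lives at two times: all symbols up
    to [n], which fix its width, and the rows up to [stop n], which fix its height. Each summand of
    [Dim] is the cost of one of these descriptions, but the empirical weights at the two times may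
    differ. Boundedness of the row term only gives times of near agreement infinitely often; that
    suffices for Hausdorff measure, where a point has to be covered at arbitrarily small scales and
    not at all of them.

    The Kolmogorov-Sinai entropy is a supremum over all finite measurable partitions, so the
    partition into letters must first be shown to attain it. In the other direction, optimal weights
    have to be realized by actual Borel measures. *)

Section Words.
Variable A : finType.

Fixpoint words (n : nat) : seq (seq A) :=
  if n is n'.+1 then [seq a :: w | a <- enum A, w <- words n'] else [:: [::]].

Arguments words : simpl never.

Lemma mem_words n w : (w \in words n) = (size w == n).
Proof.
elim: n w => [|n IH] [|x w] //=; first by rewrite /words -/words; apply/allpairsP => -[[a u] []].
rewrite /words -/words; apply/allpairsP/eqP => [[[a u] [/= _ + [_ ->]]]|[sw]].
  by rewrite IH => /eqP ->.
by exists (x, w); rewrite mem_enum IH sw.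
Qed.

Lemma words_uniq n : uniq (words n).
Proof.
elim: n => // n IH; rewrite /words -/words; apply: allpairs_uniq => //; first exact: enum_uniq.
by move=> [a u] [b v] _ _ [-> ->].
Qed.

Section Sums.
Variable V : nmodType.
Implicit Type F : seq A -> V.

Lemma big_words0 F : \sum_(w <- words 0) F w = F [::].
Proof. by rewrite big_seq1. Qed.

Lemma big_wordsS n F :
  \sum_(w <- words n.+1) F w = \sum_a \sum_(w <- words n) F (a :: w).
Proof. by rewrite /words -/words big_allpairs_dep big_enum. Qed.

Lemma big_words_cat n m F :
  \sum_(w <- words (n + m)) F w =
  \sum_(u <- words n) \sum_(v <- words m) F (u ++ v).
Proof.
elim: n F => [|n IH] F; first by rewrite big_words0.
by rewrite addSn !big_wordsS; apply: eq_bigr => a _; rewrite IH.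
Qed.

Lemma big_words1 F : \sum_(w <- words 1) F w = \sum_a F [:: a].
Proof. by rewrite big_wordsS; under eq_bigr do rewrite big_words0. Qed.

Lemma big_words_rcons n F :
  \sum_(w <- words n.+1) F w = \sum_(w <- words n) \sum_a F (rcons w a).
Proof.
rewrite -addn1 big_words_cat; apply: eq_bigr => w _.
by rewrite big_words1; under eq_bigr do rewrite cats1.
Qed.

Lemma eq_words n F G :
  (forall w, size w = n -> F w = G w) ->
  \sum_(w <- words n) F w = \sum_(w <- words n) G w.
Proof. by move=> FG; apply: eq_big_seq => w; rewrite mem_words => /eqP/FG. Qed.

End Sums.

Lemma le_words (R : numDomainType) n (F G : seq A -> R) :
  (forall w, size w = n -> F w <= G w) ->
  \sum_(w <- words n) F w <= \sum_(w <- words n) G w.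
Proof.
by move=> FG; rewrite big_seq [leRHS]big_seq; apply: ler_sum => w; rewrite mem_words => /eqP/FG.
Qed.

Lemma big_words_delta (R : pzSemiRingType) n (F : seq A -> R) (u : seq A) : size u = n ->
  \sum_(w <- words n) (w == u)%:R * F w = F u.
Proof.
move=> su; rewrite (bigD1_seq u) ?words_uniq ?mem_words ?su//= eqxx mul1r.
by rewrite big1 ?addr0// => w /negbTE ->; rewrite mul0r.
Qed.

End Words.
Arguments words : simpl never.

Section FiberSums.
Variables (A B : finType) (pi : A -> B).

Lemma big_words_fiber (V : nmodType) n (F : seq A -> V) :
  \sum_(w <- words A n) F w =
  \sum_(z <- words B n) \sum_(w <- words A n | map pi w == z) F w.
Proof.
rewrite (exchange_big_dep predT)//= [LHS]big_seq [RHS]big_seq; apply: eq_bigr => w.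
rewrite mem_words => /eqP sw; rewrite big_mkcond (bigD1_seq (map pi w)) ?words_uniq ?mem_words ?size_map ?sw//=.
by rewrite eqxx big1 ?addr0// => z; rewrite eq_sym => /negbTE ->.
Qed.

Lemma big_fiber_cat (V : nmodType) n m (z1 z2 : seq B) (F : seq A -> V) :
  size z1 = n ->
  \sum_(w <- words A (n + m) | map pi w == z1 ++ z2) F w =
  \sum_(u <- words A n | map pi u == z1)
    \sum_(v <- words A m | map pi v == z2) F (u ++ v).
Proof.
move=> s1; rewrite big_mkcond big_words_cat [RHS]big_mkcond; apply: eq_big_seq => u.
rewrite mem_words => /eqP su; case: ifPn => uz; last first.
  rewrite big1// => v _; rewrite map_cat eqseq_cat ?size_map ?su//.
  by rewrite (negbTE uz).
rewrite [RHS]big_mkcond; apply: eq_bigr => v _.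
by rewrite map_cat eqseq_cat ?size_map ?su// uz.
Qed.

Lemma big_fiber_cons (V : nmodType) n b (z : seq B) (F : seq A -> V) :
  \sum_(w <- words A n.+1 | map pi w == b :: z) F w =
  \sum_(a | pi a == b) \sum_(v <- words A n | map pi v == z) F (a :: v).
Proof.
rewrite big_mkcond big_wordsS [RHS]big_mkcond; apply: eq_bigr => a _ /=.
rewrite (eq_bigr (fun w => if (pi a == b) && (map pi w == z) then F (a :: w) else 0)) //.
by case: ifPn => ab /=; [rewrite [RHS]big_mkcond | rewrite big1].
Qed.

End FiberSums.

Section Weights.
Context {R : realType}.

Record weight (A : finType) (q : seq A -> R) : Prop := Weight {
  weight1 : q [::] = 1;
  weight_ge0 : forall w, 0 <= q w;
  weight_rcons : forall w, q w = \sum_a q (rcons w a) }.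

(** Summing over the last letter is consistency of cylinder weights; summing over the first one is
    invariance under the shift. *)
Record inv_weight (A : finType) (q : seq A -> R) : Prop := InvWeight {
  inv_weight_weight :> weight q;
  weight_cons : forall w, q w = \sum_a q (a :: w) }.

Section OneAlphabet.
Variables (A : finType) (q : seq A -> R).

Lemma weight_cat u n : weight q -> q u = \sum_(v <- words A n) q (u ++ v).
Proof.
move=> qw; elim: n u => [|n IH] u; first by rewrite big_words0 cats0.
rewrite (weight_rcons qw) big_wordsS; apply: eq_bigr => a _.
by rewrite IH; apply: eq_bigr => v _; rewrite cat_rcons.
Qed.

Lemma weight_catl v n : inv_weight q -> q v = \sum_(u <- words A n) q (u ++ v).
Proof.
move=> qw; elim: n v => [|n IH] v; first by rewrite big_words0.
rewrite big_wordsS (IH v) exchange_big; apply: eq_bigr => u _.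
by rewrite (weight_cons qw).
Qed.

Lemma weight_sum n : weight q -> \sum_(w <- words A n) q w = 1.
Proof. by move=> qw; rewrite -(weight1 qw) (weight_cat [::] n). Qed.

Lemma weight_le_take w n : weight q -> q w <= q (take n w).
Proof.
move=> qw; rewrite (weight_cat (take n w) (size w - n) qw).
rewrite (bigD1_seq (drop n w)) ?words_uniq ?mem_words ?size_drop//= cat_take_drop.
by rewrite lerDl sumr_ge0// => v _; exact: weight_ge0.
Qed.

Lemma weight_le1 w : weight q -> q w <= 1.
Proof. by move=> qw; rewrite -(weight1 qw) -(take0 w) weight_le_take. Qed.

End OneAlphabet.

Definition marg (A B : finType) (pi : A -> B) (q : seq A -> R) (z : seq B) : R :=
  \sum_(w <- words A (size z) | map pi w == z) q w.

Section Marginals.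
Variables (A B : finType) (pi : A -> B) (q : seq A -> R).

Lemma marg_sum n (G : seq B -> R) :
  \sum_(z <- words B n) marg pi q z * G z = \sum_(w <- words A n) q w * G (map pi w).
Proof.
rewrite (big_words_fiber pi); apply: eq_words => z sz.
rewrite /marg sz mulr_suml; apply: eq_bigr => w /eqP -> //.
Qed.

Lemma le_marg w : (forall w, 0 <= q w) -> q w <= marg pi q (map pi w).
Proof.
move=> q0; rewrite /marg size_map big_mkcond (bigD1_seq w) ?words_uniq ?mem_words//=.
by rewrite eqxx lerDl sumr_ge0// => v _; case: ifP.
Qed.

Lemma marg_weight : weight q -> weight (marg pi q).
Proof.
move=> qw; split.
- by rewrite /marg big_mkcond big_words0 (weight1 qw).
- by move=> w; apply: sumr_ge0 => v _; exact: weight_ge0.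
- move=> z; rewrite /marg; under eq_bigr do rewrite (weight_rcons qw).
  under [RHS]eq_bigr => b _.
    rewrite size_rcons -addn1 -cats1 (big_fiber_cat _ _ _ _ (erefl (size z))).
    over.
  rewrite [RHS]exchange_big /=; apply: eq_bigr => w _.
  rewrite (eq_bigr (fun b => \sum_(a | pi a == b) q (rcons w a))).
    by rewrite (partition_big pi predT).
  move=> b _; rewrite big_fiber_cons; apply: eq_bigr => a _.
  by rewrite big_mkcond big_words0 /= cats1.
Qed.

Lemma marg_inv_weight : inv_weight q -> inv_weight (marg pi q).
Proof.
move=> qw; split; first exact/marg_weight/inv_weight_weight.
move=> z; rewrite /marg; under [RHS]eq_bigr do rewrite big_fiber_cons.
have := partition_big (op := +%R) (idx := 0) pi predT (P := predT)
  (F := fun a => \sum_(v <- words A (size z) | map pi v == z) q (a :: v)).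
rewrite /= => <- //; rewrite exchange_big/=; apply: eq_bigr => w _; exact: weight_cons.
Qed.

End Marginals.

(** Each term is controlled by [ln x <= x - 1] at [x = k i / p i]. Where [p i = 0] both logarithmic
    terms vanish, so [k i] has to be positive only where [p i] is. *)
Lemma gibbs (I : Type) (r : seq I) (P : pred I) (p k : I -> R) :
  (forall i, P i -> 0 <= p i) -> (forall i, P i -> 0 <= k i) ->
  (forall i, P i -> 0 < p i -> 0 < k i) ->
  \sum_(i <- r | P i) k i <= \sum_(i <- r | P i) p i ->
  \sum_(i <- r | P i) p i * ln (k i) <= \sum_(i <- r | P i) p i * ln (p i).
Proof.
move=> p0 k0 pk kp; rewrite -subr_le0 -sumrB.
apply: (@le_trans _ _ (\sum_(i <- r | P i) (k i - p i))); last first.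
  by rewrite sumrB subr_le0.
apply: ler_sum => i Pi; have := p0 i Pi; rewrite le_eqVlt => /predU1P[<-|pi0].
  by rewrite !mul0r !subr0 k0.
have ki0 := pk i Pi pi0.
rewrite -mulrBr -ln_div ?posrE//.
have -> : k i / p i = 1 + (k i / p i - 1) by ring.
apply: (@le_trans _ _ (p i * (k i / p i - 1))).
  apply: ler_wpM2l; first exact: ltW.
  apply: le_ln1Dx.
  by rewrite ltrBrDr addNr divr_gt0.
by rewrite mulrBr mulrCA divff ?gt_eqF// !mulr1.
Qed.

Section Entropy.
Variables (A B : finType) (pi : A -> B).
Implicit Type q : seq A -> R.

(* The entropy of the [n]-words conditional on their images under [pi]. *)
Definition relH q (n : nat) : R :=
  - \sum_(w <- words A n) q w * ln (q w / marg pi q (map pi w)).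

(** The total mass of [k w * marg pi q (map pi w)] is at most 1, so Gibbs' inequality applies to it.
    Later bounds come from a choice of kernel: a product of kernels for subadditivity, a guessing
    rule for the generator theorem, the kernel of a mixture for concavity. *)
Lemma relH_gibbs q n (k : seq A -> R) :
  (forall w, 0 <= q w) -> (forall w, size w = n -> 0 <= k w) ->
  (forall w, size w = n -> 0 < q w -> 0 < k w) ->
  (forall z, size z = n -> \sum_(w <- words A n | map pi w == z) k w <= 1) ->
  relH q n <= - \sum_(w <- words A n) q w * ln (k w).
Proof.
move=> q0 k0 qk k1; rewrite /relH lerN2.
have key : \sum_(w <- words A n) q w * ln (k w * marg pi q (map pi w)) <=
          \sum_(w <- words A n) q w * ln (q w).
  rewrite big_seq [leRHS]big_seq; apply: gibbs => //.
  - by move=> w; rewrite mem_words => /eqP sw; rewrite mulr_ge0 ?k0// (le_trans (q0 w))// le_marg.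
  - move=> w; rewrite mem_words => /eqP sw qw; rewrite mulr_gt0 ?qk//.
    by rewrite (lt_le_trans qw)// le_marg.
  - rewrite -!big_seq; apply: (@le_trans _ _ (\sum_(z <- words B n) marg pi q z)).
      rewrite (big_words_fiber pi); apply: le_words => z sz.
      rewrite (eq_bigr (fun w => k w * marg pi q z)); last by move=> w /eqP ->.
      rewrite -mulr_suml ler_piMl ?k1//.
      by apply: sumr_ge0.
    rewrite le_eqVlt; apply/orP; left; apply/eqP.
    have := marg_sum pi q n (fun=> 1).
    by under [in X in X = _ -> _]eq_bigr do rewrite mulr1; under [in X in _ = X -> _]eq_bigr do rewrite mulr1.
have split_ln (f : seq A -> R) : (forall w, size w = n -> 0 < q w -> 0 < f w) ->
    forall w, size w = n -> q w * ln (f w * marg pi q (map pi w)) =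
      q w * ln (f w) + q w * ln (marg pi q (map pi w)).
  move=> f0 w sw; have := q0 w; rewrite le_eqVlt => /predU1P[<-|qw].
    by rewrite !mul0r addr0.
  by rewrite lnM ?posrE ?f0 ?mulrDr// (lt_le_trans qw)// le_marg.
rewrite (eq_words (split_ln _ qk)) in key.
rewrite big_split/= in key.
apply: (@le_trans _ _ (\sum_(w <- words A n) q w * ln (q w) -
    \sum_(w <- words A n) q w * ln (marg pi q (map pi w)))); first lra.
rewrite -sumrB; apply: ler_sum => w _; have := q0 w; rewrite le_eqVlt => /predU1P[<-|qw].
  by rewrite !mul0r subr0.
rewrite lnM ?posrE ?invr_gt0 ?(lt_le_trans qw) ?le_marg//.
by rewrite lnV ?posrE ?(lt_le_trans qw) ?le_marg// mulrBr.
Qed.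

Lemma kernel_ge0 q w : (forall w, 0 <= q w) -> 0 <= q w / marg pi q (map pi w).
Proof. by move=> q0; rewrite divr_ge0// sumr_ge0. Qed.

Lemma kernel_gt0 q w : (forall w, 0 <= q w) -> 0 < q w -> 0 < q w / marg pi q (map pi w).
Proof. by move=> q0 qw; rewrite divr_gt0// (lt_le_trans qw)// le_marg. Qed.

Lemma kernel_le1 q w : (forall w, 0 <= q w) -> q w / marg pi q (map pi w) <= 1.
Proof.
move=> q0; have := le_marg pi w q0.
have [->|m0 le_m] := eqVneq (marg pi q (map pi w)) 0; first by rewrite invr0 mulr0.
by rewrite ler_pdivrMr ?mul1r// lt_neqAle eq_sym m0 sumr_ge0.
Qed.

(* The sum is [0] on a fiber of zero mass, hence the inequality. *)
Lemma kernel_sum q n z : size z = n -> (forall w, 0 <= q w) ->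
  \sum_(w <- words A n | map pi w == z) q w / marg pi q (map pi w) <= 1.
Proof.
move=> sz q0; rewrite (eq_bigr (fun w => q w / marg pi q z)); last by move=> w /eqP ->.
rewrite -mulr_suml {1}/marg sz.
have [->|m0] := eqVneq (\sum_(w <- words A n | map pi w == z) q w) 0.
  by rewrite mul0r.
by rewrite divff.
Qed.

Lemma relH_ge0 q n : (forall w, 0 <= q w) -> 0 <= relH q n.
Proof.
move=> q0; rewrite oppr_ge0; apply: sumr_le0 => w _.
by rewrite mulr_ge0_le0// ln_le0// kernel_le1.
Qed.

(** The kernel treats the first [n] and the last [m] letters separately. By invariance the last [m]
    letters again have the law [q], so the cross entropy is exactly the sum of the two entropies. *)
Lemma relH_subadd q n m : inv_weight q -> relH q (n + m) <= relH q n + relH q m.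
Proof.
move=> qw; have q0 := weight_ge0 qw.
pose K w := q w / marg pi q (map pi w).
have K0 w : 0 <= K w by exact: kernel_ge0.
have Kp w : 0 < q w -> 0 < K w by exact: kernel_gt0.
apply: (le_trans (@relH_gibbs q (n + m) (fun w => K (take n w) * K (drop n w)) q0 _ _ _)).
- by move=> w _; rewrite mulr_ge0.
- move=> w sw qw0; rewrite mulr_gt0//.
    by rewrite Kp// (lt_le_trans qw0)//; exact: (weight_le_take w n qw).
  rewrite Kp// (lt_le_trans qw0)//.
  rewrite (@weight_catl _ _ (drop n w) (size (take n w)) qw).
  rewrite (bigD1_seq (take n w)) ?words_uniq ?mem_words//= cat_take_drop.
  by rewrite lerDl sumr_ge0.
- move=> z sz; rewrite -{1}(cat_take_drop n z).
  have stz : size (take n z) = n by rewrite size_take sz; case: ltnP; lia.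
  rewrite (big_fiber_cat _ _ _ _ stz).
  have sdz : size (drop n z) = m by rewrite size_drop sz; lia.
  apply: (@le_trans _ _ (\sum_(u <- words A n | map pi u == take n z) K u)); last exact: kernel_sum.
  rewrite big_seq_cond [leRHS]big_seq_cond; apply: ler_sum => u /andP[].
  rewrite mem_words => /eqP su _.
  rewrite (eq_bigr (fun v => K u * K v)); last first.
    by move=> v _; rewrite take_size_cat// drop_size_cat.
  by rewrite -mulr_sumr ler_piMr// kernel_sum.
rewrite -opprD lerN2 le_eqVlt; apply/orP; left; apply/eqP.
have lnK w : size w = (n + m)%N -> q w * ln (K (take n w) * K (drop n w)) =
    q w * ln (K (take n w)) + q w * ln (K (drop n w)).
  move=> sw; have := q0 w; rewrite le_eqVlt => /predU1P[<-|qw0]; first by rewrite !mul0r addr0.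
  rewrite lnM ?mulrDr// posrE Kp// (lt_le_trans qw0)//.
    exact: (weight_le_take w n qw).
  rewrite (@weight_catl _ _ (drop n w) (size (take n w)) qw).
  rewrite (bigD1_seq (take n w)) ?words_uniq ?mem_words//= cat_take_drop.
  by rewrite lerDl sumr_ge0.
rewrite (eq_words lnK) big_split/= !big_words_cat; congr (_ + _).
  apply: eq_words => u su; rewrite {1}(weight_cat u m qw) mulr_suml.
  by apply: eq_bigr => v _; rewrite take_size_cat.
rewrite exchange_big/=; apply: eq_words => u su; rewrite {1}(weight_catl u n qw) mulr_suml.
by apply: eq_words => v sv; rewrite drop_size_cat.
Qed.

End Entropy.

Definition Hent (A : finType) (q : seq A -> R) (n : nat) : R :=
  - \sum_(w <- words A n) q w * ln (q w).

(** Over a one-point factor all words of length [n] form one fiber of mass 1; plain entropy thus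
    inherits the properties of relative entropy. *)
Lemma Hent_relH (A : finType) (q : seq A -> R) n : weight q ->
  Hent q n = relH (fun=> tt) q n.
Proof.
move=> qw; rewrite /Hent /relH; congr (- _); apply: eq_words => w sw.
rewrite /marg size_map sw big_mkcond.
have -> : \sum_(v <- words A n) (if map (fun=> tt) v == map (fun=> tt) w then q v else 0) = 1.
  rewrite -[RHS](weight_sum n qw); apply: eq_words => v sv; rewrite ifT//.
  apply/eqP; have : size v = size w by rewrite sv sw.
  by elim: v w {sw sv} => [|x v IH] [|y w]//= [/IH ->].
by rewrite divr1.
Qed.

Lemma Hent_chain (A B : finType) (pi : A -> B) (q : seq A -> R) n :
  (forall w, 0 <= q w) -> Hent q n = relH pi q n + Hent (marg pi q) n.
Proof.
move=> q0; rewrite /Hent /relH (marg_sum pi q n (fun z => ln (marg pi q z))).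
rewrite -opprD -big_split/=; congr (- _); apply: eq_bigr => w _.
have := q0 w; rewrite le_eqVlt => /predU1P[<-|qw]; first by rewrite !mul0r addr0.
have mw : 0 < marg pi q (map pi w) by rewrite (lt_le_trans qw)// le_marg.
by rewrite lnM ?posrE ?invr_gt0// lnV ?posrE// mulrDr mulrN subrK.
Qed.

Lemma Hent_ge0 (A : finType) (q : seq A -> R) n : weight q -> 0 <= Hent q n.
Proof. by move=> qw; rewrite Hent_relH// relH_ge0//; exact: weight_ge0. Qed.

Lemma Hent_subadd (A : finType) (q : seq A -> R) n m : inv_weight q ->
  Hent q (n + m) <= Hent q n + Hent q m.
Proof. by move=> qw; rewrite !Hent_relH ?relH_subadd//; exact: qw. Qed.

Lemma subadd_mul (u : nat -> R) k n :
  (forall n m, u (n + m)%N <= u n + u m) -> u (k * n.+1)%N <= n.+1%:R * u k.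
Proof.
move=> uD; elim: n => [|n IH]; first by rewrite muln1 mul1r.
rewrite mulnS; apply: (le_trans (uD _ _)).
by rewrite [in leRHS]mulrS mulrDl mul1r lerD2l.
Qed.

(** The limit is the infimum of the averages. A long [n] is cut into copies of a nearly optimal [k]
    and a remainder shorter than [k], on which [u] is bounded by [C]. *)
Lemma fekete (u : nat -> R) :
  (forall n, 0 <= u n) -> (forall n m, u (n + m)%N <= u n + u m) ->
  exists l : R, [/\ (fun n : nat => n%:R^-1 * u n) @ \oo --> l, 0 <= l &
    forall n, (0 < n)%N -> l <= n%:R^-1 * u n].
Proof.
move=> u0 uD.
pose E : set R := [set x | exists2 n, (0 < n)%N & x = n%:R^-1 * u n].
have E0 : E !=set0 by exists (1%:R^-1 * u 1%N), 1%N.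
have lbE : lbound E 0 by move=> _ [n _ ->]; rewrite mulr_ge0.
have infE n : (0 < n)%N -> inf E <= n%:R^-1 * u n.
  by move=> n0; apply: ge_inf; [exists 0|exists n].
exists (inf E); split => //; last exact: lb_le_inf.
apply/cvgrPdist_le => e e0.
have [_ [k k0 ->] uk] : exists2 x, E x & x < inf E + e / 2.
  by apply: inf_adherent; [rewrite divr_gt0|split=> //; exists 0].
have [C C0 uC] : exists2 C, 0 <= C & forall r, (r < k)%N -> u r <= C.
  exists (\sum_(r < k) u r); first exact: sumr_ge0.
  move=> r rk; rewrite (bigD1 (Ordinal rk))//= lerDl; exact: sumr_ge0.
near=> n.
have n0 : (0 < n)%N by near: n; exists 1%N.
have nk : (k <= n)%N by near: n; exists k.
have Cn : n%:R^-1 * C <= e / 2.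
  rewrite mulrC ler_pdivrMr ?ltr0n// mulrC -ler_pdivrMr ?divr_gt0//.
  by near: n; exact: nbhs_infty_ger.
rewrite ler_norml; apply/andP; split; last first.
  by rewrite lerBlDr (le_trans (infE n n0))// lerDr ltW.
suff : n%:R^-1 * u n <= inf E + e by lra.
have un : u n <= (n %/ k)%:R * u k + C.
  rewrite [in leLHS](divn_eq n k) (le_trans (uD _ _))// lerD// ?uC ?ltn_mod//.
  rewrite mulnC -[(n %/ k)%N]prednK ?divn_gt0//; exact: subadd_mul.
apply: (@le_trans _ _ (n%:R^-1 * ((n %/ k)%:R * u k) + e / 2)).
  by rewrite (le_trans _ (lerD (lexx _) Cn))// -mulrDr ler_wpM2l.
suff : n%:R^-1 * ((n %/ k)%:R * u k) <= k%:R^-1 * u k by move: uk; lra.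
rewrite mulrA ler_wpM2r// mulrC ler_pdivrMr ?ltr0n// mulrC ler_pdivlMr ?ltr0n//.
by rewrite -natrM ler_nat leq_divM.
Unshelve. all: by end_near.
Qed.

End Weights.

(** * Limits of weights *)

Section Ultrafilter.

(** Limits along this ultrafilter replace the extraction of subsequences: every bounded sequence
    converges along it, so the weights of all words converge simultaneously without a diagonal
    argument. *)
Lemma ultra_nat : exists F : set_system nat, UltraFilter F /\ \oo `<=` F.
Proof. exact: ultraFilterLemma. Qed.

Lemma ultra_fin (F : set_system nat) (A : finType) (f : nat -> A) :
  UltraFilter F -> exists a, F [set n | f n = a].
Proof.
move=> UF; apply: contrapT => /forallNP H.
have HF (s : seq A) : F [set n | f n \notin s].
  elim: s => [|a s IH]; first exact: filterE.
  have [/H//|Fa] := in_ultra_setVsetC [set n | f n = a] UF.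
  apply: filterS (filterI Fa IH) => n /= [/eqP fa fs].
  by rewrite inE negb_or fa.
have /filter_ex[n /=] := HF (enum A).
by rewrite mem_enum.
Qed.

Lemma ultra_bounded {R : realType} (F : set_system nat) (u : nat -> R) (a b : R) :
  UltraFilter F -> (forall n, a <= u n <= b) -> exists l : R, u @ F --> l.
Proof.
move=> UF uab; have UP : ProperFilter (u @ F) by exact: fmap_proper_filter.
have Fab : (u @ F) `[a, b]%classic.
  by apply: (@filterE _ F) => n /=; rewrite in_itv/= uab.
have [l [_ cl]] := segment_compact UP Fab.
exists l => V Vl; have [//|FV] := in_ultra_setVsetC (u @^-1` V) UF.
have [x [/= nVx Vx]] := cl (~` V) V FV Vl.
by [].
Qed.

End Ultrafilter.

Section SeqLimits.
Context {R : realType}.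

Lemma cvg_sumr (T I : Type) (F : set_system T) {FF : Filter F} (r : seq I) (P : pred I)
    (f : I -> T -> R) (l : I -> R) :
  (forall i, P i -> f i @ F --> l i) ->
  (fun x => \sum_(i <- r | P i) f i x) @ F --> \sum_(i <- r | P i) l i.
Proof. by move=> H; apply: cvg_big => //; exact: add_continuous. Qed.

Lemma cvgr_unique (T : Type) (F : set_system T) {FF : ProperFilter F} (f : T -> R) (a b : R) :
  f @ F --> a -> f @ F --> b -> a = b.
Proof. by move=> /cvg_lim <- // /cvg_lim <-. Qed.

(** Applying [ln y < y] to the inverse square root of [x] gives a bound that tends to 0 at 0, which
    yields continuity of [x * ln x] there. The square handles [x >= 1]. *)
Lemma xlnx_bound (x : R) : 0 <= x -> `|x * ln x| <= 2 * Num.sqrt x + x ^+ 2.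
Proof.
rewrite le_eqVlt => /predU1P[<-|x0].
  by rewrite mul0r normr0 sqrtr0 mulr0 add0r expr2 mul0r.
have s0 : 0 < Num.sqrt x by rewrite sqrtr_gt0.
rewrite normrM (gtr0_norm x0); have [x1|x1] := leP 1 x.
  rewrite ger0_norm ?ln_ge0//; apply: (@le_trans _ _ (x ^+ 2)).
    by rewrite expr2 ler_pM2l// ltW// ln_sublinear.
  by rewrite lerDr mulr_ge0// ltW.
rewrite ler0_norm; last by rewrite ln_le0 ?ltW.
apply: (@le_trans _ _ (2 * Num.sqrt x)); last by rewrite lerDl sqr_ge0.
have xs : x = Num.sqrt x ^+ 2 by rewrite sqr_sqrtr// ltW.
have -> : x * - ln x = 2 * Num.sqrt x * (Num.sqrt x * ln (Num.sqrt x)^-1).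
  by rewrite {1 2}xs lnXn// lnV ?posrE// mulr2n; ring.
rewrite ler_piMr// ?mulr_ge0 ?(ltW s0)// mulrC -ler_pdivlMr// div1r ltW// ln_sublinear// invr_gt0//.
Qed.

Lemma xlnx_cvg (T : Type) (F : set_system T) {FF : ProperFilter F} (f : T -> R) (l : R) :
  (forall t, 0 <= f t) -> f @ F --> l ->
  (fun t => f t * ln (f t)) @ F --> l * ln l.
Proof.
move=> f0 fl; have l0 : 0 <= l by apply: (cvgr_to_ge fl); exact: nearW.
move: l0; rewrite le_eqVlt => /predU1P[l0|l0]; last first.
  have fln : (@ln R \o f) @ F --> ln l by apply: cvg_comp fl _; exact: continuous_ln.
  exact: cvgM fl fln.
rewrite -l0 mul0r; rewrite -l0 in fl.
apply: norm_cvg0; apply: (@squeeze_cvgr _ _ _ _ (fun=> 0) (fun t => 2 * Num.sqrt (f t) + (f t) ^+ 2)).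
- by apply: nearW => t; rewrite normr_ge0 xlnx_bound.
- exact: cvg_cst.
- rewrite -[X in _ --> X]addr0; apply: cvgD.
    rewrite -[X in _ --> X](mulr0 2); apply: cvgM; first exact: cvg_cst.
    rewrite -[X in _ --> X](@sqrtr0 R).
    by apply: cvg_comp fl _; exact: sqrt_continuous.
  by rewrite -[X in _ --> X](mul0r 0); apply: cvgM.
Qed.

End SeqLimits.

Section WeightLimits.
Context {R : realType} {A : finType}.
Variables (F : set_system nat).
Context {FF : ProperFilter F}.
Variables (Q : nat -> seq A -> R) (q : seq A -> R).
Hypothesis Qw : forall i, weight (Q i).
Hypothesis Qq : forall w, Q^~ w @ F --> q w.

Lemma weight_lim : weight q.
Proof.
split.
- apply: cvgr_unique (@Qq [::]) _.
  by under eq_cvg do rewrite (weight1 (Qw _)); exact: cvg_cst.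
- by move=> w; apply: (cvgr_to_ge (@Qq w)); apply: nearW => i; exact: weight_ge0.
- move=> w; apply: cvgr_unique (@Qq w) _.
  by under eq_cvg do rewrite (weight_rcons (Qw _)); apply: cvg_sumr.
Qed.

(** Invariance is required only in the limit, because empirical weights satisfy it only up to an
    error [1 / n]. *)
Lemma inv_weight_lim :
  (forall w, (fun i => Q i w - \sum_a Q i (a :: w)) @ F --> 0) -> inv_weight q.
Proof.
move=> H; split; first exact: weight_lim.
move=> w; apply/eqP; rewrite -subr_eq0; apply/eqP.
apply: cvgr_unique _ (@H w).
by apply: cvgB => //; apply: cvg_sumr.
Qed.

Lemma Hent_lim k : (fun i => Hent (Q i) k) @ F --> Hent q k.
Proof.
apply: cvgN; apply: cvg_sumr => w _; apply: xlnx_cvg => // i; exact: weight_ge0.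
Qed.

End WeightLimits.

Lemma weight_compact {R : realType} {A : finType} (Q : nat -> seq A -> R) :
  (forall i, weight (Q i)) ->
  exists F : set_system nat, exists q : seq A -> R,
    [/\ ProperFilter F, \oo `<=` F & forall w, Q^~ w @ F --> q w].
Proof.
move=> Qw; have [F [UF oF]] := ultra_nat.
have H w : exists l : R, Q^~ w @ F --> l.
  by apply: (@ultra_bounded _ F _ 0 1) => // i; rewrite weight_ge0 ?weight_le1.
by have /choice[q qP] := H; exists F, q; split => //; exact: ultra_proper.
Qed.

Lemma inv_weight_compact {R : realType} {A : finType} (Q : nat -> seq A -> R) : (forall i, inv_weight (Q i)) ->
  exists (F : set_system nat) (q : seq A -> R),
    [/\ ProperFilter F, \oo `<=` F, forall w, Q^~ w @ F --> q w & inv_weight q].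
Proof.
move=> Qi; have Qw i : weight (Q i) by exact: Qi.
have [F [q [FF oF Qq]]] := weight_compact Qw; exists F, q; split => //.
apply: (inv_weight_lim Qw Qq) => w.
have -> : (fun i => Q i w - \sum_a Q i (a :: w)) = fun=> 0.
  by apply/funext => i; rewrite -(weight_cons (Qi i)) subrr.
exact: cvg_cst.
Qed.

Section MargLimits.
Context {R : realType} {A B : finType} (pi : A -> B).
Variables (F : set_system nat).
Context {FF : ProperFilter F}.
Variables (Q : nat -> seq A -> R) (q : seq A -> R).
Hypothesis Qw : forall i, weight (Q i).
Hypothesis Qq : forall w, Q^~ w @ F --> q w.

Lemma marg_lim z : (fun i => marg pi (Q i) z) @ F --> marg pi q z.
Proof. by apply: cvg_sumr => w _. Qed.

Lemma Hent_marg_lim k : (fun i => Hent (marg pi (Q i)) k) @ F --> Hent (marg pi q) k.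
Proof.
apply: (@Hent_lim _ _ _ _ (fun i => marg pi (Q i))); last exact: marg_lim.
by move=> i; exact: marg_weight.
Qed.

(** The conditional weight [q w / marg pi q (map pi w)] is discontinuous where the marginal
    vanishes, so the limit is taken in the difference of two plain entropies. *)
Lemma relH_lim k : (fun i => relH pi (Q i) k) @ F --> relH pi q k.
Proof.
have q0 : forall w, 0 <= q w by exact: (weight_ge0 (weight_lim Qw Qq)).
have relE (r : seq A -> R) : (forall w, 0 <= r w) ->
    relH pi r k = Hent r k - Hent (marg pi r) k.
  by move=> r0; rewrite (Hent_chain pi k r0) addrK.
rewrite relE//; have -> : (fun i => relH pi (Q i) k) =
    (fun i => Hent (Q i) k - Hent (marg pi (Q i)) k).
  by apply/funext => i; rewrite relE//; exact: weight_ge0.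
by apply: cvgB; [exact: Hent_lim|exact: Hent_marg_lim].
Qed.

End MargLimits.

(** * Continuous observables and their integrals against weights *)

Section Observables.
Context {R : realType} {A : finType}.
Variable pt : A.
Implicit Types (phi : (nat -> A) -> R) (q : seq A -> R).

Definition osc phi (k : nat) (e : R) := forall x y : nat -> A,
  (forall i, (i < k)%N -> x i = y i) -> `|phi x - phi y| <= e.

Definition unif_cont phi := forall e : R, 0 < e -> exists k, osc phi k e.

Definition pad (w : seq A) : nat -> A := fun n => nth pt w n.

Definition ev q phi (k : nat) : R := \sum_(w <- words A k) q w * phi (pad w).

(** This is the integral of [phi] for the measure encoded by [q]: [ev] integrates the function that
    reads [k] letters and fills the rest with [pt]. *)
Definition integ q phi (I : R) := ev q phi @ \oo --> I.

Lemma osc_mono phi k k' e : (k <= k')%N -> osc phi k e -> osc phi k' e.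
Proof. by move=> kk H x y xy; apply: H => i ik; apply: xy; exact: leq_trans kk. Qed.

Lemma unif_cont_bounded phi : unif_cont phi -> exists M : R, 0 <= M /\ forall x, `|phi x| <= M.
Proof.
move=> /(_ 1 ltr01)[k ok].
exists (1 + \sum_(w <- words A k) `|phi (pad w)|); split.
  by rewrite addr_ge0// sumr_ge0.
move=> x; pose w := mkseq x k.
have sw : size w = k by rewrite size_mkseq.
have xw : `|phi x - phi (pad w)| <= 1.
  by apply: ok => i ik; rewrite /pad nth_mkseq.
have -> : phi x = (phi x - phi (pad w)) + phi (pad w) by rewrite subrK.
rewrite (le_trans (ler_normD _ _))// lerD//.
rewrite (bigD1_seq w) ?words_uniq ?mem_words ?sw//=.
by rewrite lerDl sumr_ge0.
Qed.

Lemma ev_osc q phi k k' e : weight q -> osc phi k e -> (k <= k')%N ->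
  `|ev q phi k' - ev q phi k| <= e.
Proof.
move=> qw ok kk'; rewrite /ev -(subnKC kk') big_words_cat -sumrB.
apply: (le_trans (ler_norm_sum _ _ _)).
apply: (@le_trans _ _ (\sum_(u <- words A k) \sum_(v <- words A (k' - k)) q (u ++ v) * e)).
  apply: le_words => u su; rewrite {1}(weight_cat u (k' - k) qw) mulr_suml -sumrB.
  apply: (le_trans (ler_norm_sum _ _ _)); apply: ler_sum => v _.
  rewrite -mulrBr normrM ger0_norm ?weight_ge0// ler_wpM2l ?weight_ge0// ok// => i ik.
  by rewrite /pad nth_cat su ik.
rewrite (eq_bigr (fun u => q u * e)); last first.
  by move=> u _; rewrite -mulr_suml -weight_cat.
by rewrite -mulr_suml weight_sum// mul1r.
Qed.

Lemma integ_ex q phi : weight q -> unif_cont phi -> exists I, integ q phi I.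
Proof.
move=> qw uc; suff : cvg (ev q phi @ \oo) by move=> /cvg_ex.
apply: cauchy_cvg; apply/cauchy_exP => e e0.
have [k ok] := uc _ (divr_gt0 e0 (ltr0n R 2 : (0 < 2%:R :> R))).
exists (ev q phi k); exists k => // n kn; rewrite /= /ball/= distrC.
by rewrite (le_lt_trans (ev_osc qw ok kn))// ltr_pdivrMr// ltr_pMr// ltr1n.
Qed.

Lemma integ_osc q phi I k e : weight q -> integ q phi I -> osc phi k e ->
  `|ev q phi k - I| <= e.
Proof.
move=> qw qI ok; rewrite distrC.
have cn : `|ev q phi n - ev q phi k| @[n --> \oo] --> `|I - ev q phi k|.
  by apply: cvg_norm; apply: cvgB => //; exact: cvg_cst.
apply: (cvgr_to_le cn).
by exists k => // n kn; exact: ev_osc.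
Qed.

Lemma integP q phi I : weight q -> unif_cont phi ->
  (forall k e, 0 < e -> osc phi k e -> `|ev q phi k - I| <= e) -> integ q phi I.
Proof.
move=> qw uc H; apply/cvgrPdist_le => e e0; have [k ok] := uc e e0.
by exists k => // n kn; rewrite distrC H//; exact: osc_mono ok.
Qed.

(** The error [e] is the oscillation of [phi] over words of length [k], while [d] leaves room for
    integrals of the [Q i] that only tend to [J]. *)
Lemma integ_lim (F : set_system nat) {FF : ProperFilter F} (Q : nat -> seq A -> R) q
    phi (J : R) :
  (forall i, weight (Q i)) -> (forall w, Q^~ w @ F --> q w) -> unif_cont phi ->
  (forall k e, 0 < e -> osc phi k e ->
     forall d, 0 < d -> \forall i \near F, `|ev (Q i) phi k - J| <= e + d) ->
  integ q phi J.
Proof.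
move=> Qw Qq uc H; apply: integP => //; first exact: (weight_lim Qw Qq).
move=> k e e0 ok; apply/ler_addgt0Pr => d d0.
apply: (@cvgr_to_le _ F _ _ (fun i => `|ev (Q i) phi k - J|)); last exact: H.
apply: cvg_norm; apply: cvgB; last exact: cvg_cst.
by apply: cvg_sumr => w _; apply: cvgM => //; exact: cvg_cst.
Qed.

(** Compactness of the shift space: pairs agreeing on longer and longer prefixes while their images
    stay [e] apart have a common limit [z], taken letter by letter along an ultrafilter, and
    continuity at [z] is contradicted. *)
Lemma seq_continuous_unif phi :
  (forall x eps, 0 < eps -> exists n, forall y,
     (forall k, (k < n)%N -> y k = x k) -> `|phi y - phi x| < eps) ->
  unif_cont phi.
Proof.
move=> cphi e e0; apply: contrapT => /forallNP H.
have /choice[xy xyP] : forall k, exists xy : (nat -> A) * (nat -> A),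
    (forall i, (i < k)%N -> xy.1 i = xy.2 i) /\ e < `|phi xy.1 - phi xy.2|.
  move=> k; have /existsNP[x /existsNP[y /not_implyP[xyk /negP]]] := H k.
  by rewrite -ltNge => xye; exists (x, y).
have [F [UF oF]] := ultra_nat.
have /choice[z zP] : forall i, exists a, F [set k | (xy k).1 i = a].
  by move=> i; exact: ultra_fin.
have [n nP] := cphi z _ (divr_gt0 e0 (ltr0n R 2 : (0 < 2%:R :> R))).
have F1 : F [set k | forall i, (i < n)%N -> (xy k).1 i = z i].
  elim: n {nP} => [|n IH]; first exact: filterE.
  apply: filterS (filterI IH (zP n)) => k [/= H1 H2] i.
  by rewrite ltnS leq_eqVlt => /predU1P[->//|/H1].
have F2 : F [set k | (n <= k)%N] by apply: oF; exists n.
have [k [/= k1 k2]] := @filter_ex _ F _ _ (filterI F1 F2).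
have [xyk] := xyP k; apply/negP; rewrite -leNgt.
have -> : phi (xy k).1 - phi (xy k).2 = (phi (xy k).1 - phi z) - (phi (xy k).2 - phi z).
  by rewrite opprB addrA subrK.
rewrite (le_trans (ler_normB _ _))// [leRHS](splitr e) ltW// ltrD// nP// => i ik.
by rewrite -xyk ?k1// (leq_trans ik).
Qed.

End Observables.

(** * The dimension functional *)

Section DimensionFunctional.
Context {R : realType} {A B : finType} (pi : A -> B).
Implicit Types (q : seq A -> R).

Definition relh q : R := limn (fun n : nat => n%:R^-1 * relH pi q n).

Definition hent (C : finType) (q : seq C -> R) : R := limn (fun n : nat => n%:R^-1 * Hent q n).

Lemma relh_spec q : inv_weight q ->
  [/\ (fun n : nat => n%:R^-1 * relH pi q n) @ \oo --> relh q, 0 <= relh q &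
      forall n, (0 < n)%N -> relh q <= n%:R^-1 * relH pi q n].
Proof.
move=> qw; have [||l [cl l0 ll]] := @fekete R (relH pi q).
- by move=> n; apply: relH_ge0; exact: (weight_ge0 qw).
- by move=> n m; exact: relH_subadd.
by rewrite /relh (cvg_lim _ cl).
Qed.

Lemma hent_spec (C : finType) (q : seq C -> R) : inv_weight q ->
  [/\ (fun n : nat => n%:R^-1 * Hent q n) @ \oo --> hent q, 0 <= hent q &
      forall n, (0 < n)%N -> hent q <= n%:R^-1 * Hent q n].
Proof.
move=> qw; have [||l [cl l0 ll]] := @fekete R (Hent q).
- by move=> n; exact: (Hent_ge0 n qw).
- by move=> n m; exact: Hent_subadd.
by rewrite /hent (cvg_lim _ cl).
Qed.

Lemma hent_chain q : inv_weight q -> hent q = relh q + hent (marg pi q).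
Proof.
move=> qw; have [c1 _ _] := hent_spec qw; have [c2 _ _] := relh_spec qw.
have [c3 _ _] := hent_spec (marg_inv_weight pi qw).
apply: cvgr_unique c1 _.
have -> : (fun n : nat => n%:R^-1 * Hent q n) =
    (fun n : nat => n%:R^-1 * relH pi q n + n%:R^-1 * Hent (marg pi q) n).
  by apply/funext => n; rewrite (Hent_chain pi n (weight_ge0 qw)) mulrDr.
exact: cvgD.
Qed.

Definition lyap_w (C : finType) (l : C -> R) (q : seq C -> R) : R := \sum_a q [:: a] * l a.

Lemma lyap_w_bounds (C : finType) (l : C -> R) (q : seq C -> R) l0 l1 : weight q ->
  (forall c, l0 <= l c <= l1) -> l0 <= lyap_w l q <= l1.
Proof.
move=> qw ll; have q1 : \sum_a q [:: a] = 1 by rewrite -big_words1 weight_sum.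
rewrite -[l0]mul1r -[l1]mul1r -q1 !mulr_suml.
by apply/andP; split; apply: ler_sum => c _; rewrite ler_wpM2l ?weight_ge0//; have /andP[] := ll c.
Qed.

Variables (la : A -> R) (lb : B -> R) (l0 l1 : R).
Hypothesis l00 : 0 < l0.
Hypothesis la_bd : forall a, l0 <= la a <= l1.
Hypothesis lb_bd : forall b, l0 <= lb b <= l1.

Definition Dk q (k : nat) : R :=
  (k%:R^-1 * relH pi q k) / lyap_w la q +
  (k%:R^-1 * Hent (marg pi q) k) / lyap_w (lb \o pi) q.

Definition Dim q : R :=
  relh q / lyap_w la q + hent (marg pi q) / lyap_w (lb \o pi) q.

Lemma lyapA_gt0 q : weight q -> 0 < lyap_w la q.
Proof. by move=> qw; have /andP[h _] := lyap_w_bounds qw la_bd; exact: lt_le_trans h. Qed.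

Lemma lyapB_gt0 q : weight q -> 0 < lyap_w (lb \o pi) q.
Proof.
move=> qw; have h : forall a, l0 <= (lb \o pi) a <= l1 by move=> a; exact: lb_bd.
by have /andP[h' _] := lyap_w_bounds qw h; exact: lt_le_trans h'.
Qed.

Lemma Dim_ge0 q : inv_weight q -> 0 <= Dim q.
Proof.
move=> qw; have [_ h1 _] := relh_spec qw; have [_ h2 _] := hent_spec (marg_inv_weight pi qw).
by rewrite addr_ge0// divr_ge0// ltW// ?lyapA_gt0 ?lyapB_gt0//; exact: qw.
Qed.

Lemma Dim_le_Dk q k : inv_weight q -> (0 < k)%N -> Dim q <= Dk q k.
Proof.
move=> qw k0; have [_ _ h1] := relh_spec qw; have [_ _ h2] := hent_spec (marg_inv_weight pi qw).
by rewrite lerD// ler_wpM2r ?h1 ?h2// invr_ge0 ltW// ?lyapA_gt0 ?lyapB_gt0//; exact: qw.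
Qed.

Lemma subadd_double (u : nat -> R) k : (forall n m, u (n + m)%N <= u n + u m) ->
  (k.*2)%:R^-1 * u (k.*2) <= k%:R^-1 * u k.
Proof.
move=> uD; have [->|k0] := posnP k; first by rewrite !invr0 !mul0r.
rewrite -muln2 natrM invfM -mulrA ler_pM2l ?invr_gt0 ?ltr0n//.
by rewrite ler_pdivrMl// mulr_natl mulr2n muln2 -addnn; exact: uD.
Qed.

(** The averages of a subadditive sequence need not be monotone, but they do not increase when the
    length is doubled. *)
Lemma Dk_dyadic q i j : inv_weight q -> (i <= j)%N -> Dk q (2 ^ j) <= Dk q (2 ^ i).
Proof.
move=> qw; move/subnKC <-; elim: (j - i)%N => [|d IH]; first by rewrite addn0.
apply: le_trans IH; rewrite addnS expnS mul2n; apply: lerD.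
  apply: ler_wpM2r; first by rewrite invr_ge0 ltW// lyapA_gt0//; exact: qw.
  by apply: subadd_double => n m; exact: relH_subadd.
apply: ler_wpM2r; first by rewrite invr_ge0 ltW// lyapB_gt0//; exact: qw.
by apply: subadd_double => n m; apply: Hent_subadd; exact: marg_inv_weight.
Qed.

Lemma Dk_cvg q : inv_weight q -> Dk q @ \oo --> Dim q.
Proof.
move=> qw; have [h1 _ _] := relh_spec qw; have [h2 _ _] := hent_spec (marg_inv_weight pi qw).
by apply: cvgD; apply: cvgMl.
Qed.

Section Limits.
Variables (F : set_system nat).
Context {FF : ProperFilter F}.
Variables (Q : nat -> seq A -> R) (q : seq A -> R).
Hypothesis Qw : forall i, weight (Q i).
Hypothesis Qq : forall w, Q^~ w @ F --> q w.

Lemma lyap_w_lim (l : A -> R) : (fun i => lyap_w l (Q i)) @ F --> lyap_w l q.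
Proof. by apply: cvg_sumr => a _; apply: cvgM; [exact: (@Qq [:: a])|exact: cvg_cst]. Qed.

Lemma Dk_lim k : (fun i => Dk (Q i) k) @ F --> Dk q k.
Proof.
have qw : weight q by exact: (weight_lim Qw Qq).
apply: cvgD; apply: cvgM.
- by apply: cvgM; [exact: cvg_cst|exact: relH_lim].
- by apply: cvgV; [rewrite gt_eqF// lyapA_gt0|exact: lyap_w_lim].
- by apply: cvgM; [exact: cvg_cst|exact: Hent_marg_lim].
- by apply: cvgV; [rewrite gt_eqF// lyapB_gt0|exact: lyap_w_lim].
Qed.

(* Dini: along powers of two [Dk] decreases to [Dim], so a lower bound on [Dk (Q i) (2 ^ i)] passes to the limit. *)
Lemma Dim_lim_ge t : \oo `<=` F -> (forall i, inv_weight (Q i)) -> inv_weight q ->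
  (forall i, t <= Dk (Q i) (2 ^ i)) -> t <= Dim q.
Proof.
move=> oF Qi qi tQ.
have tk j : t <= Dk q (2 ^ j).
  apply: (cvgr_to_ge (Dk_lim (k := 2 ^ j))); apply: oF; exists j => // i /= ji.
  exact: le_trans (tQ i) (Dk_dyadic _ ji).
have c2 : (fun j => Dk q (2 ^ j)) @ \oo --> Dim q.
  apply: (@cvg_comp _ _ _ (fun j => 2 ^ j)%N (Dk q) \oo \oo _ _ (Dk_cvg qi)).
  move=> S [N _ NS]; exists N => // n /= Nn; apply: NS => /=.
  by rewrite (leq_trans Nn)// ltnW// ltn_expl.
by apply: (cvgr_to_ge c2); exact: nearW.
Qed.

End Limits.

Lemma Nxlnx_le1 (x : R) : 0 <= x -> - (x * ln x) <= 1.
Proof.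
rewrite le_eqVlt => /predU1P[<-|x0]; first by rewrite mul0r oppr0.
rewrite -mulrN -lnV ?posrE//.
have := @le_ln1Dx R (x^-1 - 1); rewrite ltrBrDr addNr invr_gt0 => /(_ x0).
rewrite addrC subrK => h; apply: (@le_trans _ _ (x * (x^-1 - 1))).
  by rewrite ler_pM2l.
by rewrite mulrBr divff ?gt_eqF// mulr1 gerBl ltW.
Qed.

Lemma Hent_le (C : finType) (q : seq C -> R) n : weight q -> Hent q n <= (size (words C n))%:R.
Proof.
move=> qw; rewrite /Hent -sumrN -sum1_size natr_sum; apply: ler_sum => w _.
by rewrite Nxlnx_le1// weight_ge0.
Qed.

Lemma relH_le q n : weight q -> relH pi q n <= (size (words A n))%:R.
Proof.
move=> qw; apply: le_trans (Hent_le n qw).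
by rewrite (Hent_chain pi n (weight_ge0 qw)) lerDl Hent_ge0//; exact: marg_weight.
Qed.

(** A uniform bound makes the supremum over all weights of the given integral a real number; the
    entropy of one letter suffices. *)
Lemma Dim_bounded : exists M : R, forall q, inv_weight q -> Dim q <= M.
Proof.
exists ((size (words A 1))%:R / l0 + (size (words B 1))%:R / l0) => q qw.
apply: (le_trans (Dim_le_Dk qw (ltn0Sn 0))); rewrite /Dk !invr1 !mul1r.
have h1 : l0 <= lyap_w la q by have /andP[] := lyap_w_bounds qw la_bd.
have h2 : l0 <= lyap_w (lb \o pi) q.
  have h : forall a, l0 <= (lb \o pi) a <= l1 by move=> a; exact: lb_bd.
  by have /andP[] := lyap_w_bounds qw h.
apply: lerD; apply: ler_pM; rewrite ?relH_ge0 ?Hent_ge0 ?invr_ge0 ?relH_le ?Hent_le//;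
  try (exact: qw || exact: (weight_ge0 qw) || exact: (marg_weight pi qw)).
- exact/ltW/(lt_le_trans l00).
- by rewrite lef_pV2// posrE ?(lt_le_trans l00).
- exact/ltW/(lt_le_trans l00).
- by rewrite lef_pV2// posrE ?(lt_le_trans l00).
Qed.

Section Mixtures.
Variables (q0 q1 : seq A -> R) (t : R).
Hypotheses (t0 : 0 <= t) (t1 : t <= 1).
Hypotheses (q0w : inv_weight q0) (q1w : inv_weight q1).

Definition mix : seq A -> R := fun w => (1 - t) * q0 w + t * q1 w.

Lemma mix_inv_weight : inv_weight mix.
Proof.
have t1' : 0 <= 1 - t by rewrite subr_ge0.
split; first split.
- by rewrite /mix !(weight1 q0w, weight1 q1w) !mulr1 subrK.
- by move=> w; rewrite addr_ge0// mulr_ge0//; [exact: (weight_ge0 q0w)|exact: (weight_ge0 q1w)].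
- move=> w; rewrite /mix (weight_rcons q0w) (weight_rcons q1w) big_split/=.
  by rewrite -!mulr_sumr.
- move=> w; rewrite /mix (weight_cons q0w) (weight_cons q1w) big_split/=.
  by rewrite -!mulr_sumr.
Qed.

Lemma marg_mix (C : finType) (p : A -> C) z :
  marg p mix z = (1 - t) * marg p q0 z + t * marg p q1 z.
Proof. by rewrite /marg /mix big_split/= -!mulr_sumr. Qed.

Lemma lyap_w_mix (l : A -> R) : lyap_w l mix = (1 - t) * lyap_w l q0 + t * lyap_w l q1.
Proof.
rewrite /lyap_w /mix !mulr_sumr -big_split/=; apply: eq_bigr => a _.
by rewrite mulrDl !mulrA.
Qed.

End Mixtures.

(** Concavity: the entropy of the mixture is an average of cross entropies against its own kernel.
    The one of [q0] dominates the entropy of [q0] by Gibbs' inequality, and the one of [q1] is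
    nonnegative. The condition [t < 1] makes the kernel positive wherever [q0] is. *)
Lemma relH_mix (C : finType) (p : A -> C) q0 q1 t k : 0 <= t -> t < 1 ->
  inv_weight q0 -> inv_weight q1 -> (1 - t) * relH p q0 k <= relH p (mix q0 q1 t) k.
Proof.
move=> t0 t1 q0w q1w; have mw := mix_inv_weight t0 (ltW t1) q0w q1w.
have q00 := weight_ge0 q0w; have q10 := weight_ge0 q1w; have m0 := weight_ge0 mw.
have s0 : 0 < 1 - t by rewrite subr_gt0.
pose K w := mix q0 q1 t w / marg p (mix q0 q1 t) (map p w).
have K0 w : 0 <= K w by exact: kernel_ge0.
have g0 : relH p q0 k <= - \sum_(w <- words A k) q0 w * ln (K w).
  apply: relH_gibbs => //; last by move=> z sz; exact: kernel_sum.
  move=> w _ w0; apply: kernel_gt0 => //; rewrite ltr_wpDr ?mulr_ge0// mulr_gt0//.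
have g1 : 0 <= - \sum_(w <- words A k) q1 w * ln (K w).
  rewrite oppr_ge0; apply: sumr_le0 => w _; rewrite mulr_ge0_le0// ln_le0//.
  exact: kernel_le1.
have -> : relH p (mix q0 q1 t) k = (1 - t) * (- \sum_(w <- words A k) q0 w * ln (K w))
   + t * (- \sum_(w <- words A k) q1 w * ln (K w)).
  rewrite /relH !mulrN -opprD; congr (- _); rewrite !mulr_sumr -big_split/=.
  by apply: eq_bigr => w _; rewrite /K {1}/mix mulrDl !mulrA.
by rewrite ler_wpDr ?mulr_ge0// ler_pM2l.
Qed.

Lemma Hent_mix (C : finType) (p : A -> C) q0 q1 t k : 0 <= t -> t < 1 ->
  inv_weight q0 -> inv_weight q1 ->
  (1 - t) * Hent (marg p q0) k <= Hent (marg p (mix q0 q1 t)) k.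
Proof.
move=> t0 t1 q0w q1w; have mw := mix_inv_weight t0 (ltW t1) q0w q1w.
have q00 := weight_ge0 (marg_weight p q0w); have q10 := weight_ge0 (marg_weight p q1w).
have mw' := marg_weight p mw; have m0 := weight_ge0 mw'.
have s0 : 0 < 1 - t by rewrite subr_gt0.
have g0 : Hent (marg p q0) k <= - \sum_(z <- words C k) marg p q0 z * ln (marg p (mix q0 q1 t) z).
  rewrite /Hent lerN2; apply: gibbs => //.
  - by move=> z _ z0; rewrite marg_mix ltr_wpDr ?mulr_ge0// mulr_gt0.
  - by rewrite (weight_sum k mw') (weight_sum k (marg_weight p q0w)).
have g1 : 0 <= - \sum_(z <- words C k) marg p q1 z * ln (marg p (mix q0 q1 t) z).
  rewrite oppr_ge0; apply: sumr_le0 => w _; rewrite mulr_ge0_le0// ln_le0//.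
  exact: weight_le1.
have -> : Hent (marg p (mix q0 q1 t)) k =
   (1 - t) * (- \sum_(z <- words C k) marg p q0 z * ln (marg p (mix q0 q1 t) z))
   + t * (- \sum_(z <- words C k) marg p q1 z * ln (marg p (mix q0 q1 t) z)).
  rewrite /Hent !mulrN -opprD; congr (- _); rewrite !mulr_sumr -big_split/=.
  by apply: eq_bigr => z _; rewrite {1}marg_mix mulrDl !mulrA.
by rewrite ler_wpDr ?mulr_ge0// ler_pM2l.
Qed.

(** [Dim] itself is not concave, being a sum of quotients; entropies and exponents are therefore
    estimated apart, the exponents being exactly affine in the weight. *)
Lemma Dim_mix q0 q1 t : 0 <= t -> t < 1 -> inv_weight q0 -> inv_weight q1 ->
  (1 - t) * relh q0 / ((1 - t) * lyap_w la q0 + t * lyap_w la q1) +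
  (1 - t) * hent (marg pi q0) / ((1 - t) * lyap_w (lb \o pi) q0 + t * lyap_w (lb \o pi) q1)
  <= Dim (mix q0 q1 t).
Proof.
move=> t0 t1 q0w q1w; have mw := mix_inv_weight t0 (ltW t1) q0w q1w.
rewrite /Dim !lyap_w_mix; apply: lerD.
  apply: ler_wpM2r; first by rewrite -lyap_w_mix invr_ge0 ltW// lyapA_gt0//; exact: mw.
  have [c0 _ _] := relh_spec q0w; have [c1 _ _] := relh_spec mw.
  have d0 : (1 - t) * (n%:R^-1 * relH pi q0 n) @[n --> \oo] --> (1 - t) * relh q0.
    by apply: cvgM => //; exact: cvg_cst.
  apply: (ler_cvg_to d0 c1); apply: nearW => n.
  by rewrite mulrCA ler_wpM2l// relH_mix.
apply: ler_wpM2r; first by rewrite -lyap_w_mix invr_ge0 ltW// lyapB_gt0//; exact: mw.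
have [c0 _ _] := hent_spec (marg_inv_weight pi q0w).
have [c1 _ _] := hent_spec (marg_inv_weight pi mw).
have d0 : (1 - t) * (n%:R^-1 * Hent (marg pi q0) n) @[n --> \oo] --> (1 - t) * hent (marg pi q0).
  by apply: cvgM => //; exact: cvg_cst.
apply: (ler_cvg_to d0 c1); apply: nearW => n.
by rewrite mulrCA ler_wpM2l// Hent_mix.
Qed.

Lemma ev_mix pt q0 q1 t phi k :
  ev pt (mix q0 q1 t) phi k = (1 - t) * ev pt q0 phi k + t * ev pt q1 phi k.
Proof.
rewrite /ev /mix !mulr_sumr -big_split/=; apply: eq_bigr => w _.
by rewrite mulrDl !mulrA.
Qed.

Lemma integ_mix pt q0 q1 t phi I0 I1 : integ pt q0 phi I0 -> integ pt q1 phi I1 ->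
  integ pt (mix q0 q1 t) phi ((1 - t) * I0 + t * I1).
Proof.
move=> h0 h1; rewrite /integ.
have -> : ev pt (mix q0 q1 t) phi = (fun k => (1 - t) * ev pt q0 phi k + t * ev pt q1 phi k).
  by apply/funext => k; rewrite ev_mix.
by apply: cvgD; apply: cvgM => //; exact: cvg_cst.
Qed.

End DimensionFunctional.

(** * Processes and cylinder sets *)

#[short(type="pointedFinType")]
HB.structure Definition PointedFinite := {T of Finite T & isPointed T}.

Section RealProbability.
Context {R : realType} {d} {T : measurableType d}.
Variable mu : probability T R.

Definition pr (S : set T) : R := fine (mu S).

Lemma prE S : measurable S -> mu S = (pr S)%:E.
Proof. by move=> mS; rewrite fineK// fin_num_measure. Qed.

Lemma pr_ge0 S : 0 <= pr S.
Proof. by rewrite fine_ge0. Qed.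

Lemma prT : pr setT = 1.
Proof. by rewrite /pr probability_setT. Qed.

Lemma pr_le S S' : measurable S -> measurable S' -> S `<=` S' -> pr S <= pr S'.
Proof.
by move=> mS mS' SS'; rewrite -lee_fin -!prE// le_measure// inE.
Qed.

Lemma prU_le S S' : measurable S -> measurable S' -> pr (S `|` S') <= pr S + pr S'.
Proof.
move=> mS mS'; rewrite -lee_fin EFinD -!prE//; first exact: measureU2.
exact: measurableU.
Qed.

Lemma pr_bigU_le (I : Type) (r : seq I) (F : I -> set T) : (forall i, measurable (F i)) ->
  pr (\big[setU/set0]_(i <- r) F i) <= \sum_(i <- r) pr (F i).
Proof.
move=> mF; elim: r => [|i r IH]; first by rewrite !big_nil /pr measure0.
rewrite !big_cons (le_trans (prU_le _ _))//; first exact: bigsetU_measurable.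
by rewrite lerD2l.
Qed.

Lemma pr_split (C : finType) (F : C -> set T) S : measurable S ->
  (forall c, measurable (F c)) -> (forall x, exists c, F c x) ->
  (forall c c' x, F c x -> F c' x -> c = c') ->
  pr S = \sum_c pr (S `&` F c).
Proof.
move=> mS mF cov disj; apply: EFin_inj; rewrite -prE//.
have mSF c : measurable (S `&` F c) by exact: measurableI.
rewrite -sumEFin; under eq_bigr do rewrite -prE//.
rewrite -big_enum /= fsbig_seq ?enum_uniq// -measure_fin_bigcup//.
- congr (mu _); apply/seteqP; split => [x Sx|x [c _ []]//].
  by have [c Fc] := cov x; exists c => //=; rewrite mem_enum.
- move=> c c' _ _ [x [[_ Fx] [_ Fx']]]; exact: disj Fx Fx'.
Qed.

Lemma prD S S' : measurable S -> measurable S' -> S `<=` S' -> pr (S' `\` S) = pr S' - pr S.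
Proof.
move=> mS mS' SS'; apply/eqP; rewrite eq_sym subr_eq; apply/eqP.
rewrite (pr_split (F := fun b : bool => if b then S else ~` S) mS').
- by rewrite big_bool /= setIidr// -setDE addrC.
- by case=> //; exact: measurableC.
- by move=> x; have [|] := pselect (S x); [exists true|exists false].
- by move=> [] [] x.
Qed.

End RealProbability.

Section Process.
Context {R : realType} {d} {T : measurableType d}.
Variables (f : T -> T) (mf : measurable_fun setT f).

Lemma measurable_preimage_iter n S : measurable S -> measurable (iter n f @^-1` S).
Proof.
move=> mS; elim: n => // n IH.
have -> : iter n.+1 f @^-1` S = f @^-1` (iter n f @^-1` S).
  by apply/seteqP; split=> x /=; rewrite -iterSr.
by rewrite -[X in measurable X]setTI; exact: mf.
Qed.

Section Family.
Variables (C : finType) (P : C -> set T).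

Fixpoint itin (z : seq C) : set T :=
  if z is c :: z' then P c `&` f @^-1` (itin z') else setT.

Lemma itin_rcons z c : itin (rcons z c) = itin z `&` iter (size z) f @^-1` P c.
Proof.
elim: z => [|b z IH] /=; first by rewrite setIT setTI.
by rewrite IH preimage_setI setIA; congr (_ `&` _); apply/seteqP; split=> x /=; rewrite -iterSr.
Qed.

Record partition_family : Prop := PartitionFamily {
  pf_meas : forall c, measurable (P c);
  pf_cover : forall x, exists c, P c x;
  pf_disj : forall c c' x, P c x -> P c' x -> c = c' }.

Hypothesis pf : partition_family.

Lemma itin_meas z : measurable (itin z).
Proof.
elim: z => [|c z IH]; first exact: measurableT.
apply: measurableI; first exact: pf_meas.
by rewrite -[X in measurable X]setTI; exact: mf.
Qed.

Lemma itin_inj z z' x : size z = size z' -> itin z x -> itin z' x -> z = z'.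
Proof.
elim: z z' x => [|c z IH] [|c' z']//= x [sz] [Px fx] [Px' fx'].
by rewrite (pf_disj pf Px Px') (IH z' (f x)).
Qed.

Variable mu : probability T R.

Lemma pr_itin_split S n : measurable S ->
  pr mu S = \sum_(z <- words C n) pr mu (S `&` itin z).
Proof.
move=> mS; elim: n => [|n IH]; first by rewrite big_words0 /= setIT.
rewrite big_words_rcons IH; apply: eq_words => z sz.
under eq_bigr do rewrite itin_rcons setIA sz.
apply: pr_split.
- by apply: measurableI => //; exact: itin_meas.
- by move=> c; apply: measurable_preimage_iter; exact: pf_meas.
- by move=> x; exact: (pf_cover pf (iter n f x)).
- by move=> c c' x; exact: (pf_disj pf (x := iter n f x)).
Qed.

Definition law (z : seq C) : R := pr mu (itin z).

Hypothesis inv : is_invariant mu f.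

Lemma law_inv_weight : inv_weight law.
Proof.
split; first split.
- by rewrite /law /= prT.
- by move=> z; exact: pr_ge0.
- move=> z; rewrite /law; under eq_bigr do rewrite itin_rcons.
  apply: pr_split.
  + exact: itin_meas.
  + by move=> c; apply: measurable_preimage_iter; exact: pf_meas.
  + by move=> x; exact: (pf_cover pf (iter (size z) f x)).
  + by move=> c c' x; exact: (pf_disj pf (x := iter (size z) f x)).
- move=> z; rewrite /law /pr -inv; last exact: itin_meas.
  have := pr_split mu (C := C) (F := P) (S := f @^-1` itin z).
  rewrite /pr => ->.
  + by under eq_bigr do rewrite setIC.
  + by rewrite -[X in measurable X]setTI; apply: mf => //; exact: itin_meas.
  + exact: pf_meas.
  + exact: pf_cover.
  + exact: pf_disj.
Qed.

Lemma join_iter_itin (V : nmodType) (G : set T -> V) n :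
  \sum_(B <- join_iter f [seq P c | c <- enum C] n) G B = \sum_(z <- words C n) G (itin z).
Proof.
elim: n G => [|n IH] G; first by rewrite big_words0 big_seq1.
rewrite big_words_rcons /= big_allpairs_dep IH; apply: eq_words => z sz.
rewrite big_map big_enum; apply: eq_bigr => c _.
by rewrite itin_rcons sz.
Qed.

Lemma entropy_wrt_law : entropy_wrt (pr mu) f [seq P c | c <- enum C] = hent law.
Proof.
rewrite /entropy_wrt /hent; congr (limn _); apply/funext => n; congr (_ * _).
by rewrite /part_entropy (join_iter_itin (fun B => pr mu B * ln (pr mu B))).
Qed.

End Family.

Lemma marg_law (C D : finType) (P : C -> set T) (Q : D -> set T) (p : C -> D)
    (mu : probability T R) : partition_family P -> partition_family Q ->
  (forall c, P c `<=` Q (p c)) -> marg p (law P mu) = law Q mu.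
Proof.
move=> pP pQ PQ; apply/funext => z.
have sub w : itin P w `<=` itin Q (map p w).
  elim: w => [|c w IH]//= x [Pc fx]; split; first exact: PQ.
  exact: IH.
rewrite /marg [RHS](pr_itin_split pP mu (size z)); last exact: itin_meas.
rewrite big_mkcond; apply: eq_words => w sw; case: eqP => [<-|wz].
  by rewrite setIidr//; exact: sub.
rewrite (_ : itin Q z `&` itin P w = set0) /pr ?measure0//.
apply/seteqP; split => // x [Qz Pw]; apply: wz.
by apply: (itin_inj pQ _ (sub w x Pw) Qz); rewrite size_map.
Qed.

Lemma partition_familyI (C D : finType) (P : C -> set T) (Q : D -> set T) :
  partition_family P -> partition_family Q ->
  partition_family (fun cd : C * D => P cd.1 `&` Q cd.2).
Proof.
move=> pP pQ; split.
- by move=> cd; apply: measurableI; exact: pf_meas.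
- by move=> x; have [c Px] := pf_cover pP x; have [e Qx] := pf_cover pQ x; exists (c, e).
- by move=> [c e] [c' e'] x [/= Px Qx] [Px' Qx']; rewrite (pf_disj pP Px Px') (pf_disj pQ Qx Qx').
Qed.

Lemma finite_partition_family (P : seq (set T)) : is_finite_partition P ->
  partition_family (fun i : 'I_(size P) => nth set0 P i).
Proof.
move=> [mP dP cP]; split.
- by move=> i; apply: mP; rewrite mem_nth.
- move=> x; have : (\big[setU/set0]_(B <- P) B) x by rewrite cP.
  rewrite (big_nth set0) big_mkord -(bigcup_mkord _ (nth set0 P)) => -[i /= si Px].
  by exists (Ordinal si).
- move=> i j x Px Px'; apply/val_inj/eqP/negPn/negP => ij.
  have : (nth set0 P i `&` nth set0 P j) x by [].
  by rewrite (dP i j (ltn_ord i) (ltn_ord j) ij).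
Qed.

Lemma partition_family_finite (C : finType) (P : C -> set T) :
  partition_family P -> is_finite_partition [seq P c | c <- enum C].
Proof.
move=> pP; split.
- by move=> B /mapP[c _ ->]; exact: pf_meas.
- move=> i j; rewrite size_map => si sj ij.
  have [c0 _] := pf_cover pP point.
  rewrite (nth_map c0 set0 P si) (nth_map c0 set0 P sj).
  rewrite -subset0 => x [Px Px'].
  have := pf_disj pP Px Px' => /eqP; rewrite nth_uniq ?enum_uniq//.
  by rewrite (negbTE ij).
- apply/seteqP; split => // x _; have [c Px] := pf_cover pP x.
  by rewrite big_map -bigcup_seq; exists c => //=; rewrite mem_enum.
Qed.

End Process.

Section Shift.
Context {R : realType} {A : pointedFinType}.
Notation X := (shiftspace A).

Definition letter (a : A) : set X := [set x | x 0%N = a].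

Definition pfx (x : nat -> A) (n : nat) : seq A := mkseq x n.

Lemma iota1 n : iota 1 n = map S (iota 0 n).
Proof. exact: (iotaDl 1 0 n). Qed.

Lemma itinE (w : seq A) : itin sshift letter w = [set x : X | pfx x (size w) = w].
Proof.
elim: w => [|a w IH].
  by apply/seteqP; split.
rewrite [LHS]/= IH; apply/seteqP; split => x /=; rewrite /pfx /mkseq /=.
  by rewrite iota1 -map_comp => -[-> xw]; congr cons.
by rewrite iota1 -map_comp => -[xa xw].
Qed.

Lemma measurable_itin (w : seq A) : measurable (itin sshift letter w : set X).
Proof.
rewrite itinE; apply: sub_sigma_algebra; exists (size w), (fun n => nth point w n).
apply/seteqP; split => x /=.
  move=> xw k kw; by rewrite -[in RHS]xw nth_mkseq.
move=> xw; apply: (@eq_from_nth _ point); first by rewrite size_mkseq.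
by move=> i; rewrite size_mkseq => iw; rewrite nth_mkseq// xw.
Qed.

Lemma measurable_sshift : measurable_fun setT (@sshift A).
Proof.
apply: (@measurability _ _ X X setT sshift (@cylinders A)) => //.
move=> _ [_ [n [w ->]] <-]; rewrite setTI.
have -> : @sshift A @^-1` [set x | forall k, (k < n)%N -> x k = w k] =
    \bigcup_(a in [set: A]) itin sshift letter (a :: mkseq w n).
  apply/seteqP; split => x /=.
    move=> xw; exists (x 0%N) => //; split => //=; rewrite itinE /= size_mkseq.
    by apply/eq_in_map => i; rewrite mem_iota => /andP[_ ix]; rewrite xw.
  move=> [a _] /= [_]; rewrite itinE /= size_mkseq => /eq_in_map xw k kn.
  by rewrite xw// mem_iota.
apply: fin_bigcup_measurable; first exact: finite_finset.
by move=> a _; exact: measurable_itin.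
Qed.

Lemma letter_family : partition_family letter.
Proof.
split.
- move=> a; have -> : letter a = itin sshift letter [:: a].
    by apply/seteqP; split => x //= [].
  exact: measurable_itin.
- by move=> x; exists (x 0%N).
- by move=> a b x <- <-.
Qed.

Definition cyl (n : nat) (W : pred (seq A)) : set X := [set x | W (pfx x n)].

Lemma cylE n W : cyl n W = \big[setU/set0]_(w <- words A n | W w) itin sshift letter w.
Proof.
rewrite -bigcup_seq_cond; apply/seteqP; split => x /=.
  move=> Wx; exists (pfx x n); first by rewrite /= mem_words size_mkseq eqxx.
  by rewrite itinE /= size_mkseq.
by move=> [w /andP[]]; rewrite mem_words itinE /= => /eqP sw Ww xw; rewrite /cyl/= -sw xw.
Qed.

Lemma measurable_cyl n W : measurable (cyl n W).
Proof. by rewrite cylE; apply: bigsetU_measurable => w _; exact: measurable_itin. Qed.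

Lemma cyl_mono n n' W : (n <= n')%N -> cyl n W = cyl n' (fun w => W (take n w)).
Proof.
move=> nn'; apply/seteqP; split => x; rewrite /cyl/= /pfx /mkseq -map_take take_iota.
  by rewrite (minn_idPl nn').
by rewrite (minn_idPl nn').
Qed.

Variable mu : probability X R.

(** Approximation in measure by sets that depend on finitely many letters. This class is a
    sigma-algebra containing the cylinders, hence holds every measurable set. *)
Definition cyl_approx (B : set X) := measurable B /\ forall e : R, 0 < e ->
  exists n W, pr mu ((B `\` cyl n W) `|` (cyl n W `\` B)) <= e.

Lemma cyl_approxC B : cyl_approx B -> cyl_approx (~` B).
Proof.
move=> [mB H]; split; first exact: measurableC.
move=> e e0; have [n [W h]] := H e e0; exists n, (fun w => ~~ W w).
have -> : cyl n (fun w => ~~ W w) = ~` cyl n W.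
  by apply/seteqP; split => x; rewrite /cyl/=; [move/negP|move/negP].
by rewrite !setDE !setCK setUC [X in X `|` _]setIC [X in _ `|` X]setIC -!setDE.
Qed.

Lemma measurable_symdiff (B C : set X) : measurable B -> measurable C ->
  measurable ((B `\` C) `|` (C `\` B)).
Proof. by move=> mB mC; apply: measurableU; exact: measurableD. Qed.

Lemma cyl_approxU B C : cyl_approx B -> cyl_approx C -> cyl_approx (B `|` C).
Proof.
move=> [mB HB] [mC HC]; split; first exact: measurableU.
move=> e e0; have e2 : 0 < e / 2 by rewrite divr_gt0.
have [n [V h]] := HB _ e2; have [m [W h']] := HC _ e2.
exists (maxn n m), (fun w => V (take n w) || W (take m w)).
rewrite (cyl_mono _ (leq_maxl n m)) in h; rewrite (cyl_mono _ (leq_maxr n m)) in h'.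
have -> : cyl (maxn n m) (fun w => V (take n w) || W (take m w)) =
   cyl (maxn n m) (fun w => V (take n w)) `|` cyl (maxn n m) (fun w => W (take m w)).
  by apply/seteqP; split => x; rewrite /cyl/= => /orP.
set S := cyl _ (fun w => V _) in h *; set S' := cyl _ (fun w => W _) in h' *.
have mS : measurable S by exact: measurable_cyl.
have mS' : measurable S' by exact: measurable_cyl.
rewrite [e in _ <= e]splitr; apply: (le_trans _ (lerD h h')).
apply: (le_trans _ (prU_le _ _ _)); try exact: measurable_symdiff.
apply: pr_le.
- by apply: measurable_symdiff; exact: measurableU.
- by apply: measurableU; exact: measurable_symdiff.
- move=> x [[[Bx|Cx] /not_orP[nS nS']]|[[Sx|Sx] /not_orP[nB nC]]].
  + by left; left.
  + by right; left.
  + by left; right.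
  + by right; right.
Qed.

(** By continuity from below a finite union misses at most [e / 2] of the countable one, and it can
    itself be approximated up to [e / 2]. *)
Lemma cyl_approx_bigcup (B : (set X)^nat) : (forall n, cyl_approx (B n)) ->
  cyl_approx (\bigcup_n B n).
Proof.
move=> HB; have mB : measurable (\bigcup_n B n) by apply: bigcup_measurable => n _; case: (HB n).
split => // e e0; pose D n := \big[setU/set0]_(i < n) B i.
have HD n : cyl_approx (D n.+1).
  elim: n => [|n IH]; first by rewrite /D big_ord_recl big_ord0 setU0.
  by rewrite /D big_ord_recr /=; exact: cyl_approxU.
have mD n : measurable (D n) by apply: bigsetU_measurable => i _; case: (HB i).
have DB n : D n `<=` \bigcup_n B n.
  by move=> x; rewrite /D -bigcup_mkord => -[i _ Bx]; exists i.
have c : (mu \o D) n @[n --> \oo] --> mu (\bigcup_n D n).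
  apply: nondecreasing_cvg_mu => //.
    by apply: bigcup_measurable => n _.
  move=> n m nm; apply/subsetPset => x; rewrite /D -!bigcup_mkord => -[i /= im Bx].
  by exists i => //=; exact: leq_trans nm.
have DE : \bigcup_n D n = \bigcup_n B n.
  apply/seteqP; split => x [n _]; first exact: DB.
  by move=> Bx; exists n.+1 => //; rewrite /D big_ord_recr /=; right.
rewrite DE in c.
have c' : (pr mu \o D) @ \oo --> pr mu (\bigcup_n B n).
  have := fine_cvg; apply.
  by rewrite fineK ?fin_num_measure.
have e2 : 0 < e / 2 by rewrite divr_gt0.
have /cvgrPdist_le /(_ _ e2) [N _ HN] := c'.
have [n [W h]] := (HD N).2 _ e2; exists n, W.
set S := cyl n W in h *; have mS : measurable S by exact: measurable_cyl.
have sp : pr mu (\bigcup_n B n) - pr mu (D N.+1) <= e / 2.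
  by have := HN N.+1 (leqnSn N); rewrite ler_norml => /andP[].
have sp' : pr mu (\bigcup_n B n `\` D N.+1) <= e / 2.
  by rewrite (le_trans _ sp)// (prD mu (mD N.+1) mB (DB N.+1)).
rewrite [e in _ <= e]splitr; apply: (le_trans _ (lerD h sp')).
apply: (le_trans _ (prU_le _ _ _)).
- apply: pr_le.
  + exact: measurable_symdiff.
  + by apply: measurableU; [exact: measurable_symdiff|exact: measurableD].
  + move=> x [[Bx nS]|[Sx nB]].
      by have [Dx|nD] := pselect (D N.+1 x); [left; left|right].
    by left; right; split => // Dx; apply: nB; exact: DB Dx.
- exact: measurable_symdiff.
- exact: measurableD.
Qed.

Lemma measurable_cyl_approx (B : set X) : measurable B -> cyl_approx B.
Proof.
apply: (smallest_sub (X := cyl_approx)); last first.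
  move=> _ [n [w ->]]; split; first by apply: sub_sigma_algebra; exists n, w.
  move=> e e0; exists n, (pred1 (mkseq w n)).
  have -> : cyl n (pred1 (mkseq w n)) = [set x | forall k, (k < n)%N -> x k = w k].
    apply/seteqP; split => x; rewrite /cyl/=.
      by move=> /eqP/eq_in_map xw k kn; rewrite xw// mem_iota.
    by move=> xw; apply/eqP/eq_in_map => i; rewrite mem_iota => /andP[_ ?]; rewrite xw.
  by rewrite !setDv setU0 /pr measure0 ltW.
split.
- split => // e e0; exists 0%N, pred0.
  by rewrite (_ : cyl 0 pred0 = set0) ?setDv ?setU0 /pr ?measure0 ?ltW//; apply/seteqP; split.
- by move=> S HS; rewrite setTD; exact: cyl_approxC.
- exact: cyl_approx_bigcup.
Qed.

End Shift.

(** * Entropy of the shift *)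

Section GuessKernel.
Context {R : realType}.
Variables (A : finType) (M : nat) (g : seq A -> 'I_M.+1) (n : nat) (dl : R).
Hypotheses (dl0 : 0 < dl) (dl1 : dl < 1).
Notation C := ('I_M.+1 * A)%type.

(* [g] guesses the first symbol from the next [n] letters; the kernel trusts the guess up to [dl], so by Gibbs'
   inequality a small guessing error bounds the entropy conditional on the letters. *)
Definition guess_kernel1 (i : 'I_M.+1) (y : seq A) : R :=
  if (size y < n)%N then M.+1%:R^-1
  else if i == g (take n y) then 1 - dl else dl / M.+1%:R.

Fixpoint guess_kernel (w : seq C) : R :=
  if w is c :: w' then guess_kernel1 c.1 (map snd w) * guess_kernel w' else 1.

Lemma guess_kernel1_gt0 i y : 0 < guess_kernel1 i y.
Proof.
rewrite /guess_kernel1; case: ifP => _; first by rewrite invr_gt0.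
by case: ifP => _; rewrite ?subr_gt0// divr_gt0.
Qed.

Lemma guess_kernel1_sum y : \sum_i guess_kernel1 i y <= 1.
Proof.
rewrite /guess_kernel1; case: (ltnP (size y) n) => _.
  by rewrite sumr_const card_ord -(mulr_natl M.+1%:R^-1) divff.
rewrite (bigD1 (g (take n y)))//= eqxx.
rewrite (eq_bigr (fun=> dl / M.+1%:R)); last by move=> i /negbTE ->.
rewrite -lerBrDl opprB addrC subrK.
apply: (@le_trans _ _ (\sum_(i < M.+1) dl / M.+1%:R)).
  rewrite [leRHS](bigD1 (g (take n y)))//= lerDr; exact/ltW/divr_gt0.
by rewrite sumr_const card_ord -(mulr_natl (dl / _)) mulrCA divff// mulr1.
Qed.

Lemma guess_kernel_gt0 w : 0 < guess_kernel w.
Proof. by elim: w => //= c w IH; rewrite mulr_gt0// guess_kernel1_gt0. Qed.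

Lemma guess_kernel_sum z :
  \sum_(w <- words C (size z) | map snd w == z) guess_kernel w <= 1.
Proof.
elim: z => [|a z IH]; first by rewrite big_mkcond big_words0.
rewrite [size _]/= big_fiber_cons.
apply: (@le_trans _ _ (\sum_(c : C | c.2 == a) guess_kernel1 c.1 (a :: z))).
  apply: ler_sum => c /eqP ca.
  rewrite (eq_bigr (fun v => guess_kernel1 c.1 (a :: z) * guess_kernel v)).
    by rewrite -mulr_sumr ler_piMr// ltW// guess_kernel1_gt0.
  by move=> v /eqP vz; rewrite /= vz ca.
apply: le_trans (guess_kernel1_sum (a :: z)).
rewrite big_mkcond -(pair_big predT predT (fun i b => if b == a then guess_kernel1 i (a :: z) else 0))/=.
apply: ler_sum => i _; rewrite (bigD1 a)//= eqxx big1 ?addr0// => b /negbTE -> //.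
Qed.

Variable q : seq C -> R.
Hypothesis qw : inv_weight q.
Hypothesis n0 : (0 < n)%N.

(** The probability that the symbol attached to the first of [n] letters differs from the guess made
    from these letters. *)
Definition guess_error : R :=
  \sum_(w <- words C n) q w * (if w is c :: _ then (c.1 != g (map snd w))%:R else 0).

(** Bounds the mean logarithmic loss per position: a correct guess costs [- ln (1 - dl)], a wrong
    one [ln (M.+1 / dl)]. *)
Definition guess_cost : R := - ln (1 - dl) + ln (M.+1%:R / dl) * guess_error.

(** The loss at the first position of a word. A word of at least [n] letters permits a guess, and
    only its first [n] letters matter, so the sum reduces to words of length [n]. *)
Lemma guess_step N : - \sum_(w <- words C N.+1) q w *
    (if w is c :: _ then ln (guess_kernel1 c.1 (map snd w)) else 0) <=
  if (N.+1 < n)%N then ln M.+1%:R else guess_cost.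
Proof.
case: ltnP => Nn.
  rewrite (eq_words (G := fun w => q w * ln M.+1%:R^-1)); last first.
    by move=> [|c w] // sw; rewrite /guess_kernel1 size_map sw Nn.
  by rewrite -mulr_suml (weight_sum N.+1 qw) mul1r lnV ?opprK ?posrE.
pose G (w : seq C) : R := if w is c :: _ then
  - (if c.1 == g (map snd w) then ln (1 - dl) else ln (dl / M.+1%:R)) else 0.
apply: (@le_trans _ _ (\sum_(w <- words C n) q w * G w)).
  rewrite -sumrN -(subnKC Nn) big_words_cat; apply: le_words => u su.
  rewrite (weight_cat u (N.+1 - n) qw) mulr_suml.
  apply: le_words => v sv; rewrite -mulrN; apply: ler_wpM2l; first exact: (weight_ge0 qw).
  case: u su => [/esym n0'|c u su]; first by move: n0; rewrite n0'.
  rewrite /guess_kernel1 size_map size_cat su -[X in (X < _)%N]addnC.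
  rewrite ltnNge leq_addl /=.
  have -> : take n (c.2 :: [seq i.2 | i <- u ++ v]) = map snd (c :: u).
    by rewrite map_cat -cat_cons -map_cons take_size_cat// size_map.
  by rewrite /G /=; case: ifP.
rewrite /guess_cost /guess_error mulr_sumr -[- ln _]mul1r -{1}(weight_sum n qw) mulr_suml -big_split/=.
rewrite [leRHS](_ : _ = \sum_(w <- words C n) q w * (- ln (1 - dl) +
    ln (M.+1%:R / dl) * (if w is c :: _ then (c.1 != g (map snd w))%:R else 0))); last first.
  by apply: eq_bigr => w _; rewrite mulrDr; congr (_ + _); rewrite mulrCA.
apply: le_words => -[|c w] sw; first by move: n0; rewrite -sw.
apply: ler_wpM2l; first exact: (weight_ge0 qw).
rewrite /G; case: eqP => _ /=; first by rewrite mulr0 addr0.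
rewrite mulr1 -lnV ?posrE ?divr_gt0// invf_div lerDr oppr_ge0 ln_le0// gerBl; exact: ltW.
Qed.

(** The kernel factors position by position, and by invariance every position costs as much as a
    first one. Fewer than [n] letters remain to guess from only near the end, which gives a term
    that vanishes after division by [N]. *)
Lemma guess_relH N : relH snd q N <= n%:R * ln M.+1%:R + N%:R * guess_cost.
Proof.
have gc0 : 0 <= guess_cost.
  rewrite addr_ge0//; first by rewrite oppr_ge0 ln_le0// gerBl ltW.
  rewrite mulr_ge0//.
    rewrite ln_ge0// ler_pdivlMr// mul1r (le_trans (ltW dl1))// ler1n//.
  apply: sumr_ge0 => -[|c w] _; rewrite mulr_ge0//; exact: (weight_ge0 qw).
apply: (le_trans (@relH_gibbs _ _ _ _ _ _ guess_kernel (weight_ge0 qw) _ _ _)).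
- by move=> w _; rewrite ltW// guess_kernel_gt0.
- by move=> w _ _; rewrite guess_kernel_gt0.
- by move=> z <-; exact: guess_kernel_sum.
have lnM0 : 0 <= ln M.+1%:R :> R by rewrite ln_ge0// ler1n.
(* With [minn N n] the induction charges [ln M.+1] only while the word is shorter than [n]. *)
suff : - \sum_(w <- words C N) q w * ln (guess_kernel w) <=
    (minn N n)%:R * ln M.+1%:R + N%:R * guess_cost.
  move=> h; apply: (le_trans h); rewrite lerD2r ler_wpM2r// ler_nat geq_minr//.
elim: N => [|N IH].
  by rewrite big_words0 ln1 mulr0 oppr0 min0n !mul0r addr0.
have -> : \sum_(w <- words C N.+1) q w * ln (guess_kernel w) =
   \sum_(w <- words C N.+1) q w * (if w is c :: _ then ln (guess_kernel1 c.1 (map snd w)) else 0)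
   + \sum_(w <- words C N) q w * ln (guess_kernel w).
  have -> : \sum_(w <- words C N) q w * ln (guess_kernel w) =
      \sum_(w <- words C N.+1) q w * ln (guess_kernel (behead w)).
    rewrite big_wordsS exchange_big/=; apply: eq_bigr => w _.
    by rewrite (weight_cons qw) mulr_suml.
  rewrite -big_split/=; apply: eq_words => -[|c w]// sw.
  by rewrite -mulrDr /= lnM ?posrE ?guess_kernel1_gt0 ?guess_kernel_gt0.
rewrite opprD (le_trans (lerD (guess_step N) IH))//.
case: ltnP => Nn.
  rewrite (minn_idPl (ltnW (ltnW Nn))).
  have -> : N.+1%:R = 1 + N%:R :> R by rewrite -natr1 addrC.
  by rewrite !mulrDl !mul1r; lra.
have -> : N.+1%:R = 1 + N%:R :> R by rewrite -natr1 addrC.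
have : (minn N n)%:R * ln M.+1%:R <= n%:R * ln M.+1%:R :> R.
  by rewrite ler_wpM2r// ler_nat geq_minr.
by rewrite mulrDl mul1r; lra.
Qed.

Lemma guess_relh : relh snd q <= guess_cost.
Proof.
have [_ _ h] := relh_spec snd qw.
suff H (e : R) : 0 < e -> relh snd q <= guess_cost + e by apply/ler_addgt0Pr.
move=> e0.
pose c : R := n%:R * ln M.+1%:R.
have c0 : 0 <= c by rewrite mulr_ge0// ln_ge0// ler1n.
have [N N0 cN] : exists2 N : nat, (0 < N)%N & c / N%:R <= e.
  exists (Num.truncn (c / e)).+1 => //.
  by rewrite ler_pdivrMr// mulrC -ler_pdivrMr// ltW// truncnS_gt.
apply: (le_trans (h N N0)); rewrite ler_pdivrMl ?ltr0n//.
have := guess_relH N; have : n%:R * ln M.+1%:R <= N%:R * e.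
  by rewrite -ler_pdivrMl ?ltr0n// mulrC.
by move: guess_cost => gc; rewrite mulrDr; lra.
Qed.

End GuessKernel.

Section KolmogorovSinai.
Context {R : realType} {A : pointedFinType}.
Notation X := (shiftspace A).
Variable mu : probability X R.
Hypothesis inv : is_invariant mu sshift.

Definition shift_law : seq A -> R := law sshift letter mu.

Lemma shift_law_inv_weight : inv_weight shift_law.
Proof. apply: law_inv_weight => //; [exact: measurable_sshift|exact: letter_family]. Qed.

(** Every atom [P i] is close to a set [S i] that depends on [n] letters, and the guess is some [i]
    whose [S i] contains the observed prefix. Errors lie in the union of the symmetric
    differences. *)
Lemma guess_exists (M : nat) (P : 'I_M.+1 -> set X) (e : R) : partition_family P -> 0 < e ->
  exists n (g : seq A -> 'I_M.+1), (0 < n)%N /\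
    guess_error g n (law sshift (fun c : 'I_M.+1 * A => P c.1 `&` letter c.2) mu) <= e.
Proof.
move=> pP e0; set Q := fun c : _ * A => _.
have pQ : partition_family Q by apply: partition_familyI => //; exact: letter_family.
have mf := @measurable_sshift A.
have eM : 0 < e / M.+1%:R by rewrite divr_gt0.
have /choice[nW nWP] : forall i, exists nW : nat * pred (seq A),
    pr mu ((P i `\` cyl nW.1 nW.2) `|` (cyl nW.1 nW.2 `\` P i)) <= e / M.+1%:R.
  move=> i; have [_ /(_ _ eM)[n [W h]]] := measurable_cyl_approx mu (pf_meas pP i).
  by exists (n, W).
pose n := (\max_i (nW i).1).+1.
have ni i : ((nW i).1 <= n)%N by apply: leqW; exact: leq_bigmax.
pose W i := fun w : seq A => (nW i).2 (take (nW i).1 w).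
pose S i : set X := cyl n (W i).
have mS i : measurable (S i) by exact: measurable_cyl.
have SP i : pr mu ((P i `\` S i) `|` (S i `\` P i)) <= e / M.+1%:R.
  by have := nWP i; rewrite (cyl_mono _ (ni i)).
pose g w := odflt ord0 [pick i | W i w].
exists n, g; split => //.
pose Bad : set X := \big[setU/set0]_(i < M.+1) ((P i `\` S i) `|` (S i `\` P i)).
have mPS i : measurable ((P i `\` S i) `|` (S i `\` P i)).
  by apply: measurableU; apply: measurableD => //; exact: pf_meas.
have mBad : measurable Bad by exact: bigsetU_measurable.
have prBad : pr mu Bad <= e.
  apply: (le_trans (pr_bigU_le _ _ mPS)).
  apply: (@le_trans _ _ (\sum_(i < M.+1) e / M.+1%:R)); first exact: ler_sum.
  by rewrite sumr_const card_ord -(mulr_natl (e / _)) mulrCA divff// mulr1.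
apply: (le_trans _ prBad); rewrite (pr_itin_split mf pQ mu n mBad).
apply: le_words => -[|c w] sw; first by [].
case: eqP => [_|cg] /=; first by rewrite mulr0 pr_ge0.
rewrite mulr1; apply: pr_le.
- exact: itin_meas.
- by apply: measurableI => //; exact: (itin_meas mf pQ (c :: w)).
move=> x wx; split => //.
have gx : g (map snd (c :: w)) = g (pfx (x : X) n).
  congr g.
  have sub v : itin sshift Q v `<=` itin sshift letter (map snd v).
    by elim: v => [|b v IH]//= y [[_ ly] fy]; split => //; exact: IH.
  by have := sub _ _ wx; rewrite itinE /= size_map => <-; rewrite -[n]sw.
have Px : P c.1 x by case: wx => -[].
rewrite /Bad -(bigcup_seq (index_enum _)).
(* If [S c.1] misses the point, the difference of the true atom contains it. Otherwise the guess
   selects some [j] other than [c.1], and the point is in [S j] but not in [P j]. *)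
have [Sx|nSx] := pselect (S c.1 x); last by exists c.1 => /=; [rewrite mem_index_enum|left].
have : g (pfx (x : X) n) != c.1 by rewrite -gx eq_sym; exact/eqP.
rewrite /g; case: pickP => [j Wj /= jc|/(_ c.1)]; last by move: Sx; rewrite /S /cyl/= => ->.
exists j => /=; first by rewrite mem_index_enum.
right; split => // Pj; move: jc; rewrite (pf_disj pP Pj Px) eqxx //.
Qed.

(** Generator theorem. The entropy of [P] is at most that of its join with the letters, which is the
    entropy of the letters plus a relative entropy; the latter is 0 because the letters guess [P]
    with arbitrarily small error. *)
Lemma entropy_partition_le (P : seq (set X)) : is_finite_partition P ->
  entropy_wrt (pr mu) sshift P <= hent shift_law.
Proof.
move=> fP; have mf := @measurable_sshift A.
have PE : P = map (fun i : 'I_(size P) => nth set0 P i) (enum 'I_(size P)).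
  apply: (@eq_from_nth _ set0); first by rewrite size_map size_enum_ord.
  move=> i iP; rewrite (nth_map (Ordinal iP)) ?size_enum_ord//.
  by rewrite nth_enum_ord.
have pP := finite_partition_family fP.
rewrite [in leLHS]PE entropy_wrt_law.
case: P fP pP {PE} => [[_ _ /seteqP[_]]|B P' _ pP].
  by rewrite big_nil => /(_ point I).
move: pP; rewrite [size _]/=; set M := size P'; set Pf := fun i : 'I_M.+1 => _ => pP.
pose Q := fun c : 'I_M.+1 * A => Pf c.1 `&` letter c.2.
have pQ : partition_family Q by apply: partition_familyI => //; exact: letter_family.
have qw : inv_weight (law sshift Q mu) by apply: law_inv_weight.
have m1 : marg fst (law sshift Q mu) = law sshift Pf mu.
  by apply: marg_law => // c x [].
have m2 : marg snd (law sshift Q mu) = shift_law.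
  by apply: marg_law => //; [exact: letter_family|move=> c x []].
have h1 : hent (law sshift Pf mu) <= hent (law sshift Q mu).
  by rewrite (hent_chain fst qw) m1 lerDr; have [_ ->] := relh_spec fst qw.
apply: (le_trans h1); rewrite (hent_chain snd qw) m2 gerDr.
apply/ler_addgt0Pr => e e0; rewrite add0r.
have e2 : 0 < e / 2 by rewrite divr_gt0.
(* With this [dl] a correct guess costs exactly [e / 2]; the error probability is then made small
   enough for the wrong guesses to cost at most [e / 2]. *)
pose dl : R := 1 - expR (- (e / 2)).
have dl0 : 0 < dl by rewrite subr_gt0 expR_lt1 oppr_lt0.
have dl1 : dl < 1 by rewrite gtrBl expR_gt0.
pose L : R := ln (M.+1%:R / dl).
have L0 : 0 <= L.
  by rewrite ln_ge0// ler_pdivlMr// mul1r (le_trans (ltW dl1))// ler1n.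
have L1 : 0 < L + 1 by rewrite ltr_wpDl.
have [n [g [n0 gP]]] := guess_exists pP (divr_gt0 e2 L1).
apply: (le_trans (guess_relh g dl0 dl1 qw n0)).
have dlE : 1 - dl = expR (- (e / 2)) by rewrite /dl opprB addrC subrK.
rewrite /guess_cost dlE expRK opprK [leRHS]splitr lerD2l.
rewrite -/L; apply: (le_trans (ler_wpM2l L0 gP)).
by rewrite mulrCA ler_piMr ?(ltW e2)// ler_pdivrMr// mul1r lerDl.
Qed.

Theorem ks_entropy_shift : ks_entropy (pr mu) sshift = hent shift_law.
Proof.
rewrite /ks_entropy; set S := (X in ereal_sup X).
suff -> : ereal_sup S = (hent shift_law)%:E by [].
apply/eqP; rewrite eq_le; apply/andP; split.
  by apply: ge_ereal_sup => _ [P fP <-]; rewrite lee_fin entropy_partition_le.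
apply: ereal_sup_ubound; exists [seq letter a | a <- enum A].
  by apply: partition_family_finite; exact: letter_family.
by rewrite entropy_wrt_law.
Qed.

End KolmogorovSinai.

(** * Measures with prescribed cylinder weights *)

Section PushForward.
Context {d d'} {T : measurableType d} {T' : measurableType d'} {R : realType}.
Variables (P : probability T R) (f : T -> T') (mf : measurable_fun setT f).

HB.instance Definition _ := @isMeasurableFun.Build _ _ _ _ f mf.

Definition push_probability : probability T' R := distribution P f.

Lemma push_probabilityE B : push_probability B = P (f @^-1` B).
Proof. by []. Qed.

End PushForward.

Section UnitLebesgue.
Context {R : realType}.

Lemma unit_itv_meas : measurable (`[0, 1[%classic : set (measurableTypeR R)).
Proof. exact: measurable_itv. Qed.

Definition unit_leb : set (measurableTypeR R) -> \bar R :=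
  mrestr (@lebesgue_measure R) unit_itv_meas.

HB.instance Definition _ := Measure.on unit_leb.

Lemma unit_leb_setT : unit_leb setT = 1%E.
Proof.
by rewrite /unit_leb /mrestr setTI lebesgue_measure_itv/= lte_fin ltr01 oppr0 adde0.
Qed.

HB.instance Definition _ := Measure_isProbability.Build _ _ _ unit_leb unit_leb_setT.

End UnitLebesgue.

(* A measure with prescribed cylinder weights is the image of Lebesgue measure on [0, 1[ under the
   quantile coding: the interval attached to [w] has length [q w] and is cut into the intervals of its children. *)
Section Coding.
Context {R : realType} {A : pointedFinType}.
Variables (q : seq A -> R) (qw : weight q).
Notation X := (shiftspace A).

Definition rank_sum (w : seq A) (k : nat) : R :=
  \sum_(b : A | (enum_rank b < k)%N) q (rcons w b).

Fixpoint left_end_from (p w : seq A) : R :=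
  if w is a :: w' then rank_sum p (enum_rank a) + left_end_from (rcons p a) w' else 0.

Definition left_end (w : seq A) : R := left_end_from [::] w.

Definition code_itv (w : seq A) : set R := `[left_end w, left_end w + q w[%classic.

Lemma left_end_rcons w a : left_end (rcons w a) = left_end w + rank_sum w (enum_rank a).
Proof.
rewrite /left_end; suff H p : left_end_from p (rcons w a) =
    left_end_from p w + rank_sum (p ++ w) (enum_rank a) by exact: H.
elim: w p => [|b w IH] p /=; first by rewrite addr0 add0r cats0.
by rewrite IH addrA cat_rcons.
Qed.

Lemma rank_sum0 w : rank_sum w 0 = 0.
Proof. by rewrite /rank_sum big_pred0. Qed.

Lemma rank_sum_card w : rank_sum w #|A| = q w.
Proof. by rewrite (weight_rcons qw w) /rank_sum; apply: eq_bigl => b; rewrite ltn_ord. Qed.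

Lemma rank_sumS w a : rank_sum w (enum_rank a).+1 = rank_sum w (enum_rank a) + q (rcons w a).
Proof.
rewrite /rank_sum (bigD1 a)//= addrC; congr (_ + _); apply: eq_bigl => b.
rewrite ltnS [RHS]ltn_neqAle andbC; congr (_ && _).
by rewrite -(inj_eq enum_rank_inj).
Qed.

Lemma rank_sum_mono w k l : (k <= l)%N -> rank_sum w k <= rank_sum w l.
Proof.
move=> kl; rewrite /rank_sum big_mkcond [leRHS]big_mkcond; apply: ler_sum => b _.
case: ifPn => bk; first by rewrite (leq_trans bk).
by case: ifP => // _; exact: weight_ge0.
Qed.

Lemma code_itvP w x : code_itv w x <-> left_end w <= x < left_end w + q w.
Proof. by rewrite /code_itv/= in_itv/=. Qed.

Lemma code_itv_sub w a : code_itv (rcons w a) `<=` code_itv w.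
Proof.
move=> x /code_itvP; rewrite left_end_rcons -addrA -rank_sumS => /andP[h1 h2].
apply/code_itvP; apply/andP; split.
  by rewrite (le_trans _ h1)// lerDl -(rank_sum0 w) rank_sum_mono.
by rewrite (lt_le_trans h2)// lerD2l -rank_sum_card rank_sum_mono.
Qed.

Lemma code_itv_inj w a b x : code_itv (rcons w a) x -> code_itv (rcons w b) x -> a = b.
Proof.
move=> /code_itvP; rewrite left_end_rcons -addrA -rank_sumS => /andP[a1 a2].
move=> /code_itvP; rewrite left_end_rcons -addrA -rank_sumS => /andP[b1 b2].
apply/enum_rank_inj/val_inj/eqP; rewrite eqn_leq.
apply/andP; split; rewrite leqNgt; apply/negP => h; have := rank_sum_mono w h; lra.
Qed.

Lemma code_itv_child w x : code_itv w x -> exists a, code_itv (rcons w a) x.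
Proof.
move=> /code_itvP/andP[x1 x2].
have ex : exists k, x < left_end w + rank_sum w k by exists #|A|; rewrite rank_sum_card.
have := ex_minnP ex; case=> k xk kmin.
case: k xk kmin => [|k] xk kmin.
  by move: xk; rewrite rank_sum0 addr0 ltNge x1.
have kA : (k < #|A|)%N by apply: kmin; rewrite rank_sum_card.
exists (enum_val (Ordinal kA)); apply/code_itvP.
rewrite left_end_rcons -addrA -rank_sumS enum_valK /= xk andbT leNgt.
by apply/negP => /kmin; rewrite ltnn.
Qed.

(** For [x] outside [[0, 1[] no child interval contains [x], and the default makes the code
    constantly [point]. *)
Definition code_child (w : seq A) (x : R) : A :=
  odflt point [pick a | `[< code_itv (rcons w a) x >]].

Fixpoint code_word (x : R) (n : nat) : seq A :=
  if n is n'.+1 then rcons (code_word x n') (code_child (code_word x n') x) else [::].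

Definition code (x : measurableTypeR R) : X := fun n => code_child (code_word x n) x.

Lemma pfxS (y : nat -> A) n : pfx y n.+1 = rcons (pfx y n) (y n).
Proof. by rewrite /pfx /mkseq -addn1 iotaD map_cat cats1. Qed.

Lemma pfx_code x n : pfx (code x) n = code_word x n.
Proof. by elim: n => // n IH; rewrite pfxS IH. Qed.

Lemma code_childP w x a : code_itv (rcons w a) x -> code_child w x = a.
Proof.
move=> xa; rewrite /code_child; case: pickP => [b /asboolP xb|/(_ a)/asboolP//].
exact: code_itv_inj xb xa.
Qed.

Lemma code_itv0 : code_itv [::] = `[0, 1[%classic.
Proof. by rewrite /code_itv /left_end/= (weight1 qw) add0r. Qed.

Lemma code_itv_unit w : code_itv w `<=` `[0, 1[%classic.
Proof.
elim/last_ind: w => [|w a IH]; first by rewrite code_itv0.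
by move=> x /code_itv_sub/IH.
Qed.

Lemma code_wordP x : `[0, 1[%classic x -> forall w, code_word x (size w) = w <-> code_itv w x.
Proof.
move=> x01 w; split.
  move=> <-; elim: (size w) => [|n IH] /=; first by rewrite code_itv0.
  by have [a xa] := code_itv_child IH; rewrite (code_childP xa).
elim/last_ind: w => [//|w a IH] xwa; rewrite size_rcons /=.
by rewrite (IH (code_itv_sub xwa)) (code_childP xwa).
Qed.

Lemma code_child_out w x : ~ `[0, 1[%classic x -> code_child w x = point.
Proof.
move=> x01; rewrite /code_child; case: pickP => //= a /asboolP xa.
by case: x01; exact: code_itv_unit xa.
Qed.

Lemma code_preimage w :
  code @^-1` itin sshift letter w `&` `[0, 1[%classic = code_itv w.
Proof.
rewrite itinE; apply/seteqP; split => x /=.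
  by rewrite pfx_code => -[xw x01]; apply/(code_wordP x01).
move=> xw; have x01 := code_itv_unit xw; split => //; rewrite pfx_code.
by apply/(code_wordP x01).
Qed.

Lemma measurable_code : measurable_fun setT code.
Proof.
have mI w : measurable (code_itv w : set (measurableTypeR R)) by exact: measurable_itv.
have key w : measurable (code @^-1` itin sshift letter w : set (measurableTypeR R)).
  have -> : code @^-1` itin sshift letter w = code_itv w `|`
      (code @^-1` itin sshift letter w `&` ~` `[0, 1[%classic).
    by rewrite -code_preimage -setIUr setUv setIT.
  apply: measurableU => //.
  (* Outside [[0, 1[] the code is constant, so the preimage contains all of the complement or none
     of it, according to whether [w] repeats [point]. *)
  have [->|] := eqVneq w (nseq (size w) point).
    rewrite (_ : _ `&` _ = ~` `[0, 1[%classic); first by apply: measurableC; exact: unit_itv_meas.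
    apply/seteqP; split => x; first by case.
    move=> x01; split => //; rewrite /= itinE /= size_nseq pfx_code.
    elim: (size w) => // n IH; rewrite -[n.+1]addn1 nseqD /= cats1 addn1 /= IH.
    by rewrite code_child_out.
  move=> /eqP wp; rewrite (_ : _ `&` _ = set0); first exact: measurable0.
  apply/seteqP; split => // x [] /=; rewrite itinE /= pfx_code => xw x01; apply: wp.
  rewrite -[LHS]xw; elim: (size w) => // n IH; rewrite -[n.+1]addn1 nseqD /= cats1 addn1 /= IH.
  by rewrite code_child_out.
apply: (@measurability _ _ _ X setT code (@cylinders A)) => //.
move=> _ [_ [n [w ->]] <-]; rewrite setTI.
have -> : [set x | forall k, (k < n)%N -> x k = w k] = itin sshift letter (mkseq w n) :> set X.
  rewrite itinE size_mkseq; apply/seteqP; split => x /=.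
    by move=> xw; apply/eq_in_map => i; rewrite mem_iota => /andP[_ ?]; rewrite xw.
  by move=> /eq_in_map xw k kn; rewrite xw// mem_iota.
exact: key.
Qed.

Definition weight_measure : probability X R := push_probability unit_leb measurable_code.

Lemma weight_measureE w : pr weight_measure (itin sshift letter w) = q w.
Proof.
rewrite /pr push_probabilityE -[X in fine X]/(lebesgue_measure _) code_preimage.
rewrite /code_itv lebesgue_measure_itv/= lte_fin ltrDl.
have := weight_ge0 qw w; rewrite le_eqVlt => /predU1P[<-|q0]; first by rewrite ltxx.
by rewrite q0 -EFinB addrAC subrr add0r.
Qed.

End Coding.

Section Uniqueness.
Context {R : realType} {A : pointedFinType}.
Notation X := (shiftspace A).

Lemma cylindersE (n : nat) (w : nat -> A) :
  [set x | forall k, (k < n)%N -> x k = w k] = itin sshift letter (mkseq w n) :> set X.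
Proof.
rewrite itinE size_mkseq; apply/seteqP; split => x /=.
  by move=> xw; apply/eq_in_map => i; rewrite mem_iota => /andP[_ ?]; rewrite xw.
by move=> /eq_in_map xw k kn; rewrite xw// mem_iota.
Qed.

(** Two cylinders are nested or disjoint, so together with the empty set they form a class stable
    under intersection that generates the sigma-algebra. *)
Lemma shift_measure_unique (m1 m2 : probability X R) :
  (forall w, m1 (itin sshift letter w) = m2 (itin sshift letter w)) ->
  forall B, measurable B -> m1 B = m2 B.
Proof.
move=> H B mB.
pose G : set (set X) := [set C | C = set0 \/ exists w, C = itin sshift letter w].
have Gm : G `<=` measurable.
  by move=> _ [->|[w ->]]; [exact: measurable0|exact: measurable_itin].
apply: (@g_sigma_algebra_measure_unique _ R X G Gm (fun=> setT)).
- by move=> _; right; exists [::].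
- by apply/seteqP; split => // x _; exists 0%N.
- have aux w w' : (size w <= size w')%N -> G (itin sshift letter w `&` itin sshift letter w').
    move=> ww'; have [tw|tw] := eqVneq (take (size w) w') w.
      right; exists w'; apply/setIidPr; rewrite !itinE => x /= xw'.
      rewrite -[RHS]tw -[in RHS]xw' /pfx /mkseq -map_take take_iota.
      by rewrite (minn_idPl ww').
    left; apply/seteqP; split => // x; rewrite !itinE /= => -[xw xw'].
    case/eqP: tw; rewrite -[RHS]xw -[in LHS]xw' /pfx /mkseq -map_take take_iota.
    by rewrite (minn_idPl ww').
  move=> C D [->|[w ->]]; first by rewrite set0I; left.
  move=> [->|[w' ->]]; first by rewrite setI0; left.
  by have [/aux//|/ltnW/aux] := leqP (size w) (size w'); rewrite setIC.
- move=> _ [->|[w ->]]; last exact: H.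
  by transitivity (0 : \bar R)%E; [exact: measure0|symmetry; exact: measure0].
- move=> _; apply: (@le_lt_trans _ _ (1 : \bar R)%E); last exact: ltry.
  by rewrite le_eqVlt; apply/orP; left; apply/eqP; exact: probability_setT.
- suff : measurable `<=` <<s G >> by apply.
  apply: smallest_sub; first exact: smallest_sigma_algebra.
  by move=> _ [n [w ->]]; apply: sub_sigma_algebra; right; exists (mkseq w n); rewrite cylindersE.
Qed.

Lemma weight_measure_invariant (q : seq A -> R) (qw : inv_weight q) :
  is_invariant (weight_measure qw) sshift.
Proof.
have ms := @measurable_sshift A.
move=> B mB; rewrite -[LHS]/(push_probability (weight_measure qw) ms B).
apply: shift_measure_unique => // w; rewrite push_probabilityE.
have mw : measurable (@sshift A @^-1` itin sshift letter w).
  by rewrite -[X in measurable X]setTI; apply: ms => //; exact: measurable_itin.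
rewrite !prE//; last exact: measurable_itin.
congr EFin; rewrite weight_measureE.
rewrite (pr_split (F := letter) (weight_measure qw) mw).
- rewrite (weight_cons qw); apply: eq_bigr => a _.
  by rewrite setIC -(weight_measureE qw (a :: w)).
- exact: pf_meas letter_family.
- exact: pf_cover letter_family.
- exact: pf_disj letter_family.
Qed.

Lemma weight_measure_law (q : seq A -> R) (qw : weight q) : shift_law (weight_measure qw) = q.
Proof. by apply/funext => w; exact: weight_measureE. Qed.

End Uniqueness.

(** * Lebesgue integrals of continuous observables *)

Section Integral.
Context {R : realType} {A : pointedFinType}.
Notation X := (shiftspace A).
Variables (mu : probability X R) (phi : X -> R).
Hypothesis uc : unif_cont phi.

Lemma osc_pfx k e x : osc phi k e -> `|phi x - phi (pad point (pfx x k))| <= e.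
Proof. by move=> ok; apply: ok => i ik; rewrite /pad nth_mkseq. Qed.

Lemma unif_cont_measurable : measurable_fun setT phi.
Proof.
apply: (measurable_fun_cvg (h := fun k (x : X) => phi (pad point (pfx x k)))).
  move=> k _ Y mY; rewrite setTI.
  have -> : (fun x : X => phi (pad point (pfx x k))) @^-1` Y =
      cyl k (fun w => `[< Y (phi (pad point w)) >]).
    by apply/seteqP; split => x; rewrite /cyl/= => /asboolP.
  exact: measurable_cyl.
move=> x _; apply/cvgrPdist_le => e e0; have [k ok] := uc e0.
by exists k => // n /= kn; apply: osc_pfx; exact: osc_mono ok.
Qed.

Lemma unif_cont_integrable B : measurable B -> mu.-integrable B (EFin \o phi).
Proof.
move=> mB; apply: measurable_bounded_integrable => //.
- by rewrite ltey_eq fin_num_measure.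
- by apply: measurable_funTS; exact: unif_cont_measurable.
- have [M [M0 MP]] := unif_cont_bounded point uc.
  exists M; split; first exact: num_real.
  by move=> y My x _; exact: le_trans (MP x) (ltW My).
Qed.

(** On a cylinder of length [k] the function differs from its value at the padded word by at most
    [e]; summing over the cylinders compares the Lebesgue integral with [ev]. *)
Lemma integral_integ I : integ point (shift_law mu) phi I ->
  (\int[mu]_x (phi x)%:E)%E = I%:E.
Proof.
move=> qI; have mphi := unif_cont_measurable.
pose J : R := Rintegral mu setT phi.
have JE : (\int[mu]_x (phi x)%:E)%E = J%:E.
  by rewrite /J /Rintegral fineK//; apply: integrable_fin_num => //; exact: unif_cont_integrable.
rewrite JE; congr EFin; apply: (cvgr_unique _ qI).
have mitin w : measurable (itin sshift letter w : set X) by exact: measurable_itin.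
apply/cvgrPdist_le => e e0; have [k0 ok0] := uc e0.
exists k0 => // k /= k0k; have ok := osc_mono k0k ok0.
have JS : J = \sum_(w <- words A k) Rintegral mu (itin sshift letter w) phi.
  apply: EFin_inj; rewrite -JE -sumEFin.
  have cov : \big[setU/set0]_(w <- words A k) itin sshift letter w = setT :> set X.
    rewrite -bigcup_seq; apply/seteqP; split => // x _; exists (pfx x k).
      by rewrite /= mem_words size_mkseq.
    by rewrite itinE /= size_mkseq.
  rewrite -[in LHS]cov integral_bigsetU_EFin ?words_uniq//.
  - apply: eq_bigr => w _; rewrite /Rintegral fineK//.
    by apply: integrable_fin_num => //; exact: unif_cont_integrable.
  - move=> w w' /=; rewrite !mem_words => /eqP sw /eqP sw' [x [xw xw']].
    by apply: (itin_inj letter_family _ xw xw'); rewrite sw.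
  - by apply/measurable_EFinP; apply: measurable_funTS.
rewrite JS /ev -sumrB (le_trans (ler_norm_sum _ _ _))//.
apply: (@le_trans _ _ (\sum_(w <- words A k) e * pr mu (itin sshift letter w))); last first.
  rewrite -mulr_sumr -[leRHS]mulr1 ler_wpM2l ?(ltW e0)//.
  have := pr_itin_split measurable_sshift letter_family mu k measurableT.
  by rewrite prT => ->; apply: ler_sum => w _; rewrite setTI.
apply: le_words => w sw.
have cI (c : R) : mu.-integrable (itin sshift letter w) (EFin \o cst c).
  by apply: finite_measure_integrable_cst.
have near x : itin sshift letter w x -> `|phi x - phi (pad point w)| <= e.
  by rewrite itinE /= => xw; rewrite -xw sw; exact: osc_pfx.
have iphi := unif_cont_integrable (mitin w).
have cE c : c * pr mu (itin sshift letter w) =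
    Rintegral mu (itin sshift letter w) (cst c) by rewrite Rintegral_cst.
rewrite /shift_law /law mulrC ler_distl; apply/andP; split.
  rewrite -mulrBl cE; apply: (le_Rintegral (mitin w) (cI _) iphi) => x /near.
  by rewrite ler_distl => /andP[].
rewrite -mulrDl cE; apply: (le_Rintegral (mitin w) iphi (cI _)) => x /near.
by rewrite ler_distl => /andP[].
Qed.

End Integral.

(** * Hausdorff measure *)

Section HausdorffBounds.
Context {R : realType}.
Implicit Types (U E : set (R * R)) (s t : R).

Lemma diam_pow_ge0 U s : 0 <= diam_pow U s.
Proof. by rewrite /diam_pow; case: ifP => // _; exact: powR_ge0. Qed.

Lemma diam2_ge0 U : U !=set0 -> (0 <= diam2 U)%E.
Proof.
move=> [z Uz]; apply: ereal_sup_ubound; exists z => //; exists z => //.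
by rewrite /dist2 !subrr expr2 mul0r addr0 sqrtr0.
Qed.

Lemma diam2_set0_le (e : \bar R) : (diam2 (@set0 (R * R)) <= e)%E.
Proof. by apply: ge_ereal_sup => _ [z []]. Qed.

Lemma diam2_le U (e : R) : (forall z w, U z -> U w -> dist2 z w <= e) -> (diam2 U <= e%:E)%E.
Proof. by move=> H; apply: ge_ereal_sup => _ [z Uz [w Uw <-]]; rewrite lee_fin H. Qed.

Lemma diam2_dist U (e : R) z w : (diam2 U <= e%:E)%E -> U z -> U w -> dist2 z w <= e.
Proof.
move=> dU Uz Uw; rewrite -lee_fin; apply: le_trans dU.
by apply: ereal_sup_ubound; exists z => //; exists w.
Qed.

Lemma norm_le_dist2 (z w : R * R) : `|z.1 - w.1| <= dist2 z w /\ `|z.2 - w.2| <= dist2 z w.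
Proof.
by rewrite -!sqrtr_sqr /dist2; split; rewrite ler_wsqrtr// ?lerDl ?lerDr sqr_ge0.
Qed.

Lemma dist2_le (z w : R * R) e : `|z.1 - w.1| <= e -> `|z.2 - w.2| <= e -> dist2 z w <= 2 * e.
Proof.
move=> h1 h2; have e0 : 0 <= e by exact: le_trans h1.
rewrite /dist2 -[leRHS]ger0_norm ?mulr_ge0// -sqrtr_sqr ler_wsqrtr//.
rewrite -[(z.1 - _) ^+ 2]real_normK ?num_real// -[(z.2 - _) ^+ 2]real_normK ?num_real//.
have : `|z.1 - w.1| ^+ 2 <= e ^+ 2 by rewrite ler_pXn2r ?nnegrE.
have : `|z.2 - w.2| ^+ 2 <= e ^+ 2 by rewrite ler_pXn2r ?nnegrE.
have := sqr_ge0 e; rewrite exprMn; lra.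
Qed.

Lemma diam_pow_le U s e : 0 <= s -> (diam2 U <= e%:E)%E -> diam_pow U s <= e `^ s.
Proof.
move=> s0 dU; rewrite /diam_pow; case: asboolP => [_|/eqP/set0P U0]; first exact: powR_ge0.
have d0 := diam2_ge0 U0.
have e0 : 0 <= e by rewrite -lee_fin; exact: le_trans dU.
have df : diam2 U \is a fin_num by rewrite ge0_fin_numE// (le_lt_trans dU)// ltry.
by apply: ge0_ler_powR; rewrite ?nnegrE ?fine_ge0// -lee_fin fineK.
Qed.

Lemma hausdorff_delta_ge0 s dl E : (0 <= hausdorff_delta s dl E)%E.
Proof.
apply: le_ereal_inf_tmp => _ [U _ <-]; apply: nneseries_ge0 => k _ _.
by rewrite lee_fin diam_pow_ge0.
Qed.

Lemma hausdorff_dim_le s E : 0 <= s -> hausdorff_measure s E = 0%E -> (hausdorff_dim E <= s%:E)%E.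
Proof. by move=> s0 Hs; apply: ereal_inf_lbound; exists s. Qed.

(* Borel-Cantelli for covers; the padding by [set0] makes the concatenated lists longer than their index. *)
Lemma hausdorff_measure_limsup s E (l : nat -> seq (set (R * R))) :
  (forall z, E z -> forall N, exists n, (N <= n)%N /\ exists2 U, U \in l n & U z) ->
  (forall dl, 0 < dl -> exists N, forall n U, (N <= n)%N -> U \in l n -> (diam2 U <= dl%:E)%E) ->
  (forall e, 0 < e -> exists N, forall M,
     \sum_(N <= n < M) \sum_(U <- l n) diam_pow U s <= e) ->
  hausdorff_measure s E = 0%E.
Proof.
move=> cov dia sm; apply/eqP; rewrite eq_le; apply/andP; split; last first.
  by apply: (@le_trans _ _ (hausdorff_delta s 1 E)); rewrite ?hausdorff_delta_ge0//;
     apply: ereal_sup_ubound; exists 1 => /=.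
apply: ge_ereal_sup => _ [dl /= dl0 <-].
apply/lee_addgt0Pr => e e0; rewrite add0e.
have [N1 N1P] := dia dl dl0; have [N2 N2P] := sm e e0.
pose N := maxn N1 N2.
pose C K := flatten [seq set0 :: l (N + n)%N | n <- iota 0 K].
have CS K : C K.+1 = C K ++ (set0 :: l (N + K)%N).
  by rewrite /C -addn1 iotaD map_cat flatten_cat /= cats0.
have sC K : (K <= size (C K))%N.
  elim: K => // K IH; rewrite CS size_cat /=.
  by rewrite addnS ltnS (leq_trans IH)// leq_addr.
have pC K K' : (K <= K')%N -> exists r, C K' = C K ++ r.
  move/subnKC <-; elim: (K' - K)%N => [|j [r IH]]; first by exists [::]; rewrite addn0 cats0.
  by rewrite addnS CS IH -catA; eexists.
(* The list [C k.+1] has more than [k] entries and is a prefix of all later lists, so [U] enumerates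
   every piece from index [N] on. *)
pose U k := nth set0 (C k.+1) k.
have UC K k : (k < K)%N -> U k = nth set0 (C K) k.
  move=> kK; have [r ->] := pC k.+1 K kK; rewrite nth_cat.
  by rewrite (leq_trans (ltnSn k) (sC k.+1)).
have inC K V : V \in C K -> V = set0 \/ exists2 n, (N <= n)%N & V \in l n.
  move/flattenP => [_ /mapP[n _ ->]]; rewrite inE => /predU1P[->|Vn]; first by left.
  by right; exists (N + n)%N => //; exact: leq_addr.
apply: (@le_trans _ _ (\sum_(k <oo) (diam_pow (U k) s)%:E)%E).
  apply: ereal_inf_lbound; exists U => //; split.
    move=> z Ez; have [n [Nn [V Vn Vz]]] := cov z Ez N.
    have VC : V \in C (n - N).+1 by rewrite CS subnKC// mem_cat inE Vn !orbT.
    pose i := index V (C (n - N).+1); exists i => //; rewrite /U; pose K := maxn i.+1 (n - N).+1.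
    have -> : nth set0 (C i.+1) i = nth set0 (C K) i by exact: (UC K i (leq_maxl _ _)).
    have [r ->] := pC (n - N).+1 K (leq_maxr _ _).
    by rewrite nth_cat index_mem VC nth_index.
  move=> k; have Uk : U k \in C k.+1 by exact: mem_nth (sC k.+1).
  have [->|[n Nn Vn]] := inC _ _ Uk; first exact: diam2_set0_le.
  by apply: N1P Vn; exact: leq_trans (leq_maxl _ _) Nn.
have dp0 : diam_pow set0 s = 0 by rewrite /diam_pow; case: asboolP.
apply: lime_le.
  by apply: is_cvg_nneseries => k _ _; rewrite lee_fin diam_pow_ge0.
apply: nearW => K; rewrite sumEFin lee_fin.
apply: (@le_trans _ _ (\sum_(V <- C K) diam_pow V s)).
  rewrite (big_nth set0) (big_cat_nat (leq0n K) (sC K))/=.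
  rewrite big_nat [X in _ <= X + _]big_nat.
  rewrite (eq_bigr (fun k => diam_pow (nth set0 (C K) k) s)).
    by rewrite lerDl sumr_ge0// => k _; exact: diam_pow_ge0.
  by move=> k /andP[_ kK]; rewrite (UC K).
have -> : \sum_(V <- C K) diam_pow V s = \sum_(N <= n < N + K) \sum_(V <- l n) diam_pow V s.
  elim: K => [|K IH]; first by rewrite addn0 big_geq// /C big_nil.
  by rewrite CS big_cat/= big_cons dp0 add0r addnS big_nat_recr ?leq_addr//= IH.
apply: le_trans (N2P (N + K)%N).
rewrite [leRHS](big_cat_nat (leq_maxr N1 N2) (leq_addr K N))/= lerDr.
by apply: sumr_ge0 => n _; apply: sumr_ge0 => V _; exact: diam_pow_ge0.
Qed.

Section MassDistribution.
Context {d} {T : measurableType d}.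
Variables (P : probability T R) (E' : set T) (Pt : T -> R * R) (C s t r0 : R).
Hypotheses (mE : measurable E') (PE : pr P E' = 1).
Hypotheses (C0 : 0 <= C) (s0 : 0 < s) (t0 : 0 <= t) (ts : t < s) (r00 : 0 < r0).
Hypothesis ball_mass : forall r U, 0 < r < r0 -> (diam2 U <= r%:E)%E ->
  exists S, [/\ measurable S, E' `&` Pt @^-1` U `<=` S & pr P S <= C * r `^ s].

(** [ball_mass] asks for a positive radius; a set of diameter 0 is enclosed in a radius [r] with
    [C * r ^ s <= eta], which is the reason for the term [eta]. The set [S] stands in for the
    preimage of [U], which need not be measurable since [U] is arbitrary. *)
Lemma cover_mass U (dl eta : R) : dl < r0 -> dl < 1 -> 0 < eta -> (diam2 U <= dl%:E)%E ->
  exists S, [/\ measurable S, E' `&` Pt @^-1` U `<=` S & pr P S <= C * diam_pow U t + eta].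
Proof.
move=> dlr dl1 eta0 dU; have [->|/set0P U0] := eqVneq U set0.
  exists set0; split => //.
  by rewrite {1}/pr measure0/= addr_ge0 ?(ltW eta0)// mulr_ge0// diam_pow_ge0.
have d0 := diam2_ge0 U0.
have df : diam2 U \is a fin_num by rewrite ge0_fin_numE// (le_lt_trans dU)// ltry.
pose D := fine (diam2 U); have DU : diam2 U = D%:E by rewrite fineK.
have Ddl : D <= dl by rewrite -lee_fin -DU.
have D0 : 0 <= D by exact: fine_ge0.
have DP : diam_pow U t = D `^ t.
  by rewrite /diam_pow; case: asboolP => // UE; case: U0 => z; rewrite UE.
move: D0; rewrite le_eqVlt => /predU1P[D0|D0].
  pose r := Num.min (r0 / 2) ((eta / (C + 1)) `^ s^-1).
  have C1 : 0 < C + 1 by rewrite ltr_wpDl.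
  have r0' : 0 < r by rewrite lt_min divr_gt0//= powR_gt0// divr_gt0.
  have rr0 : r < r0 by rewrite gt_min ltr_pdivrMr// ltr_pMr// ltr1n.
  have [||S [mS ES PS]] := @ball_mass r U; first by rewrite r0' rr0.
    by rewrite DU -D0 lee_fin ltW.
  exists S; split => //; apply: (le_trans PS); apply: (@le_trans _ _ eta); last first.
    by rewrite lerDr mulr_ge0// diam_pow_ge0.
  have : r `^ s <= eta / (C + 1).
    apply: (@le_trans _ _ (((eta / (C + 1)) `^ s^-1) `^ s)).
      by apply: ge0_ler_powR; rewrite ?nnegrE ?powR_ge0 ?(ltW s0) ?(ltW r0')// ge_min lexx orbT.
    by rewrite -powRrM mulVf ?gt_eqF// powRr1// divr_ge0// ltW.
  rewrite ler_pdivlMr// => h; rewrite (le_trans _ h)// mulrC ler_wpM2l ?powR_ge0// lerDl//.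
have [||S [mS ES PS]] := @ball_mass D U.
- by rewrite D0 (le_lt_trans Ddl).
- by rewrite DU.
exists S; split => //; apply: (le_trans PS).
rewrite DP; apply: (@le_trans _ _ (C * D `^ t)); last by rewrite lerDl ltW.
apply: ler_wpM2l => //; apply: ger_powR; last exact: ltW.
by rewrite D0 (le_trans Ddl)// ltW.
Qed.

(** Mass distribution principle: a cover with too small a sum of powers would carry a total mass
    below 1, although it covers a set of full mass. *)
Lemma hausdorff_measure_neq0 E : Pt @` E' `<=` E -> hausdorff_measure t E != 0%E.
Proof.
move=> EE; apply/eqP => H0.
pose dl : R := Num.min (r0 / 2) (1 / 2).
have dl0 : 0 < dl by rewrite lt_min !divr_gt0.
have dlr : dl < r0 by rewrite gt_min ltr_pdivrMr// ltr_pMr// ltr1n.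
have dl1 : dl < 1 by rewrite gt_min [X in _ || X]ltr_pdivrMr// mul1r ltr1n orbT.
have C2 : 0 < C + 2 by rewrite ltr_wpDl.
(* The cover contributes at most [C * eta] and the geometric correction terms [eta], in total
   [(C + 1) / (C + 2) < 1]. *)
pose eta : R := (C + 2)^-1.
have eta0 : 0 < eta by rewrite invr_gt0.
have hd0 : (hausdorff_delta t dl E < eta%:E)%E.
  apply: (@le_lt_trans _ _ 0%E); last by rewrite lte_fin.
  by rewrite -H0; apply: ereal_sup_ubound; exists dl.
have [_ [U [UE Udl] <-] Ueta] := ereal_inf_lt hd0.
have e2 k : 0 < eta / (2 ^ k.+1)%:R by rewrite divr_gt0// ltr0n expn_gt0.
have /choice[S SP] := fun k => cover_mass dlr dl1 (e2 k) (Udl k).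
have mS k : measurable (S k) by case: (SP k).
have ES : E' `<=` \bigcup_k S k.
  move=> x Ex; have [k _ Uk] : (\bigcup_k U k) (Pt x) by apply: UE; apply: EE; exists x.
  by exists k => //; have [_ h _] := SP k; exact: h.
have : (P E' <= \sum_(k <oo) P (S k))%E by exact: measure_sigma_subadditive.
rewrite (prE P mE) PE.
apply/negP; rewrite -ltNge.
apply: (@le_lt_trans _ _ (\sum_(k <oo) (C%:E * (diam_pow (U k) t)%:E + (eta / (2 ^ k.+1)%:R)%:E))%E).
  apply: lee_nneseries => [k _ _|k _]; first exact: measure_ge0.
  by rewrite (prE P (mS k)) -EFinM -EFinD lee_fin; have [_ _] := SP k.
have dp0 k : (0 <= (diam_pow (U k) t)%:E)%E by rewrite lee_fin diam_pow_ge0.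
apply: (le_lt_trans (epsilon_trick _ _ _)).
- by move=> k; rewrite mule_ge0// lee_fin.
- exact: ltW.
rewrite nneseriesZl//; apply: (@le_lt_trans _ _ (C%:E * eta%:E + eta%:E)%E).
  by rewrite leeD2r// lee_wpmul2l ?lee_fin// ltW.
rewrite -EFinM -EFinD lte_fin /eta -[X in _ + X]mul1r -mulrDl ltr_pdivrMr// mul1r.
by rewrite ltrD2l ltr1n.
Qed.

End MassDistribution.

End HausdorffBounds.

(** * Empirical weights and types *)

Section Windows.
Context {A : eqType}.

Definition win (x : nat -> A) (l k : nat) : seq A := [seq x (l + i)%N | i <- iota 0 k].

Lemma size_win x l k : size (win x l k) = k.
Proof. by rewrite size_map size_iota. Qed.

Lemma winSr x l k : win x l k.+1 = rcons (win x l k) (x (l + k)%N).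
Proof. by rewrite /win -addn1 iotaD map_cat cats1. Qed.

Lemma winSl x l k : win x l k.+1 = x l :: win x l.+1 k.
Proof.
rewrite /win /= addn0; congr cons; rewrite (iotaDl 1 0) -map_comp.
by apply: eq_map => i /=; rewrite addnA addn1.
Qed.

Lemma win_mkseq x l k n : (l + k <= n)%N -> take k (drop l (mkseq x n)) = win x l k.
Proof.
move=> lkn; rewrite /mkseq -map_drop -map_take drop_iota take_iota add0n.
have -> : minn k (n - l) = k by apply/minn_idPl; lia.
by rewrite -[l in iota l]addn0 iotaDl -map_comp.
Qed.

End Windows.

Lemma map_win (A B : eqType) (p : A -> B) x l k : map p (win x l k) = win (p \o x) l k.
Proof. by rewrite /win -map_comp. Qed.

Section Empirical.
Context {R : realType} {A : finType}.
Implicit Type x : nat -> A.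

(* The windows counted start before [n] but may end after it. *)
Definition emp x (n : nat) (w : seq A) : R :=
  n%:R^-1 * \sum_(l < n) (win x l (size w) == w)%:R.

Lemma emp_sum x n k (F : seq A -> R) :
  \sum_(w <- words A k) emp x n w * F w = n%:R^-1 * \sum_(l < n) F (win x l k).
Proof.
transitivity (\sum_(w <- words A k) n%:R^-1 * \sum_(l < n) (w == win x l k)%:R * F w).
  apply: eq_words => w sw; rewrite /emp sw -mulrA mulr_suml; congr (_ * _).
  by apply: eq_bigr => l _; rewrite eq_sym.
rewrite -mulr_sumr exchange_big/=; congr (_ * _); apply: eq_bigr => l _.
by rewrite big_words_delta ?size_win.
Qed.

Lemma emp_weight x n : (0 < n)%N -> weight (emp x n).
Proof.
move=> n0; split.
- rewrite /emp (eq_bigr (fun=> 1)) ?sumr_const ?card_ord ?mulVf ?pnatr_eq0 -?lt0n//.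
- by move=> w; rewrite mulr_ge0 ?invr_ge0// sumr_ge0.
- move=> w; rewrite /emp -mulr_sumr exchange_big/=; congr (_ * _); apply: eq_bigr => l _.
  rewrite (bigD1 (x (l + size w)%N))//= size_rcons winSr eqseq_rcons eqxx andbT.
  rewrite big1 ?addr0// => c cx; rewrite size_rcons winSr eqseq_rcons.
  by rewrite [x _ == c]eq_sym (negbTE cx) andbF.
Qed.

(** Consistency on the right is exact because windows may pass [n]. On the left the starting points
    shift by one and the sums telescope to the windows at 0 and at [n]. *)
Lemma emp_left x n w : (0 < n)%N ->
  `|emp x n w - \sum_c emp x n (c :: w)| <= n%:R^-1.
Proof.
move=> n0; have -> : \sum_c emp x n (c :: w) =
    n%:R^-1 * \sum_(l < n) (win x l.+1 (size w) == w)%:R.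
  rewrite /emp -mulr_sumr exchange_big/=; congr (_ * _); apply: eq_bigr => l _.
  rewrite (bigD1 (x l))//= winSl eqseq_cons eqxx.
  by rewrite big1 ?addr0// => c cx; rewrite eqseq_cons [x l == c]eq_sym (negbTE cx).
rewrite /emp -mulrBr normrM ger0_norm ?invr_ge0// ler_piMr ?invr_ge0//.
pose g l : R := (win x l (size w) == w)%:R.
rewrite -[X in X - _](big_mkord predT g) -[X in _ - X](big_mkord predT (g \o S)).
have -> : \sum_(0 <= i < n) g i - \sum_(0 <= i < n) (g \o S) i = g 0%N - g n.
  have := telescope_sumr g (leq0n n); rewrite sumrB/= => h.
  by rewrite -[LHS]opprB h opprB.
by rewrite /g; case: (_ == _); case: (_ == _); rewrite ?subrr ?subr0 ?sub0r ?normr0 ?normrN ?normr1.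
Qed.

Lemma lyap_w_emp (l : A -> R) x n : lyap_w l (emp x n) = n%:R^-1 * \sum_(i < n) l (x i).
Proof.
rewrite /lyap_w -(big_words1 (fun w => emp x n w * (if w is c :: _ then l c else 0))).
by rewrite emp_sum; congr (_ * _); apply: eq_bigr => i _; rewrite /win/= addn0.
Qed.

Lemma ev_emp pt phi x n k :
  ev pt (emp x n) phi k = n%:R^-1 * \sum_(l < n) phi (pad pt (win x l k)).
Proof. by rewrite /ev emp_sum. Qed.

End Empirical.

Lemma marg_emp {R : realType} (A B : finType) (p : A -> B) x n :
  marg p (emp x n : seq A -> R) = emp (p \o x) n.
Proof.
apply/funext => z; rewrite /marg big_mkcond.
transitivity (\sum_(w <- words A (size z)) (emp x n w * (map p w == z)%:R : R)).
  by apply: eq_bigr => w _; case: eqP => _; rewrite ?mulr1 ?mulr0.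
rewrite emp_sum /emp; congr (_ * _); apply: eq_bigr => l _.
by rewrite map_win.
Qed.

(** * Products of block kernels over disjoint blocks *)

Section Tiling.
Context {R : realType} {A B : finType} (p : A -> B).
Variables (kap : seq A -> R) (k : nat).
Hypothesis kap0 : forall w, 0 <= kap w.
Hypothesis kap1 : forall z, size z = k -> \sum_(w <- words A k | map p w == z) kap w <= 1.

Fixpoint tile (N : nat) (u : seq A) : R :=
  if N is N'.+1 then kap (take k u) * tile N' (drop k u) else 1.

Lemma tile_ge0 N u : 0 <= tile N u.
Proof. by elim: N u => //= N IH u; rewrite mulr_ge0. Qed.

Lemma count_fiber n v : size v = n -> \sum_(u <- words A n | map p u == v) (1 : R) <= #|A|%:R ^+ n.
Proof.
move=> sv; rewrite big_mkcond; apply: (@le_trans _ _ (\sum_(u <- words A n) 1)).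
  by apply: ler_sum => u _; case: ifP.
clear v sv; elim: n => [|n IH]; first by rewrite big_words0 expr0.
by rewrite big_wordsS sumr_const -[X in X <= _]mulr_natl exprS; exact: ler_wpM2l.
Qed.

(** Each block contributes a factor at most 1 over its row fiber; every letter after the last block
    is counted crudely by [#|A|]. *)
Lemma tile_sum0 N n v : size v = n -> (N * k <= n)%N ->
  \sum_(u <- words A n | map p u == v) tile N u <= #|A|%:R ^+ (n - N * k).
Proof.
elim: N n v => [|N IH] n v sv Nk /=; first by rewrite subn0 count_fiber.
have kn : (k <= n)%N by apply: leq_trans Nk; rewrite mulSn leq_addr.
have stv : size (take k v) = k by rewrite size_take sv; case: ltnP => //; lia.
have sdv : size (drop k v) = (n - k)%N by rewrite size_drop sv.
rewrite -{1}(subnKC kn) -{1}(cat_take_drop k v) (big_fiber_cat _ _ _ _ stv).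
apply: (@le_trans _ _ (\sum_(u <- words A k | map p u == take k v)
    kap u * #|A|%:R ^+ (n - k - N * k))).
  rewrite big_seq_cond [leRHS]big_seq_cond; apply: ler_sum => u /andP[].
  rewrite mem_words => /eqP su _.
  rewrite (eq_bigr (fun w => kap u * tile N w)).
    by rewrite -mulr_sumr ler_wpM2l// IH//; rewrite mulSn in Nk; lia.
  by move=> w _; rewrite take_size_cat// drop_size_cat.
rewrite -mulr_suml mulSn subnDA ler_piMl ?exprn_ge0//; exact: kap1.
Qed.

Lemma tile_sum N j n v : size v = n -> (j + N * k <= n)%N ->
  \sum_(u <- words A n | map p u == v) tile N (drop j u) <= #|A|%:R ^+ (n - N * k).
Proof.
move=> sv jN; have jn : (j <= n)%N by apply: leq_trans jN; rewrite leq_addr.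
have stv : size (take j v) = j by rewrite size_take sv; case: ltnP => //; lia.
have sdv : size (drop j v) = (n - j)%N by rewrite size_drop sv.
rewrite -{1}(subnKC jn) -{1}(cat_take_drop j v) (big_fiber_cat _ _ _ _ stv).
apply: (@le_trans _ _ (\sum_(u <- words A j | map p u == take j v)
    #|A|%:R ^+ (n - j - N * k))).
  rewrite big_seq_cond [leRHS]big_seq_cond; apply: ler_sum => u /andP[].
  rewrite mem_words => /eqP su _.
  rewrite (eq_bigr (fun w => tile N w)); first by apply: tile_sum0 => //; lia.
  by move=> w _; rewrite drop_size_cat.
have -> : (n - N * k = j + (n - j - N * k))%N by lia.
rewrite exprD (eq_bigr (fun=> 1 * #|A|%:R ^+ (n - j - N * k))); last by move=> *; rewrite mul1r.
by rewrite -mulr_suml ler_wpM2r ?exprn_ge0// count_fiber.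
Qed.

Lemma tile_win x N j n : (j + N * k <= n)%N ->
  tile N (drop j (mkseq x n)) = \prod_(i < N) kap (win x (j + i * k) k).
Proof.
elim: N j => [|N IH] j jN; first by rewrite big_ord0.
rewrite big_ord_recl /= mul0n addn0 win_mkseq; last by move: jN; rewrite mulSn; lia.
rewrite drop_drop [(k + j)%N]addnC IH; last by move: jN; rewrite mulSn; lia.
by congr (_ * _); apply: eq_bigr => i _; rewrite mulSn addnA.
Qed.

End Tiling.

Section Phases.
Context {R : realType}.

Lemma sum_ord_mul (V : nmodType) (g : nat -> V) n k :
  \sum_(l < n * k) g l = \sum_(i < n) \sum_(j < k) g (i * k + j)%N.
Proof.
elim: n => [|n IH]; first by rewrite !big_ord0.
by rewrite mulSnr big_split_ord/= IH big_ord_recr.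
Qed.

(** The starting points are sorted by residue modulo [k], each residue giving disjoint blocks; some
    residue does at least as well as the average. Since [f <= 0], dropping the windows that pass [n]
    only increases the sum. *)
Lemma exists_phase (f : nat -> R) n k : (0 < k)%N -> (forall l, f l <= 0) ->
  exists2 j, (j < k)%N &
    k%:R^-1 * \sum_(l < n) f l <= \sum_(i < (n - j) %/ k) f (j + i * k)%N.
Proof.
move=> k0 f0; pose S j := \sum_(i < (n - j) %/ k) f (j + i * k)%N.
have key : \sum_(l < n) f l <= \sum_(j < k) S j.
  pose g l := if (l + k <= n)%N then f l else 0.
  apply: (@le_trans _ _ (\sum_(l < n) g l)).
    by apply: ler_sum => l _; rewrite /g; case: ifP.
  (* The range becomes a multiple of [k]; the new terms are 0 because their windows pass [n]. *)
  have -> : \sum_(l < n) g l = \sum_(l < n * k) g l.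
    have nk : (n <= n * k)%N by rewrite leq_pmulr.
    rewrite -!(big_mkord predT g) (big_cat_nat (leq0n n) nk)/=.
    rewrite [X in _ = _ + X]big_nat [X in _ = _ + X]big1 ?addr0// => l /andP[nl _].
    by rewrite /g ifF//; apply/negbTE; rewrite -ltnNge; lia.
  rewrite sum_ord_mul exchange_big/=; apply: ler_sum => j _.
  rewrite /S -(big_mkord predT (fun i => g (i * k + j)%N)) -(big_mkord predT (fun i => f (j + i * k)%N)).
  have le : ((n - j) %/ k <= n)%N.
    by rewrite (leq_trans (leq_div _ _))// leq_subr.
  rewrite (big_cat_nat (leq0n _) le)/= [X in _ + X <= _]big_nat [X in _ + X <= _]big1 ?addr0.
    rewrite big_nat [leRHS]big_nat; apply: ler_sum => i /andP[_ ij].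
    rewrite /g [(i * k + j)%N]addnC ifT//.
    move: ij; rewrite leq_divRL// => ij.
    have : (0 < n - j)%N by apply: leq_trans ij; rewrite mulSn; lia.
    by rewrite mulSn in ij; lia.
  move=> i /andP[ij _]; rewrite /g ifF//; apply/negbTE; rewrite -ltnNge.
  by move: ij; rewrite -ltnS ltn_divLR// mulSn; lia.
apply: contrapT => /forall2NP H.
have H' (j : 'I_k) : S j < k%:R^-1 * \sum_(l < n) f l.
  by case: (H j) => [|/negP]; [rewrite ltn_ord|rewrite -ltNge].
have : \sum_(j < k) S j < \sum_(j < k) k%:R^-1 * \sum_(l < n) f l.
  apply: ltr_sum => //; apply/hasP; exists (Ordinal k0) => //; exact: mem_index_enum.
rewrite sumr_const card_ord -(mulr_natl (_ * _)) mulrA divff ?pnatr_eq0 -?lt0n// mul1r.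
by rewrite ltNge key.
Qed.

End Phases.

Section Types.
Context {R : realType} {A B : finType} (p : A -> B).
Variables (k n : nat).
Notation type := {ffun k.-tuple A -> 'I_n.+1}.

(** A type records how often each word of length [k] occurs among [n] windows; the number of types,
    [n.+1 ^ (#|A| ^ k)], is polynomial in [n]. *)
Definition type_count (tau : type) (w : seq A) : R :=
  if insub w is Some t then (tau t : nat)%:R else 0.

Definition type_kernel (tau : type) (w : seq A) : R :=
  type_count tau w / marg p (type_count tau) (map p w).

Lemma type_count_ge0 tau w : 0 <= type_count tau w.
Proof. by rewrite /type_count; case: insub. Qed.

Lemma type_kernel_ge0 tau w : 0 <= type_kernel tau w.
Proof. by apply: kernel_ge0; exact: type_count_ge0. Qed.

Lemma type_kernel_sum tau z : size z = k ->
  \sum_(w <- words A k | map p w == z) type_kernel tau w <= 1.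
Proof. by move=> sz; apply: kernel_sum => //; exact: type_count_ge0. Qed.

Lemma emp_type x : (0 < n)%N -> exists tau : type, forall w, size w = k ->
  type_kernel tau w = emp x n w / marg p (emp x n) (map p w).
Proof.
move=> n0.
have cn (t : k.-tuple A) : (\sum_(l < n) (win x l k == t) < n.+1)%N.
  rewrite ltnS; apply: (@leq_trans (\sum_(l < n) 1)); last by rewrite sum1_card card_ord.
  by apply: leq_sum => l _; case: (_ == _).
exists [ffun t => Ordinal (cn t)].
have tE w : size w = k -> type_count [ffun t => Ordinal (cn t)] w = n%:R * emp x n w.
  move=> sw; rewrite /type_count insubT ?sw// => skw; rewrite ffunE /= natr_sum.
  by rewrite /emp mulrA divff ?mul1r ?pnatr_eq0 -?lt0n// sw.
move=> w sw; rewrite /type_kernel tE//.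
have -> : marg p (type_count [ffun t => Ordinal (cn t)]) (map p w) =
    n%:R * marg p (emp x n) (map p w).
  rewrite /marg mulr_sumr size_map sw big_seq_cond [RHS]big_seq_cond; apply: eq_bigr => v /andP[].
  by rewrite mem_words => /eqP sv _; rewrite tE.
by rewrite invfM mulrACA divff ?mul1r// pnatr_eq0 -lt0n.
Qed.

(* [type_weight u] is at least [exp (- (n / k) relH k)] of the empirical weights of any sequence with prefix [u], while
   its sum over a row fiber is polynomial in [n]; the sum over the phase [j] is needed to compare the overlapping
   windows of [emp] with disjoint blocks. *)
Definition type_weight (u : seq A) : R :=
  \sum_(tau : type) \sum_(j < k) tile (type_kernel tau) k ((n - j) %/ k) (drop j u).

Lemma type_weight_ge0 u : 0 <= type_weight u.
Proof. by apply: sumr_ge0 => tau _; apply: sumr_ge0 => j _; apply: tile_ge0; exact: type_kernel_ge0. Qed.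

(** For every type and phase at most [2 * k] letters lie outside the blocks: those before the phase
    and those left after the last block. *)
Lemma type_weight_sum v : size v = n -> (0 < k)%N ->
  \sum_(u <- words A n | map p u == v) type_weight u <=
  (n.+1%:R ^+ (#|A| ^ k)) * k%:R * (#|A|.+1)%:R ^+ (2 * k).
Proof.
move=> sv k0; rewrite /type_weight exchange_big/=.
have -> : n.+1%:R ^+ (#|A| ^ k) * k%:R * (#|A|.+1)%:R ^+ (2 * k) =
   \sum_(tau : type) \sum_(j < k) ((#|A|.+1)%:R ^+ (2 * k) : R).
  rewrite !sumr_const card_ord card_ffun card_tuple card_ord -natrX.
  by rewrite -[RHS]mulr_natl -(mulr_natl (_ ^+ (2 * k))) mulrA.
apply: ler_sum => tau _; rewrite exchange_big/=; apply: ler_sum => j _.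
have [jn|nj] := leqP j n; last first.
  have -> : ((n - j) %/ k = 0)%N by rewrite (eqP (ltnW nj)) div0n.
  apply: le_trans; first exact: (count_fiber p sv).
  apply: (@le_trans _ _ ((#|A|.+1)%:R ^+ n)); first by rewrite lerXn2r ?nnegrE ?ler0n// ler_nat.
  rewrite ler_weXn2l ?ler1n//; have := ltn_ord j; lia.
have jN : (j + (n - j) %/ k * k <= n)%N by have := leq_divM (n - j) k; lia.
apply: (le_trans (tile_sum (type_kernel_ge0 tau) (type_kernel_sum tau) sv jN)).
(* The base [#|A|.+1] is at least 1 even for an empty alphabet, so the exponent may be raised. *)
apply: (@le_trans _ _ ((#|A|.+1)%:R ^+ (n - (n - j) %/ k * k))).
  by rewrite lerXn2r ?nnegrE ?ler0n// ler_nat.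
rewrite ler_weXn2l ?ler1n//.
have := divn_eq (n - j) k; have := ltn_pmod (n - j) k0; have := ltn_ord j; lia.
Qed.

(** One summand suffices: the type of [x] itself at a phase where the blocks do as well as the
    average window. The mean of the logarithms of the kernel over all windows is [- relH]. *)
Lemma type_weight_emp x : (0 < n)%N -> (0 < k)%N ->
  expR (- (n%:R / k%:R * relH p (emp x n) k)) <= type_weight (mkseq x n).
Proof.
move=> n0 k0; have [tau tauE] := emp_type x n0.
have ew : weight (emp x n : seq A -> R) := emp_weight x n0.
have e0 := weight_ge0 ew.
pose f l : R := ln (type_kernel tau (win x l k)).
have f0 l : f l <= 0.
  by rewrite /f ln_le0// tauE ?size_win// kernel_le1.
have [j jk jP] := exists_phase n k0 f0.
have fE : relH p (emp x n) k = - (n%:R^-1 * \sum_(l < n) f l).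
  rewrite /relH (emp_sum x n k (fun w => ln (emp x n w / marg p (emp x n) (map p w)))).
  congr (- (_ * _)); apply: eq_bigr => l _.
  by rewrite /f tauE ?size_win.
have pos l : (l < n)%N -> 0 < type_kernel tau (win x l k).
  move=> ln; rewrite tauE ?size_win//; apply: kernel_gt0 => //.
  rewrite /emp mulr_gt0 ?invr_gt0 ?ltr0n// (bigD1 (Ordinal ln))//= size_win eqxx.
  by rewrite ltr_wpDr ?sumr_ge0.
apply: (@le_trans _ _ (tile (type_kernel tau) k ((n - j) %/ k) (drop j (mkseq x n)))); last first.
  rewrite /type_weight (bigD1 tau)//= (bigD1 (Ordinal jk))//= -addrA lerDl addr_ge0//.
    by apply: sumr_ge0 => i _; apply: tile_ge0; exact: type_kernel_ge0.
  by apply: sumr_ge0 => t _; apply: sumr_ge0 => i _; apply: tile_ge0; exact: type_kernel_ge0.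
have [jn|nj] := leqP j n; last first.
  have -> : ((n - j) %/ k = 0)%N by rewrite (eqP (ltnW nj)) div0n.
  rewrite /= -[leRHS]expR0 ler_expR oppr_le0 mulr_ge0// ?divr_ge0//; exact: relH_ge0.
have jN : (j + (n - j) %/ k * k <= n)%N by have := leq_divM (n - j) k; lia.
rewrite (tile_win _ _ jN).
have -> : \prod_(i < (n - j) %/ k) type_kernel tau (win x (j + i * k) k) =
   expR (\sum_(i < (n - j) %/ k) f (j + i * k)%N).
  rewrite expR_sum; apply: eq_bigr => i _; rewrite /f lnK// posrE pos//.
  have : (i * k + k <= (n - j) %/ k * k)%N by rewrite -mulSnr leq_mul2r ltn_ord orbT.
  lia.
rewrite ler_expR (le_trans _ jP)// fE mulrN opprK mulrA.
by rewrite [n%:R / k%:R / _]mulrAC divff ?mul1r// pnatr_eq0 -lt0n.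
Qed.

End Types.

(** * Upper bound *)

Section Summability.
Context {R : realType}.

Lemma geometric_tail (th : R) N M : 0 <= th -> th < 1 ->
  \sum_(N <= n < M) th ^+ n <= th ^+ N / (1 - th).
Proof.
move=> th0 th1; have s0 : 0 < 1 - th by rewrite subr_gt0.
have [NM|/ltnW MN] := leqP N M; last by rewrite big_geq// divr_ge0 ?exprn_ge0// ltW.
rewrite ler_pdivlMr// mulr_suml.
have -> : \sum_(N <= n < M) th ^+ n * (1 - th) = th ^+ N - th ^+ M.
  rewrite -[RHS]opprB -(telescope_sumr (fun n => th ^+ n) NM) -sumrN.
  by apply: eq_bigr => n _; rewrite mulrBr mulr1 opprB -exprSr.
by rewrite gerBl exprn_ge0.
Qed.

(** A single term of the exponential series dominates the power. *)
Lemma poly_exp_bound (c : R) (P : nat) : 0 < c ->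
  exists2 K : R, 0 <= K & forall n : nat, n.+1%:R ^+ P.+1 <= K * expR (c * n%:R).
Proof.
move=> c0; exists ((P.+1)`!%:R / c ^+ P.+1 * expR c).
  by rewrite mulr_ge0 ?expR_ge0// divr_ge0// exprn_ge0// ltW.
move=> n; have := @expR_ge1Dxn R (c * n.+1%:R) P (mulr_ge0 (ltW c0) (ler0n _ _)).
move=> h; have {h} : (c * n.+1%:R) ^+ P.+1 / (P.+1)`!%:R <= expR (c * n.+1%:R).
  by apply: le_trans h; rewrite lerDr.
rewrite ler_pdivrMr ?ltr0n ?fact_gt0// exprMn => h.
rewrite -(ler_pM2l (exprn_gt0 P.+1 c0)) (le_trans h)//.
have -> : expR (c * n.+1%:R) = expR c * expR (c * n%:R).
  by rewrite -expRD -natr1 mulrDr mulr1 addrC.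
rewrite le_eqVlt; apply/orP; left; apply/eqP; field.
by rewrite expf_neq0 ?gt_eqF.
Qed.

Lemma expR_powR (x s : R) : (expR x) `^ s = expR (s * x).
Proof. by rewrite /powR gt_eqF ?expR_gt0// expRK. Qed.

End Summability.

(** * Hitting times of Birkhoff sums *)

Section HittingTimes.
Context {R : realType} {C : eqType} (l : C -> R) (l0 l1 : R).
Hypothesis l00 : 0 < l0.
Hypothesis l_bd : forall c, l0 <= l c <= l1.
Implicit Types (x y : nat -> C) (rho : R).

Let S x n : R := \sum_(i < n) l (x i).

Lemma birkhoff_bounds x n : n%:R * l0 <= S x n <= n%:R * l1.
Proof.
have cst (c : R) : n%:R * c = \sum_(i < n) c by rewrite sumr_const card_ord mulr_natl.
by rewrite !cst; apply/andP; split; apply: ler_sum => i _; have /andP[] := l_bd (x i).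
Qed.

Lemma hit_exists x rho : exists n, rho <= S x n.
Proof.
exists (Num.truncn (rho / l0)).+1; have /andP[h _] := birkhoff_bounds x (Num.truncn (rho / l0)).+1.
by apply: le_trans h; rewrite -ler_pdivrMr// ltW// truncnS_gt.
Qed.

Definition hit rho x : nat := ex_minn (hit_exists x rho).

Lemma hitP rho x : rho <= S x (hit rho x).
Proof. by rewrite /hit; case: ex_minnP. Qed.

Lemma hit_min rho x n : rho <= S x n -> (hit rho x <= n)%N.
Proof. by rewrite /hit; case: ex_minnP => m _; exact. Qed.

Lemma hit_le rho x : 0 <= rho -> S x (hit rho x) <= rho + l1.
Proof.
move=> rho0; have l10 : 0 <= l1 by have /andP[h1 h2] := l_bd (x 0%N); exact: le_trans (ltW l00) (le_trans h1 h2).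
case E: (hit rho x) => [|n]; first by rewrite /S big_ord0 addr_ge0.
rewrite /S big_ord_recr/= lerD//; last by have /andP[] := l_bd (x n).
by rewrite ltW// ltNge; apply/negP => /hit_min; rewrite E ltnn.
Qed.

Lemma hit_ge rho x : rho <= (hit rho x)%:R * l1.
Proof. by apply: (le_trans (hitP rho x)); have /andP[] := birkhoff_bounds x (hit rho x). Qed.

(** Stopping time property: the letters before the hitting time determine it. *)
Lemma hit_eq rho x y : (forall i, (i < hit rho x)%N -> x i = y i) -> hit rho y = hit rho x.
Proof.
move=> xy; have h n : (n <= hit rho x)%N -> S y n = S x n.
  by move=> nx; apply: eq_bigr => i _; rewrite xy// (leq_trans _ nx).
apply/eqP; rewrite eqn_leq hit_min/= ?h//; last exact: hitP.
rewrite leqNgt; apply/negP => h2; have := hitP rho y; rewrite h ?(ltnW h2)// => /hit_min h3.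
by move: h2; rewrite ltnNge h3.
Qed.

(** The first difference precedes the hitting time of [y] as well, since otherwise [x] would agree
    with [y] up to that time and the two times would coincide. This lets distinct approximate
    squares be separated at a common index. *)
Lemma hit_diff rho x y : mkseq x (hit rho x) != mkseq y (hit rho x) ->
  exists j, [/\ (j < hit rho x)%N, (j < hit rho y)%N, forall i, (i < j)%N -> x i = y i & x j <> y j].
Proof.
move=> ne; have [j jP jmin] : exists2 j, (j < hit rho x)%N && (x j != y j) &
    forall i, (i < hit rho x)%N && (x i != y i) -> (j <= i)%N.
  suff ex : exists j, (j < hit rho x)%N && (x j != y j).
    by exists (ex_minn ex); case: ex_minnP.
  apply: contrapT => /forallNP nj; move/eqP: ne; apply; apply/eq_in_map => i.
  rewrite mem_iota /= add0n => ix; apply/eqP; apply/negPn/negP => xy.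
  by apply: (nj i); rewrite ix.
have /andP[jx /eqP xyj] := jP.
have lt_eq i : (i < j)%N -> x i = y i.
  move=> ij; apply/eqP; apply/negPn/negP => xy.
  have := jmin i; rewrite (ltn_trans ij jx) xy => /(_ isT).
  by rewrite leqNgt ij.
exists j; split => //; rewrite ltnNge; apply/negP => yj.
have e : hit rho x = hit rho y by apply: hit_eq => i iy; rewrite lt_eq// (leq_trans iy).
by move: jx; rewrite e ltnNge yj.
Qed.

End HittingTimes.

Section UpperBound.
Context {R : realType} {A B : finType} (pt : A) (p : A -> B).
Variables (la : A -> R) (lb : B -> R) (l0 l1 : R).
Hypothesis l00 : 0 < l0.
Hypothesis la_bd : forall a, l0 <= la a <= l1.
Hypothesis lb_bd : forall b, l0 <= lb b <= l1.
Hypothesis lb_le : forall a, lb (p a) <= la a.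
Implicit Type x : nat -> A.

Definition Lam x n : R := \sum_(i < n) la (x i).
Definition LamV x n : R := \sum_(i < n) lb (p (x i)).

Lemma LamS x n : Lam x n.+1 = Lam x n + la (x n).
Proof. by rewrite /Lam big_ord_recr. Qed.

Lemma la_gt0 a : 0 < la a.
Proof. by have /andP[h _] := la_bd a; exact: lt_le_trans h. Qed.

Lemma LamV_le_Lam x n : LamV x n <= Lam x n.
Proof. exact: ler_sum. Qed.

Lemma Lam_bounds x n : n%:R * l0 <= Lam x n <= n%:R * l1.
Proof. exact: (birkhoff_bounds la_bd). Qed.

Lemma LamV_bounds x n : n%:R * l0 <= LamV x n <= n%:R * l1.
Proof. exact: (birkhoff_bounds lb_bd (p \o x)). Qed.

Lemma Lam_mono x n m : (n <= m)%N -> Lam x n <= Lam x m.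
Proof.
move/subnKC <-; elim: (m - n)%N => [|j IH]; first by rewrite addn0.
by rewrite addnS LamS (le_trans IH)// lerDl ltW// la_gt0.
Qed.

(* The row index at which the height of the approximate square drops to its width at time [n]. *)
Definition stop x n : nat := hit l00 lb_bd (Lam x n) (p \o x).

Lemma stopP x n : Lam x n <= LamV x (stop x n).
Proof. exact: (hitP l00 lb_bd (Lam x n) (p \o x)). Qed.

Lemma stop_ge x n : (n <= stop x n)%N.
Proof.
rewrite leqNgt; apply/negP => Ln; have := stopP x n; apply/negP; rewrite -ltNge.
apply: (le_lt_trans (LamV_le_Lam _ _)); apply: (@lt_le_trans _ _ (Lam x (stop x n).+1)).
  by rewrite LamS ltrDl la_gt0.
exact: Lam_mono.
Qed.

Lemma stop_le x n : LamV x (stop x n) <= Lam x n + l1.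
Proof.
apply: (hit_le l00 lb_bd (p \o x)); have /andP[h _] := Lam_bounds x n.
by apply: le_trans h; rewrite mulr_ge0// ltW.
Qed.

Definition stop_cst : nat := (Num.truncn (l1 / l0)).+2.

Lemma stop_linear x n : (0 < n)%N -> (stop x n <= stop_cst * n)%N.
Proof.
move=> n0; case E: (stop x n) => [//|L].
have h : LamV x L < Lam x n.
  by rewrite ltNge; apply/negP => /(hit_min l00 lb_bd (x := p \o x)); rewrite -/(stop x n) E ltnn.
have /andP[h1 _] := LamV_bounds x L; have /andP[_ h2] := Lam_bounds x n.
have : L%:R < n%:R * (l1 / l0).
  by rewrite mulrA ltr_pdivlMr// (le_lt_trans h1)// (lt_le_trans h).
have h3 : l1 / l0 < (Num.truncn (l1 / l0)).+1%:R by rewrite truncnS_gt.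
have h4 : n%:R * (l1 / l0) < n%:R * (Num.truncn (l1 / l0)).+1%:R by rewrite ltr_pM2l ?ltr0n.
move=> /lt_trans /(_ h4); rewrite -natrM ltr_nat /stop_cst => h5.
by rewrite mulSn mulnC; lia.
Qed.

(** The row summand of [Dk], isolated because an approximate square pays for it at time [stop x n]
    instead of [n]. *)
Definition gk (q : seq A -> R) (k : nat) : R :=
  (k%:R^-1 * Hent (marg p q) k) / lyap_w (lb \o p) q.

Lemma gk_bounds q k : weight q -> (0 < k)%N -> 0 <= gk q k <= (size (words B k))%:R / l0.
Proof.
move=> qw k0; have mw := marg_weight p qw.
have h2 : l0 <= lyap_w (lb \o p) q.
  have h : forall a, l0 <= (lb \o p) a <= l1 by move=> a; exact: lb_bd.
  by have /andP[] := lyap_w_bounds qw h.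
have h3 : 0 < lyap_w (lb \o p) q by exact: lt_le_trans h2.
apply/andP; split.
  by rewrite divr_ge0 ?(ltW h3)// mulr_ge0 ?invr_ge0//; exact: Hent_ge0.
apply: ler_pM; rewrite ?invr_ge0 ?(ltW h3)//.
- by rewrite mulr_ge0 ?invr_ge0//; exact: Hent_ge0.
- apply: (@le_trans _ _ (Hent (marg p q) k)); last exact: Hent_le.
  by rewrite ler_piMl ?Hent_ge0// invf_le1 ?ler1n// ltr0n.
- by rewrite lef_pV2 ?posrE.
Qed.

Variables (phi : (nat -> A) -> R) (alpha : R).
Hypothesis uc : unif_cont phi.

Definition level x : Prop :=
  (fun n : nat => n%:R^-1 * \sum_(l < n) phi (fun i => x (l + i)%N)) @ \oo --> alpha.

Lemma ev_emp_osc x n k e : (0 < n)%N -> osc phi k e ->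
  `|ev pt (emp x n) phi k - n%:R^-1 * \sum_(l < n) phi (fun i => x (l + i)%N)| <= e.
Proof.
move=> n0 ok; rewrite ev_emp -mulrBr -sumrB normrM ger0_norm ?invr_ge0//.
rewrite ler_pdivrMl ?ltr0n//; apply: (le_trans (ler_norm_sum _ _ _)).
have -> : n%:R * e = \sum_(i < n) e by rewrite sumr_const card_ord mulr_natl.
apply: ler_sum => l _; apply: ok => i ik.
by rewrite /pad /win (nth_map 0%N) ?size_iota// nth_iota// add0n.
Qed.

(** Along a sequence of bad times the empirical weights accumulate at an invariant weight with
    integral [alpha], and [Dk] at fixed [k] is continuous. *)
Lemma eventually_Dk x k t : level x ->
  (forall q, inv_weight q -> integ pt q phi alpha -> Dk p la lb q k < t) ->
  exists n0, forall n, (n0 <= n)%N -> Dk p la lb (emp x n) k < t.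
Proof.
move=> lx H; apply: contrapT => /forallNP nH.
have /choice[nn nnP] : forall j, exists n, (j < n)%N /\ t <= Dk p la lb (emp x n) k.
  move=> j; have /existsNP[n /not_implyP[jn /negP]] := nH j.+1.
  by rewrite -leNgt => h; exists n.
have nn0 j : (0 < nn j)%N by case: (nnP j) => jn _; exact: leq_ltn_trans jn.
pose Q j := emp x (nn j) : seq A -> R.
have Qw j : weight (Q j) by exact: emp_weight.
have [F [q [FF oF Qq]]] := weight_compact Qw.
have nnoo (m : nat) : \forall j \near F, (m <= nn j)%N.
  apply: oF; exists m => // j /= mj; case: (nnP j) => jn _.
  by rewrite (leq_trans mj)// ltnW.
have qi : inv_weight q.
  apply: (inv_weight_lim Qw Qq) => w; apply: norm_cvg0.
  apply: (@squeeze_cvgr _ _ _ _ (fun=> 0) (fun j => (nn j)%:R^-1)).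
  - by apply: nearW => j; rewrite normr_ge0 emp_left.
  - exact: cvg_cst.
  - apply/cvgrPdist_le => e e0; apply: filterS (nnoo (Num.truncn e^-1).+1) => j /= h.
    rewrite sub0r normrN ger0_norm ?invr_ge0// -[e]invrK lef_pV2 ?posrE ?invr_gt0 ?ltr0n//.
    by rewrite (le_trans (ltW (truncnS_gt _)))// ler_nat.
have qI : integ pt q phi alpha.
  apply: (integ_lim Qw Qq uc) => k' e e0 ok d d0.
  have /cvgrPdist_le/(_ _ d0)[N _ NP] := lx.
  apply: filterS (nnoo N) => j /NP h.
  have -> : ev pt (Q j) phi k' - alpha = (ev pt (Q j) phi k' -
     (nn j)%:R^-1 * \sum_(l < nn j) phi (fun i => x (l + i)%N)) -
     (alpha - (nn j)%:R^-1 * \sum_(l < nn j) phi (fun i => x (l + i)%N)).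
    by rewrite opprB addrA subrK.
  by rewrite (le_trans (ler_normB _ _))// lerD// ev_emp_osc.
have := H q qi qI; apply/negP; rewrite -leNgt.
have c : (fun j => Dk p la lb (Q j) k) @ F --> Dk p la lb q k.
  exact: (@Dk_lim R A B p la lb l0 l1 l00 la_bd lb_bd F FF Q q Qw Qq k).
by apply: (cvgr_to_ge c); apply: nearW => j; case: (nnP j).
Qed.

(** Exchanges quantifiers: one length serves all weights. Otherwise counterexamples for every
    [2 ^ i] would accumulate at a weight with [Dim] at least [t]. *)
Lemma exists_dyadic S t : S < t ->
  (forall q, inv_weight q -> integ pt q phi alpha -> Dim p la lb q <= S) ->
  exists i, forall q, inv_weight q -> integ pt q phi alpha -> Dk p la lb q (2 ^ i) < t.
Proof.
move=> St H; apply: contrapT => /forallNP nH.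
have /choice[Q QP] : forall i, exists q, [/\ inv_weight q, integ pt q phi alpha &
    t <= Dk p la lb q (2 ^ i)].
  move=> i; have /existsNP[q /not_implyP[qi /not_implyP[qI /negP]]] := nH i.
  by rewrite -leNgt => h; exists q.
have Qi i : inv_weight (Q i) by case: (QP i).
have Qw i : weight (Q i) by exact: Qi.
have [F [q [FF oF Qq qi]]] := inv_weight_compact Qi.
have qI : integ pt q phi alpha.
  apply: (integ_lim Qw Qq uc) => k e e0 ok d d0; apply: nearW => i.
  case: (QP i) => _ hI _; rewrite (le_trans (integ_osc (Qw i) hI ok))// lerDl ltW//.
have := H q qi qI; apply/negP; rewrite -ltNge (lt_le_trans St)//.
by apply: (Dim_lim_ge l00 la_bd lb_bd Qw Qq oF Qi qi) => i; case: (QP i).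
Qed.

(* Otherwise [gk] would grow by [e] at each step along the iterates of [stop], while it is bounded. *)
Lemma frequently_gk x k e : (0 < k)%N -> 0 < e -> forall N, exists n, [/\ (N <= n)%N, (0 < n)%N &
  gk (emp x (stop x n)) k <= gk (emp x n) k + e].
Proof.
move=> k0 e0 N; apply: contrapT => /forallNP nH.
have H n : (N < n)%N -> gk (emp x n) k + e < gk (emp x (stop x n)) k.
  move=> Nn; rewrite ltNge; apply/negP => h; apply: (nH n); split => //; first exact: ltnW.
  exact: leq_ltn_trans Nn.
pose m i := iter i (stop x) N.+1.
have mN i : (N < m i)%N.
  by elim: i => // i IH; rewrite /m iterS (leq_trans IH)// stop_ge.
have w i : weight (emp x (m i) : seq A -> R) by apply: emp_weight; exact: leq_ltn_trans (mN i).
have mi i : i%:R * e <= gk (emp x (m i)) k.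
  elim: i => [|i IH]; first by rewrite mul0r; have /andP[] := gk_bounds (w 0%N) k0.
  rewrite -natr1 mulrDl mul1r (le_trans (lerD IH (lexx e)))// ltW//.
  by have := H (m i) (mN i).
pose G : R := (size (words B k))%:R / l0.
have := mi (Num.truncn (G / e)).+1; apply/negP; rewrite -ltNge.
have /andP[_ h] := gk_bounds (w (Num.truncn (G / e)).+1) k0.
by apply: (le_lt_trans h); rewrite -ltr_pdivrMr// truncnS_gt.
Qed.

Variable Pt : (nat -> A) -> R * R.
Hypothesis PtX : forall n x y, mkseq x n = mkseq y n ->
  `|(Pt x).1 - (Pt y).1| <= expR (- Lam x n).
Hypothesis PtY : forall L x y, mkseq (p \o x) L = mkseq (p \o y) L ->
  `|(Pt x).2 - (Pt y).2| <= expR (- LamV x L).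

Section Covers.
Variables (k : nat) (t e : R).
Hypotheses (k0 : (0 < k)%N) (e0 : 0 < e) (t0 : 0 <= t).

Definition good x n := [/\ (0 < n)%N, Dk p la lb (emp x n) k <= t &
  gk (emp x (stop x n)) k <= gk (emp x n) k + e].

(** Mirrors the splitting of [Dim]: full symbols up to [n] are weighted relative to their rows, and
    rows up to [L] are weighted absolutely, as words over a one-point factor. *)
Definition code_weight n L (u : seq A) (v : seq B) : R :=
  type_weight p k n u * type_weight (fun=> tt) k L v.

Let G : R := (size (words B k))%:R / l0.

(** The two exponents are [Lam x n] times the relative term and [LamV x (stop x n)] times the row
    term. The latter Birkhoff sum exceeds [Lam x n] by at most [l1], and the row term exceeds its
    value at time [n] by at most [e]. *)
Lemma code_weight_ge x n : good x n ->
  expR (- (Lam x n * (t + e) + l1 * G)) <=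
  code_weight n (stop x n) (mkseq x n) (mkseq (p \o x) (stop x n)).
Proof.
move=> [n0 Dt gt]; pose L := stop x n.
have L0 : (0 < L)%N by exact: leq_trans n0 (stop_ge x n).
have nw : weight (emp x n : seq A -> R) by exact: emp_weight.
have Lw : weight (emp x L : seq A -> R) by exact: emp_weight.
have vw : weight (emp (p \o x) L : seq B -> R) by exact: emp_weight.
have h1 := @type_weight_emp R A B p k n x n0 k0.
have h2 := @type_weight_emp R B unit (fun=> tt) k L (p \o x) L0 k0.
apply: (le_trans _ (ler_pM (expR_ge0 _) (expR_ge0 _) h1 h2)).
rewrite -expRD ler_expR -opprD lerN2 -Hent_relH// -marg_emp.
have nR : 0 < n%:R :> R by rewrite ltr0n.
have LR : 0 < L%:R :> R by rewrite ltr0n.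
have lamE : Lam x n = n%:R * lyap_w la (emp x n).
  by rewrite lyap_w_emp mulrA divff ?mul1r// gt_eqF.
have lamVE : LamV x L = L%:R * lyap_w (lb \o p) (emp x L).
  by rewrite lyap_w_emp mulrA divff ?mul1r// gt_eqF.
have la0 := lyapA_gt0 l00 la_bd nw; have lb0 := lyapB_gt0 p l00 lb_bd Lw.
have e1 : n%:R / k%:R * relH p (emp x n) k =
    Lam x n * ((k%:R^-1 * relH p (emp x n) k) / lyap_w la (emp x n)).
  by rewrite lamE; field; rewrite !gt_eqF ?ltr0n.
have e2 : L%:R / k%:R * Hent (marg p (emp x L)) k = LamV x L * gk (emp x L) k.
  by rewrite lamVE /gk; field; rewrite !gt_eqF ?ltr0n.
have gkE : Dk p la lb (emp x n) k =
  (k%:R^-1 * relH p (emp x n) k) / lyap_w la (emp x n) + gk (emp x n) k by [].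
have /andP[g0 gG] := gk_bounds Lw k0.
have l10 : 0 <= l1.
  by have /andP[a1 a2] := la_bd pt; exact: le_trans (ltW l00) (le_trans a1 a2).
have Lam0 : 0 <= Lam x n by have /andP[h _] := Lam_bounds x n; apply: le_trans h; rewrite mulr_ge0// ltW.
have s1 : LamV x L * gk (emp x L) k <= (Lam x n + l1) * gk (emp x L) k.
  by rewrite ler_wpM2r// stop_le.
have s2 : l1 * gk (emp x L) k <= l1 * G by rewrite ler_wpM2l.
have s3 : Lam x n * ((k%:R^-1 * relH p (emp x n) k) / lyap_w la (emp x n) + gk (emp x L) k) <=
    Lam x n * (t + e).
  by rewrite ler_wpM2l//; move: gt Dt; rewrite gkE -/L; lra.
rewrite e1 e2; move: s1 s2 s3; rewrite mulrDl mulrDr; lra.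
Qed.

Definition piece n L u v : set (R * R) := Pt @` [set x | [/\ good x n, L = stop x n,
  u = mkseq x n & v = mkseq (p \o x) L]].

Lemma piece_diam n L u v x : good x n -> L = stop x n -> u = mkseq x n ->
  v = mkseq (p \o x) L -> (diam2 (piece n L u v) <= (2 * expR (- Lam x n))%:E)%E.
Proof.
move=> gx Lx ux vx; apply: diam2_le => _ _ [y [gy Ly uy vy] <-] [z [gz Lz uz vz] <-].
have LE (y' : nat -> A) : u = mkseq y' n -> Lam y' n = Lam x n.
  rewrite ux => /eq_in_map E; apply: eq_bigr => i _; rewrite -E// mem_iota/=.
  by rewrite add0n ltn_ord.
apply: dist2_le.
  by rewrite -(LE y uy); apply: PtX; rewrite -uy -uz.
apply: (@le_trans _ _ (expR (- LamV y L))); first by apply: PtY; rewrite -vy -vz.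
by rewrite ler_expR lerN2 -(LE y uy) Ly stopP.
Qed.

Lemma piece_diam_unif n L u v : (diam2 (piece n L u v) <= (2 * expR (- (n%:R * l0)))%:E)%E.
Proof.
have [->|/set0P[z [x [gx Lx ux vx] _]]] := eqVneq (piece n L u v) set0.
  exact: diam2_set0_le.
apply: (le_trans (piece_diam gx Lx ux vx)); rewrite lee_fin ler_pM2l// ler_expR lerN2.
by have /andP[] := Lam_bounds x n.
Qed.

(** Of the surplus [2 * e] one half pays for the change of the row term, and the other half leaves
    the factor [exp (- e * l0 * n)] that makes the cover summable. *)
Lemma piece_diam_pow n L u v s : s = t + 2 * e ->
  diam_pow (piece n L u v) s <=
  (2 `^ s * expR (l1 * G) * expR (- (e * l0 * n%:R))) * code_weight n L u v.
Proof.
move=> sE; have cw0 : 0 <= code_weight n L u v by rewrite mulr_ge0// type_weight_ge0.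
have [->|/set0P[z [x [gx Lx ux vx] _]]] := eqVneq (piece n L u v) set0.
  rewrite {1}/diam_pow; case: asboolP => // _.
  by apply: mulr_ge0 cw0; apply: mulr_ge0 (expR_ge0 _); apply: mulr_ge0 (powR_ge0 _ _) (expR_ge0 _).
have s0 : 0 <= s by rewrite sE addr_ge0// mulr_ge0// ltW.
apply: (le_trans (diam_pow_le s0 (piece_diam gx Lx ux vx))).
rewrite powRM ?expR_ge0// expR_powR -!mulrA ler_wpM2l ?powR_ge0//.
apply: (@le_trans _ _ (expR (l1 * G) * (expR (- (e * l0 * n%:R)) *
    expR (- (Lam x n * (t + e) + l1 * G))))).
  rewrite -!expRD ler_expR sE; have /andP[h _] := Lam_bounds x n.
  have : e * (n%:R * l0) <= e * Lam x n by rewrite ler_pM2l.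
  by move: (l1 * G) => z'; rewrite !mulrA; lra.
apply: ler_wpM2l; first exact: expR_ge0.
rewrite -!mulrA; apply: ler_wpM2l; first exact: expR_ge0.
rewrite vx ux Lx.
exact: code_weight_ge.
Qed.

(** The letters [u] run only over the fiber of the rows [take n v], so that the type weights of [u]
    sum to a polynomial for each fixed [v]. *)
Definition pieces n : seq (set (R * R)) :=
  flatten [seq flatten [seq [seq piece n L u v | u <- words A n & map p u == take n v]
    | v <- words B L] | L <- iota n (stop_cst * n).+1].

Lemma pieces_cover x n : good x n -> exists2 U, U \in pieces n & U (Pt x).
Proof.
move=> gx; exists (piece n (stop x n) (mkseq x n) (mkseq (p \o x) (stop x n))); last by exists x.
have n0 : (0 < n)%N by case: gx.
apply/flatten_mapP; exists (stop x n).
  by rewrite mem_iota stop_ge/= addnS ltnS (leq_trans (stop_linear x n0))// leq_addl.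
apply/flatten_mapP; exists (mkseq (p \o x) (stop x n)).
  by rewrite mem_words size_mkseq.
apply: map_f; rewrite mem_filter mem_words size_mkseq eqxx andbT.
rewrite /mkseq -map_take take_iota (minn_idPl (stop_ge x n)) -map_comp.
by apply/eqP/eq_map.
Qed.

Lemma pieces_diam n U : U \in pieces n -> (diam2 U <= (2 * expR (- (n%:R * l0)))%:E)%E.
Proof.
by move=> /flatten_mapP[L _ /flatten_mapP[v _ /mapP[u _ ->]]]; exact: piece_diam_unif.
Qed.

Lemma pieces_sum s : s = t + 2 * e -> exists2 K : R, 0 <= K &
  forall n, \sum_(U <- pieces n) diam_pow U s <= K * expR (- (e * l0 / 2)) ^+ n.
Proof.
move=> sE; set PA := (#|A| ^ k)%N; set PB := (#|B| ^ k)%N.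
pose cA : R := k%:R * (#|A|.+1)%:R ^+ (2 * k).
pose cB : R := k%:R * (#|B|.+1)%:R ^+ (2 * k).
have cA0 : 0 <= cA by rewrite mulr_ge0// exprn_ge0.
have cB0 : 0 <= cB by rewrite mulr_ge0// exprn_ge0.
have el0 : 0 < e * l0 / 2 by rewrite divr_gt0// mulr_gt0.
(* Half of the exponential decay absorbs the polynomial number of types, phases and lengths [L]. *)
have [K K0 KP] := @poly_exp_bound R _ (PA + PB) el0.
pose K1 : R := 2 `^ s * expR (l1 * G).
have K10 : 0 <= K1 by rewrite mulr_ge0 ?powR_ge0 ?expR_ge0.
pose M := stop_cst.+1.
exists (K1 * cA * cB * M%:R ^+ PB.+1 * K).
  by rewrite !mulr_ge0// exprn_ge0.
move=> n; rewrite /pieces big_flatten big_map.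
have step L : L \in iota n (stop_cst * n).+1 ->
    \sum_(U <- flatten [seq [seq piece n L u v | u <- words A n & map p u == take n v]
       | v <- words B L]) diam_pow U s <=
    K1 * expR (- (e * l0 * n%:R)) * (n.+1%:R ^+ PA * cA * ((M * n.+1)%:R ^+ PB * cB)).
  rewrite mem_iota => /andP[nL Ln].
  rewrite big_flatten big_map.
  apply: (@le_trans _ _ (\sum_(v <- words B L) K1 * expR (- (e * l0 * n%:R)) *
      (n.+1%:R ^+ PA * cA) * type_weight (fun=> tt) k L v)).
    apply: le_words => v sv; rewrite big_map big_filter.
    apply: (@le_trans _ _ (\sum_(u <- words A n | map p u == take n v)
        (K1 * expR (- (e * l0 * n%:R))) * (type_weight p k n u * type_weight (fun=> tt) k L v))).
      by apply: ler_sum => u _; exact: piece_diam_pow.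
    rewrite -mulr_sumr -mulr_suml -(mulrA (K1 * _)).
    apply: ler_wpM2l; first by rewrite mulr_ge0 ?expR_ge0.
    apply: ler_wpM2r; first exact: type_weight_ge0.
    rewrite mulrA; apply: type_weight_sum => //.
    by rewrite size_take sv; case: ltngtP nL.
  rewrite -mulr_sumr -!(mulrA (K1 * _)).
  apply: ler_wpM2l; first by rewrite mulr_ge0 ?expR_ge0.
  apply: ler_wpM2l; first by rewrite mulr_ge0// exprn_ge0.
  have := @type_weight_sum R B unit (fun=> tt) k L (nseq L tt) (size_nseq _ _) k0.
  rewrite big_mkcond /= (eq_words (G := type_weight (fun=> tt) k L)); last first.
    by move=> v sv; rewrite ifT//; apply/eqP; rewrite -sv; elim: v {sv} => //= ? ? ->.
  move=> h; apply: (le_trans h); rewrite -mulrA -/cB ler_wpM2r//.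
  rewrite lerXn2r ?nnegrE// ler_nat /M; move: Ln; rewrite mulnS mulSn; lia.
rewrite big_seq; apply: le_trans.
  by apply: ler_sum => L; exact: step.
rewrite -big_seq big_const_seq count_predT size_iota iter_addr_0.
have MN : ((stop_cst * n).+1 <= M * n.+1)%N by rewrite /M mulnS mulSn; lia.
have {MN} MN : (stop_cst * n).+1%:R <= M%:R * n.+1%:R :> R by rewrite -natrM ler_nat.
set X := K1 * _ * _; apply: (@le_trans _ _ (M%:R * n.+1%:R * X)).
  rewrite -[leLHS]mulr_natl; apply: ler_wpM2r MN; rewrite /X.
  by rewrite !mulr_ge0 ?expR_ge0// ?exprn_ge0.
rewrite {}/X; have -> : M%:R * n.+1%:R * (K1 * expR (- (e * l0 * n%:R)) *
    (n.+1%:R ^+ PA * cA * ((M * n.+1)%:R ^+ PB * cB))) =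
  (K1 * cA * cB * M%:R ^+ PB.+1) * (expR (- (e * l0 * n%:R)) * n.+1%:R ^+ (PA + PB).+1).
  by rewrite natrM exprMn !exprS exprD; ring.
rewrite -(mulrA (K1 * cA * cB * M%:R ^+ PB.+1)).
apply: ler_wpM2l; first by rewrite !mulr_ge0// exprn_ge0.
apply: (le_trans (ler_wpM2l (expR_ge0 _) (KP n))).
rewrite mulrCA ler_wpM2l// -expRM_natl -expRD ler_expR.
by rewrite le_eqVlt; apply/orP; left; apply/eqP; field.
Qed.

End Covers.

Theorem level_measure0 S s : 0 <= S -> S < s ->
  (forall q, inv_weight q -> integ pt q phi alpha -> Dim p la lb q <= S) ->
  hausdorff_measure s (Pt @` [set x | level x]) = 0%E.
Proof.
(* The gap is split as [s = S + 4 * e]: two shares for [Dk] exceeding [S], two for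
   [piece_diam_pow]. *)
move=> S0 Ss HS; pose e := (s - S) / 4.
have e0 : 0 < e by rewrite divr_gt0// subr_gt0.
pose t := S + 2 * e.
have t0 : 0 <= t by rewrite addr_ge0// mulr_ge0// ltW.
have sE : s = t + 2 * e by rewrite /t /e; lra.
have St : S < t by rewrite ltrDl mulr_gt0.
have [i iP] := exists_dyadic St HS.
have k0 : (0 < 2 ^ i)%N by rewrite expn_gt0.
pose l n := pieces (2 ^ i) t e n.
apply: (@hausdorff_measure_limsup R s _ l).
- move=> _ [x /= lx <-] N.
  have [n0 n0P] := eventually_Dk lx iP.
  have [n [Nn n_gt0 gn]] := frequently_gk x k0 e0 (maxn N n0).
  exists n; split; first by apply: leq_trans Nn; exact: leq_maxl.
  apply: pieces_cover; split => //; apply/ltW/n0P.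
  by apply: leq_trans Nn; exact: leq_maxr.
- move=> dl dl0.
  have th1 : `|expR (- l0)| < 1 by rewrite ger0_norm ?expR_ge0// expR_lt1 oppr_lt0.
  have dl2 : 0 < dl / 2 by rewrite divr_gt0.
  have /cvgrPdist_le/(_ _ dl2)[N _ NP] := cvg_expr th1.
  exists N => n U Nn Ul; apply: (le_trans (pieces_diam Ul)).
  rewrite lee_fin mulrC -ler_pdivlMr//; have := NP n Nn.
  by rewrite sub0r normrN ger0_norm ?exprn_ge0 ?expR_ge0// -expRM_natl mulrN.
- move=> d d0; have [K Kge KP] := pieces_sum k0 e0 t0 sE.
  set th := expR (- (e * l0 / 2)) in KP.
  have th0 : 0 <= th by exact: expR_ge0.
  have th1 : th < 1 by rewrite expR_lt1 oppr_lt0 divr_gt0// mulr_gt0.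
  have nth1 : `|th| < 1 by rewrite ger0_norm.
  have K1 : 0 < K + 1 by rewrite ltr_wpDl.
  have d1 : 0 < d * (1 - th) / (K + 1) by rewrite divr_gt0// mulr_gt0// subr_gt0.
  have /cvgrPdist_le/(_ _ d1)[N _ NP] := cvg_expr nth1.
  exists N => M; apply: (@le_trans _ _ (\sum_(N <= n < M) K * th ^+ n)).
    by apply: ler_sum => n _; exact: KP.
  rewrite -mulr_sumr; apply: (le_trans (ler_wpM2l Kge (geometric_tail N M th0 th1))).
  have := NP N (leqnn N); rewrite sub0r normrN ger0_norm ?exprn_ge0//.
  rewrite ler_pdivlMr// => h.
  rewrite mulrA ler_pdivrMr ?subr_gt0// (le_trans _ h)// mulrC ler_wpM2l ?exprn_ge0//.
  by rewrite lerDl.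
Qed.

End UpperBound.

(** * Good blocks *)

Section BlockProducts.
Context {R : realType} {A : finType}.
Variable t : nat -> nat.

Definition block_pos (J : nat) : nat := \sum_(j < J) t j.
Definition block (w : seq A) (j : nat) : seq A := take (t j) (drop (block_pos j) w).

Lemma block_posS J : block_pos J.+1 = (block_pos J + t J)%N.
Proof. by rewrite /block_pos big_ord_recr. Qed.

Lemma block_pos_mono J K : (J <= K)%N -> (block_pos J <= block_pos K)%N.
Proof.
move/subnKC <-; elim: (K - J)%N => [|i IH]; first by rewrite addn0.
by rewrite addnS block_posS (leq_trans IH)// leq_addr.
Qed.

Lemma block_cat u v J j : size u = block_pos J -> (j < J)%N -> block (u ++ v) j = block u j.
Proof.
move=> su jJ; rewrite /block drop_cat.
have h : (block_pos j + t j <= size u)%N by rewrite su -block_posS block_pos_mono.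
case: ltnP => h2; last first.
  have tj0 : t j = 0%N by lia.
  by rewrite tj0 !take0.
by rewrite take_cat size_drop; case: ltnP => // h3; rewrite (_ : t j - _ = 0)%N ?take0 ?cats0 ?take_oversize ?size_drop//; lia.
Qed.

Lemma block_last u v J : size u = block_pos J -> size v = t J -> block (u ++ v) J = v.
Proof. by move=> su sv; rewrite /block drop_cat su ltnn subnn drop0 -sv take_size. Qed.

Lemma size_block w J j : size w = block_pos J -> (j < J)%N -> size (block w j) = t j.
Proof.
move=> sw jJ; rewrite size_take size_drop sw.
have h : (block_pos j + t j <= block_pos J)%N by rewrite -block_posS block_pos_mono.
by case: ltnP => // h2; lia.
Qed.

Lemma big_block_prod (G : nat -> seq A -> R) J :
  \sum_(w <- words A (block_pos J)) \prod_(j < J) G j (block w j) =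
  \prod_(j < J) \sum_(u <- words A (t j)) G j u.
Proof.
elim: J => [|J IH].
  by rewrite !big_ord0 /block_pos big_ord0 big_words0 big_ord0.
rewrite block_posS big_words_cat big_ord_recr/= -IH mulr_suml; apply: eq_words => u su.
rewrite mulr_sumr; apply: eq_words => v sv; rewrite big_ord_recr/= block_last//; congr (_ * _).
by apply: eq_bigr => j _; rewrite (block_cat _ su).
Qed.

Variable r : nat -> seq A -> R.
Hypothesis r0 : forall j w, 0 <= r j w.
Hypothesis r1 : forall j, \sum_(u <- words A (t j)) r j u = 1.

Definition block_prod J w : R := \prod_(j < J) r j (block w j).

Lemma block_prod_ge0 J w : 0 <= block_prod J w.
Proof. exact: prodr_ge0. Qed.

Lemma block_prod_cat u v J : size u = block_pos J -> size v = t J ->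
  block_prod J.+1 (u ++ v) = block_prod J u * r J v.
Proof.
move=> su sv; rewrite /block_prod big_ord_recr/= block_last//; congr (_ * _).
by apply: eq_bigr => j _; rewrite (block_cat _ su).
Qed.

Lemma block_prod_sum J : \sum_(w <- words A (block_pos J)) block_prod J w = 1.
Proof. by rewrite big_block_prod big1. Qed.

Section Moments.
Variable g : nat -> seq A -> R.
Hypothesis g0 : forall j, \sum_(u <- words A (t j)) r j u * g j u = 0.

Definition block_sum J w : R := \sum_(j < J) g j (block w j).

Lemma block_sum_cat u v J : size u = block_pos J -> size v = t J ->
  block_sum J.+1 (u ++ v) = block_sum J u + g J v.
Proof.
move=> su sv; rewrite /block_sum big_ord_recr/= block_last//; congr (_ + _).
by apply: eq_bigr => j _; rewrite (block_cat _ su).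
Qed.

(** The blocks are independent and centered, so the cross terms vanish. *)
Lemma block_variance J :
  \sum_(w <- words A (block_pos J)) block_prod J w * block_sum J w ^+ 2 =
  \sum_(j < J) \sum_(u <- words A (t j)) r j u * g j u ^+ 2.
Proof.
elim: J => [|J IH]; first by rewrite big_ord0 big1// => w _; rewrite /block_sum big_ord0 expr0n mulr0.
rewrite block_posS big_words_cat big_ord_recr/= -IH.
set V := \sum_(u <- words A (t J)) _.
transitivity (\sum_(u <- words A (block_pos J)) (block_prod J u * block_sum J u ^+ 2 + block_prod J u * V)).
  apply: eq_words => u su.
  transitivity (block_prod J u * (block_sum J u ^+ 2 * \sum_(v <- words A (t J)) r J v +
     2 * block_sum J u * (\sum_(v <- words A (t J)) r J v * g J v) + V)).
    under eq_words => v sv do rewrite block_prod_cat// block_sum_cat//.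
    move: (block_prod J u) (block_sum J u) => P S.
    by rewrite !mulr_sumr /V -!big_split mulr_sumr; apply: eq_bigr => v _ /=; ring.
  by rewrite r1 g0 mulr0 addr0 mulr1 mulrDr.
by rewrite big_split/= -mulr_suml block_prod_sum mul1r.
Qed.

End Moments.

End BlockProducts.

Section Chebyshev.
Context {R : realType} {A : finType} {I : finType}.
Variables (k : nat) (kap : seq A -> R) (g : I -> seq A -> R).
Hypothesis kap0 : forall w, 0 <= kap w.
Hypothesis kap1 : \sum_(u <- words A k) kap u = 1.
Hypothesis g0 : forall i, \sum_(u <- words A k) kap u * g i u = 0.

Let t : nat -> nat := fun=> k.
Let r : nat -> seq A -> R := fun=> kap.

Definition small_sums N (eta : R) (w : seq A) : bool :=
  [forall i, `|block_sum t (fun=> g i) N w| <= eta * N%:R].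

Lemma small_sums_mass eta : 0 < eta -> exists N0, forall N, (N0 <= N)%N ->
  2^-1 <= \sum_(w <- words A (block_pos t N)) block_prod t r N w * (small_sums N eta w)%:R.
Proof.
move=> eta0; pose V : R := \sum_i \sum_(u <- words A k) kap u * g i u ^+ 2.
have V0 : 0 <= V by apply: sumr_ge0 => i _; apply: sumr_ge0 => u _; rewrite mulr_ge0 ?sqr_ge0.
(* For such [N] the second moments, [N * V] in total over [i], are at most half of
   [(eta * N) ^ 2]. *)
exists (Num.truncn (2 * V / eta ^+ 2)).+1 => N NN.
have N0 : (0 < N)%N by exact: leq_trans NN.
have NR : 0 < N%:R :> R by rewrite ltr0n.
have h1 := block_prod_sum (fun=> kap1) N : \sum_(w <- words A (block_pos t N)) block_prod t r N w = 1.
have h2 : \sum_(w <- words A (block_pos t N)) block_prod t r N w * (1 - (small_sums N eta w)%:R) <= 2^-1.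
  apply: (@le_trans _ _ (\sum_(w <- words A (block_pos t N)) block_prod t r N w *
      ((eta * N%:R) ^- 2 * \sum_i block_sum t (fun=> g i) N w ^+ 2))).
    apply: le_words => w sw; apply: ler_wpM2l; first exact: block_prod_ge0.
    have S0 : 0 <= \sum_i block_sum t (fun=> g i) N w ^+ 2 by apply: sumr_ge0 => i _; exact: sqr_ge0.
    have E0 : 0 < (eta * N%:R) ^+ 2 by rewrite exprn_gt0// mulr_gt0.
    case: (boolP (small_sums N eta w)) => [_|].
      by rewrite subrr mulr_ge0// invr_ge0 ltW.
    rewrite subr0 negb_forall => /existsP[i]; rewrite -ltNge => h.
    rewrite ler_pdivlMl// mulr1 (bigD1 i)//= ler_wpDr ?sumr_ge0// => [j _|]; first exact: sqr_ge0.
    by rewrite -[leRHS]real_normK ?num_real// lerXn2r ?nnegrE ?(ltW h)// mulr_ge0// ltW.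
  under eq_bigr do rewrite mulrCA mulr_sumr.
  rewrite -mulr_sumr exchange_big/=.
  have -> : \sum_i \sum_(w <- words A (block_pos t N)) block_prod t r N w * block_sum t (fun=> g i) N w ^+ 2
      = N%:R * V.
    rewrite mulr_sumr; apply: eq_bigr => i _.
    by rewrite (@block_variance R A t r (fun=> kap1) (fun=> g i) (fun=> g0 i) N) /t /r/= sumr_const card_ord mulr_natl.
  have : 2 * V / eta ^+ 2 <= N%:R.
    by apply: (le_trans (ltW (truncnS_gt _))); rewrite ler_nat.
  rewrite ler_pdivrMr ?exprn_gt0// => h3.
  rewrite exprMn ler_pdivrMl ?mulr_gt0 ?exprn_gt0// expr2 (expr2 N%:R).
  move: h3; rewrite expr2; move: (N%:R : R) NR => n NR h3; nra.
move: h2; under eq_bigr do rewrite mulrBr mulr1; rewrite sumrB h1; lra.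
Qed.

End Chebyshev.

(** * Birkhoff sums computed from finite words *)

Section WindowSums.
Context {R : realType} {A : finType} (pt : A).
Variables (psi : (nat -> A) -> R) (m : nat) (e M : R).
Hypothesis e0 : 0 <= e.
Hypothesis om : osc psi m e.
Hypothesis psiM : forall x, `|psi x| <= M.

Let M0 : 0 <= M.
Proof. exact: le_trans (psiM (fun=> pt)). Qed.

Definition window_sum (k : nat) (w : seq A) : R := \sum_(i < k) psi (pad pt (drop i w)).

(** At most [m] positions of a word have fewer than [m] letters ahead of them; only there does the
    padding matter, at a cost of at most [2 * M] each. *)
Lemma sum_short k : (\sum_(i < k) (k - i < m) <= m)%N.
Proof.
suff : (\sum_(i < k) (k - i < m) <= minn k m)%N by lia.
elim: k => [|k IH]; first by rewrite big_ord0.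
rewrite big_ord_recl subn0.
under eq_bigr do rewrite lift0 subSS.
by move: IH; move: (\sum_(i < k) _)%N => S; case: (ltnP k.+1 m) => h /=; lia.
Qed.

Lemma ler_sum_short k (F : nat -> R) : (forall i, (i < k)%N -> F i <= e + (k - i < m)%:R * (2 * M)) ->
  \sum_(i < k) F i <= k%:R * e + m%:R * (2 * M).
Proof.
move=> H; apply: (@le_trans _ _ (\sum_(i < k) (e + (k - i < m)%:R * (2 * M)))).
  by apply: ler_sum => i _; exact: H.
rewrite big_split/=; apply: lerD; first by rewrite sumr_const card_ord mulr_natl.
by rewrite -mulr_suml -natr_sum ler_wpM2r ?mulr_ge0// ler_nat sum_short.
Qed.

Lemma window_sum_win x l k :
  `|\sum_(i < k) psi (fun j => x (l + i + j)%N) - window_sum k (win x l k)| <=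
  k%:R * e + m%:R * (2 * M).
Proof.
rewrite -sumrB; apply: (le_trans (ler_norm_sum _ _ _)).
apply: (@ler_sum_short k (fun i => `|psi (fun j => x (l + i + j)%N) - psi (pad pt (drop i (win x l k)))|)).
move=> i ik; case: (ltnP (k - i)%N m) => h; last first.
  rewrite mul0r addr0; apply: om => j jm.
  by rewrite /pad nth_drop (nth_map 0%N) ?size_iota ?nth_iota ?add0n ?addnA//; lia.
rewrite mul1r (le_trans (ler_normB _ _))// (le_trans (lerD (psiM _) (psiM _)))//.
by rewrite mulr2n mulrDl mul1r lerDr.
Qed.

Variables (q : seq A -> R) (I : R).
Hypothesis qi : inv_weight q.
Hypothesis qI : integ pt q psi I.

Lemma ev_bounded k : `|ev pt q psi k| <= M.
Proof.
apply: (le_trans (ler_norm_sum _ _ _)); apply: (@le_trans _ _ (\sum_(w <- words A k) q w * M)).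
  apply: le_words => w _; have qw0 := weight_ge0 qi w.
  by rewrite normrM (ger0_norm qw0) ler_wpM2l.
by rewrite -mulr_suml (weight_sum _ qi) mul1r.
Qed.

Lemma integ_bounded : `|I| <= M.
Proof.
have h : `|ev pt q psi k| @[k --> \oo] --> `|I| by exact: cvg_norm.
by apply: (cvgr_to_le h); apply: nearW => k; exact: ev_bounded.
Qed.

Lemma window_sum_mean k :
  `|\sum_(w <- words A k) q w * window_sum k w - k%:R * I| <= k%:R * e + m%:R * (2 * M).
Proof.
have -> : \sum_(w <- words A k) q w * window_sum k w = \sum_(i < k) ev pt q psi (k - i).
  under eq_bigr do rewrite mulr_sumr.
  rewrite exchange_big/=; apply: eq_bigr => i _.
  rewrite -{1}(subnKC (ltnW (ltn_ord i))) big_words_cat exchange_big/=.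
  apply: eq_words => v sv; rewrite (weight_catl v i qi) mulr_suml.
  by apply: eq_words => u su; rewrite -su drop_size_cat.
have -> : k%:R * I = \sum_(i < k) I by rewrite sumr_const card_ord mulr_natl.
rewrite -sumrB; apply: (le_trans (ler_norm_sum _ _ _)).
apply: (@ler_sum_short k (fun i => `|ev pt q psi (k - i) - I|)) => i ik.
case: (ltnP (k - i)%N m) => h; last first.
  by rewrite mul0r addr0; apply: (integ_osc qi qI); exact: osc_mono om.
rewrite mul1r (le_trans (ler_normB _ _))// (le_trans (lerD (ev_bounded _) integ_bounded))//.
by rewrite mulr2n mulrDl mul1r lerDr.
Qed.

End WindowSums.

Section GoodBlocks.
Context {R : realType} {A B J : finType} (pt : A) (p : A -> B).
Variables (q : seq A -> R) (psi : J -> (nat -> A) -> R) (I : J -> R).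
Hypothesis qi : inv_weight q.
Hypothesis uc : forall j, unif_cont (psi j).
Hypothesis qI : forall j, integ pt q (psi j) (I j).

Let h : R := hent q.
Let hv : R := hent (marg p q).

(** The information of a word minus its mean; small sums over blocks express equipartition. *)
Definition info (C : finType) (k : nat) (r : seq C -> R) (w : seq C) : R := - ln (r w) - Hent r k.

Lemma info_mean k (C : finType) (r : seq C -> R) : weight r ->
  \sum_(w <- words C k) r w * info k r w = 0.
Proof.
move=> rw; rewrite /info; under eq_bigr do rewrite mulrBr mulrN.
by rewrite sumrB sumrN -mulr_suml (weight_sum _ rw) mul1r /Hent subrr.
Qed.

Lemma prod_le_expR_ln (N : nat) (x : 'I_N -> R) : (forall i, 0 <= x i) ->
  \prod_i x i <= expR (\sum_i ln (x i)).
Proof.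
move=> x0; rewrite expR_sum; apply: ler_prod => i _; rewrite x0/=.
have [xi|xi] := ltP 0 (x i); first by rewrite lnK.
by rewrite (le_trans xi)// expR_ge0.
Qed.

Definition dev (k : nat) (i : bool + J) (w : seq A) : R :=
  match i with
  | inl true => info k q w
  | inl false => info k (marg p q) (map p w)
  | inr j => window_sum pt (psi j) k w - \sum_(u <- words A k) q u * window_sum pt (psi j) k u
  end.

Lemma dev_mean k i : \sum_(u <- words A k) q u * dev k i u = 0.
Proof.
have qw : weight q := qi.
case: i => [[]|j] /=; first exact: info_mean.
  rewrite (big_words_fiber p) -[RHS](info_mean k (marg_weight p qw)); apply: eq_words => z sz.
  rewrite /marg sz mulr_suml big_seq_cond [RHS]big_seq_cond.
  by apply: eq_bigr => w /andP[_ /eqP ->]; rewrite /info /marg sz.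
under eq_bigr do rewrite mulrBr.
by rewrite sumrB -mulr_suml (weight_sum _ qw) mul1r subrr.
Qed.

(** The block law is the product of [N] copies of the law of [q] on words of length [k], conditioned
    on small sums of all deviations. Since that event has mass at least 1/2, conditioning at most
    doubles the weights. First [k] is chosen against the boundary effects, then [N] by Chebyshev's
    inequality. *)
Lemma good_block (e : R) : 0 < e -> exists (l : nat) (r : seq A -> R),
  [/\ (0 < l)%N, forall w, 0 <= r w, \sum_(w <- words A l) r w = 1,
      forall w, size w = l -> r w <= expR (- (l%:R * (h - e))) &
      (forall z, size z = l -> \sum_(w <- words A l | map p w == z) r w <= expR (- (l%:R * (hv - e)))) /\
      (forall j x, 0 < r (mkseq x l) ->
        `|\sum_(i < l) psi j (fun n => x (i + n)%N) - l%:R * I j| <= l%:R * e)].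
Proof.
have qw : weight q := qi; have mw := marg_weight p qw; have mi := marg_inv_weight p qi.
move=> e0; have e8 : 0 < e / 8 by rewrite divr_gt0.
have /choice[m mP] : forall j, exists m, osc (psi j) m (e / 8) by move=> j; exact: uc.
have /choice[M MP] : forall j, exists M : R, 0 <= M /\ forall x, `|psi j x| <= M.
  by move=> j; exact: unif_cont_bounded pt _ (uc j).
pose C : R := \sum_j (m j)%:R * (2 * M j).
have Cj0 j : 0 <= (m j)%:R * (2 * M j) by case: (MP j) => Mj0 _; rewrite !mulr_ge0.
have Cj j : (m j)%:R * (2 * M j) <= C by rewrite /C (bigD1 j)//= lerDl sumr_ge0.
(* [C] bounds the boundary error of a window for every observable; this [k] makes it at most
   [k * e / 8]. *)
pose k := (Num.truncn (C / (e / 8))).+1.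
have kR : 0 < k%:R :> R by rewrite ltr0n.
have Ck : C <= k%:R * (e / 8) by rewrite -ler_pdivrMr// ltW// truncnS_gt.
pose eta : R := k%:R * (e / 8).
have eta0 : 0 < eta by rewrite mulr_gt0.
have kap1 := weight_sum k qw.
have [N0 N0P] := small_sums_mass (weight_ge0 qw) kap1 (dev_mean k) eta0.
(* The second entry makes the factor 2 lost by conditioning at most [exp (N * k * e / 2)]. *)
pose N := maxn N0 (Num.truncn (2 * ln (2 : R) / e)).+1.
have NR : 0 < N%:R :> R by rewrite ltr0n leq_max orbT.
have N2 : ln (2 : R) <= N%:R * k%:R * (e / 2).
  apply: (@le_trans _ _ (N%:R * (e / 2))).
    have : 2 * ln (2 : R) / e <= N%:R.
      by apply: (le_trans (ltW (truncnS_gt _))); rewrite ler_nat leq_maxr.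
    by rewrite ler_pdivrMr//; lra.
  by rewrite -mulrA ler_pM2l// ler_peMl ?ler1n// divr_ge0// (ltW e0).
have {N0P}Z2 := N0P N (leq_maxl _ _).
pose t : nat -> nat := fun=> k.
pose l := block_pos t N.
have lE : l = (N * k)%N by rewrite /l /block_pos sum_nat_const card_ord.
have lR : l%:R = N%:R * k%:R :> R by rewrite lE natrM.
have bp0 w : 0 <= block_prod t (fun=> q) N w by apply: block_prod_ge0 => _; exact: weight_ge0.
pose G w := small_sums k (dev k) N eta w.
set Z := \sum_(w <- _) _ in Z2.
have Z0 : 0 < Z by apply: lt_le_trans Z2; rewrite invr_gt0.
have iZ2 : Z^-1 <= 2 by rewrite -[2]invrK lef_pV2 ?posrE ?invr_gt0.
pose r w : R := block_prod t (fun=> q) N w * (G w)%:R / Z.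
have r0 w : 0 <= r w by rewrite /r divr_ge0 ?(ltW Z0)// mulr_ge0.
have GP w i : G w -> `|block_sum t (fun=> dev k i) N w| <= eta * N%:R by move/forallP.
have r2 w : r w <= expR (ln 2) * (block_prod t (fun=> q) N w * (G w)%:R).
  by rewrite lnK ?posrE// mulrC /r ler_wpM2l ?mulr_ge0.
(* Serves both entropies. The entropy of a block is at least [k] times the limit; the deviation
   costs [e / 8] and the factor 2 costs [e / 2] per letter. *)
have infoB (C' : finType) (s : seq C' -> R) w : inv_weight s -> size w = l ->
    `|\sum_(j < N) info k s (block t w j)| <= eta * N%:R ->
    expR (ln 2) * \prod_(j < N) s (block t w j) <= expR (- (l%:R * (hent s - e))).
  move=> si sw Hw; have sw' : weight s := si.
  apply: (@le_trans _ _ (expR (ln 2) * expR (\sum_(j < N) ln (s (block t w j))))).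
    by rewrite ler_pM2l ?expR_gt0//; apply: prod_le_expR_ln => j; exact: weight_ge0.
  rewrite -expRD ler_expR lR.
  have -> : \sum_(j < N) ln (s (block t w j)) =
      - (N%:R * Hent s k) - \sum_(j < N) info k s (block t w j).
    by rewrite /info sumrB sumrN sumr_const card_ord -mulr_natl; move: (\sum_(j < N) _) => x; lra.
  have [_ _ hs] := hent_spec si; have := hs k isT; rewrite ler_pdivlMl// => hk.
  have h1 : N%:R * (k%:R * hent s) <= N%:R * Hent s k by rewrite ler_pM2l.
  move: Hw; rewrite ler_norml /eta => /andP[h2 _].
  move: N2 h1 h2; rewrite (mulrA N%:R k%:R) (_ : k%:R * (e / 8) * N%:R = N%:R * k%:R * (e / 8)); last by ring.
  move: (\sum_(j < N) _) (Hent s k) (hent s) => x2 x3 x4.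
  have : 0 < N%:R * k%:R :> R by rewrite mulr_gt0.
  by move: (N%:R * k%:R) => y y0 N2 h1 h2; nra.
exists l, r; split => //.
- by rewrite lE muln_gt0 (_ : 0 < N)%N// leq_max orbT.
- by rewrite /r -mulr_suml divff// gt_eqF.
- move=> w sw; case: (boolP (G w)) => Gw; last first.
    by rewrite /r (negbTE Gw) mulr0 mul0r expR_ge0.
  apply: (le_trans (r2 w)); rewrite Gw mulr1; apply: infoB => //.
  exact: (GP w (inl true) Gw).
split.
- move=> z sz.
  (* The row information depends only on [z], so one good word of the fiber controls it; without any
     good word the sum is 0. *)
  have [/hasP[w0 w0P /andP[/eqP w0z Gw0]]|/hasPn nG] :=
    boolP (has (fun w => (map p w == z) && G w) (words A l)); last first.
    rewrite big_seq_cond big1 ?expR_ge0// => w /andP[wl wz].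
    by move: (nG w wl); rewrite wz/= => /negbTE Gw; rewrite /r Gw mulr0 mul0r.
  apply: (@le_trans _ _ (expR (ln 2) * \prod_(j < N) marg p q (block t z j))); last first.
    apply: infoB => //; have := GP w0 (inl false) Gw0.
    rewrite /block_sum (eq_bigr (fun j : 'I_N => info k (marg p q) (block t z j)))// => j _.
    by rewrite /= /block map_take map_drop w0z.
  apply: (@le_trans _ _ (\sum_(w <- words A l) expR (ln 2) *
      \prod_(j < N) (q (block t w j) * (map p (block t w j) == block t z j)%:R))).
    rewrite big_mkcond; apply: le_words => w sw; case: eqP => [wz|_]; last first.
      by rewrite mulr_ge0 ?expR_ge0// prodr_ge0// => j _; rewrite mulr_ge0// weight_ge0.
    apply: (le_trans (r2 w)); rewrite ler_wpM2l ?expR_ge0//.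
    rewrite (@le_trans _ _ (block_prod t (fun=> q) N w))//; first by rewrite ler_piMr// lern1 leq_b1.
    rewrite /block_prod le_eqVlt; apply/orP; left; apply/eqP; apply: eq_bigr => j _.
    by rewrite /block map_take map_drop wz eqxx mulr1.
  rewrite -mulr_sumr ler_wpM2l ?expR_ge0//.
  rewrite (big_block_prod t (fun j u => q u * (map p u == block t z j)%:R)).
  apply: ler_prod => j _; rewrite sumr_ge0/= => [|u _]; last by rewrite mulr_ge0// weight_ge0.
  rewrite /marg (size_block (J := N))// [leRHS]big_mkcond.
  by apply: le_words => u _; case: eqP => _; rewrite ?mulr1 ?mulr0.
- move=> j x rx; have Gx : G (mkseq x l).
    by move: rx; rewrite /r; case: (G _) => //; rewrite mulr0 mul0r ltxx.
  have h1 := GP _ (inr j) Gx; have [Mj0 Mj] := MP j; have om := mP j.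
  have h2 := window_sum_mean (pt := pt) (ltW e8) om Mj qi (@qI j) k.
  rewrite -/eta in h2.
  have h3 : `|\sum_(i < l) psi j (fun n => x (i + n)%N) - \sum_(b < N) window_sum pt (psi j) k (win x (b * k) k)|
      <= N%:R * (eta + C).
    rewrite lE (sum_ord_mul (fun i => psi j (fun n => x (i + n)%N))) -sumrB.
    apply: (le_trans (ler_norm_sum _ _ _)).
    have -> : N%:R * (eta + C) = \sum_(b < N) (eta + C) by rewrite sumr_const card_ord mulr_natl.
    apply: ler_sum => b _; apply: (le_trans (window_sum_win pt (ltW e8) om Mj x (b * k) k)).
    exact: lerD.
  have h4 : block_sum t (fun=> dev k (inr j)) N (mkseq x l) =
      \sum_(b < N) window_sum pt (psi j) k (win x (b * k) k) -
      N%:R * \sum_(u <- words A k) q u * window_sum pt (psi j) k u.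
    rewrite /block_sum /dev sumrB sumr_const card_ord -[X in _ - X]mulr_natl; congr (_ - _).
    apply: eq_bigr => b _; congr (window_sum _ _ _ _).
    have -> : (b * k)%N = block_pos t b by rewrite /block_pos sum_nat_const card_ord.
    by apply: win_mkseq; rewrite -block_posS; exact: block_pos_mono.
  rewrite h4 in h1; move: h1 h2 h3.
  set S1 := \sum_(i < l) _; set S2 := \sum_(b < N) _; set mu := \sum_(u <- _) _ => h1 h2 h3.
  have h5 : N%:R * `|mu - k%:R * I j| <= N%:R * (eta + C).
    by rewrite ler_pM2l// (le_trans h2)// lerD2l.
  have h6 : `|N%:R * mu - l%:R * I j| <= N%:R * (eta + C).
    by rewrite lR -mulrA -mulrBr normrM ger0_norm ?(ltW NR).
  have h7 : N%:R * C <= N%:R * eta by rewrite ler_pM2l.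
  (* The three errors below amount to at most [1 + 2 + 2] of these eight shares. *)
  have -> : l%:R * e = N%:R * eta * 8 by rewrite lR /eta; lra.
  have Ne0 : 0 < N%:R * eta by rewrite mulr_gt0.
  move: h1 h3 h6 h7 Ne0; rewrite (mulrC eta) !mulrDr !ler_norml.
  move: (N%:R * mu) (l%:R * I j) (N%:R * eta) (N%:R * C) => x1 x2 x3 x4.
  by move=> /andP[a1 a2] /andP[b1 b2] /andP[c1 c2] d1 d2; apply/andP; split; lra.
Qed.

End GoodBlocks.

(** * Block measures *)

Section Concatenation.
Context {R : realType} {A : finType}.
Variables (t : nat -> nat) (r : nat -> seq A -> R).
Hypothesis t_gt0 : forall j, (0 < t j)%N.
Hypothesis r0 : forall j w, 0 <= r j w.
Hypothesis r1 : forall j, \sum_(u <- words A (t j)) r j u = 1.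

Lemma leq_block_pos J : (J <= block_pos t J)%N.
Proof. by elim: J => // J IH; rewrite block_posS; have := t_gt0 J; lia. Qed.

(** Blocks are nonempty, so the first [size w] of them cover [w]; completing [w] to any other number
    of blocks that cover it gives the same value. *)
Definition block_weight (w : seq A) : R :=
  \sum_(v <- words A (block_pos t (size w) - size w)) block_prod t r (size w) (w ++ v).

Lemma block_weight_mono w J K : (J <= K)%N -> (size w <= block_pos t J)%N ->
  \sum_(v <- words A (block_pos t K - size w)) block_prod t r K (w ++ v) =
  \sum_(v <- words A (block_pos t J - size w)) block_prod t r J (w ++ v).
Proof.
move/subnKC <- => h; elim: (K - J)%N => [|i IH]; first by rewrite addn0.
rewrite addnS -IH block_posS.
have h2 : (size w <= block_pos t (J + i))%N by rewrite (leq_trans h)// block_pos_mono// leq_addr.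
rewrite -addnBAC// big_words_cat; apply: eq_words => u su.
rewrite (eq_words (G := fun v => block_prod t r (J + i) (w ++ u) * r (J + i)%N v)).
  by rewrite -mulr_sumr r1 mulr1.
by move=> v sv; rewrite catA block_prod_cat// size_cat su subnKC.
Qed.

Lemma block_weightE J w : (size w <= block_pos t J)%N ->
  block_weight w = \sum_(v <- words A (block_pos t J - size w)) block_prod t r J (w ++ v).
Proof.
move=> h; rewrite /block_weight -(block_weight_mono (leq_maxl (size w) J)) ?leq_block_pos//.
by rewrite (block_weight_mono (leq_maxr (size w) J)).
Qed.

Lemma block_weight_full J w : size w = block_pos t J -> block_weight w = block_prod t r J w.
Proof.
by move=> sw; rewrite (@block_weightE J) sw// subnn big_words0 cats0.
Qed.

Lemma block_weight_weight : weight block_weight.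
Proof.
split.
- by rewrite (@block_weight_full 0) /block_prod ?big_ord0//= /block_pos big_ord0.
- by move=> w; apply: sumr_ge0 => v _; exact: block_prod_ge0.
move=> w; have h := leq_block_pos (size w).+1.
rewrite (@block_weightE (size w).+1) ?(leq_trans _ h)//.
rewrite -[(_ - _)%N]prednK ?subn_gt0// -subnS big_wordsS; apply: eq_bigr => a _.
rewrite (@block_weightE (size w).+1) size_rcons//.
by apply: eq_bigr => v _; rewrite cat_rcons.
Qed.

End Concatenation.

Section CylinderProbability.
Context {R : realType} {A : pointedFinType}.

Lemma pr_cyl (mu : probability (shiftspace A) R) n (W : pred (seq A)) :
  pr mu (cyl n W) = \sum_(w <- words A n | W w) shift_law mu w.
Proof.
rewrite (pr_itin_split measurable_sshift letter_family _ n) ?big_mkcond//; last exact: measurable_cyl.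
rewrite [RHS]big_mkcond; apply: eq_words => w sw.
case: ifP => Ww.
  rewrite (_ : _ `&` _ = itin sshift letter w)//.
  by rewrite itinE; apply/seteqP; split => [x []//|x /= xw]; split => //; rewrite /cyl /= -sw xw.
rewrite (_ : _ `&` _ = set0) ?/pr ?measure0//.
by rewrite itinE -subset0 => x [] /=; rewrite /cyl/= -sw => + e; rewrite e Ww.
Qed.

Variables (t : nat -> nat) (r : nat -> seq A -> R).
Hypothesis t_gt0 : forall j, (0 < t j)%N.
Hypothesis r0 : forall j w, 0 <= r j w.
Hypothesis r1 : forall j, \sum_(u <- words A (t j)) r j u = 1.

Definition block_measure : probability (shiftspace A) R :=
  weight_measure (block_weight_weight t_gt0 r0 r1).

Definition box (K : nat) (W : nat -> pred (seq A)) : set (shiftspace A) :=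
  [set x | forall j, (j < K)%N -> W j (win x (block_pos t j) (t j))].

Lemma block_mkseq x K j : (j < K)%N -> block t (mkseq x (block_pos t K)) j = win x (block_pos t j) (t j) :> seq A.
Proof. by move=> jK; apply: win_mkseq; rewrite -block_posS; exact: block_pos_mono. Qed.

Lemma box_cyl K W : box K W =
  cyl (block_pos t K) (fun w => [forall j : 'I_K, W j (block t w j)]).
Proof.
apply/seteqP; split => x /= h.
  by apply/forallP => j; rewrite block_mkseq//; exact: h.
by move=> j jK; move/forallP: h => /(_ (Ordinal jK)); rewrite block_mkseq.
Qed.

Lemma measurable_box K W : measurable (box K W).
Proof. by rewrite box_cyl; exact: measurable_cyl. Qed.

Lemma pr_box K W : pr block_measure (box K W) =
  \prod_(j < K) \sum_(u <- words A (t j) | W j u) r j u.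
Proof.
rewrite box_cyl pr_cyl weight_measure_law big_mkcond.
rewrite [RHS](eq_bigr (fun j : 'I_K => \sum_(u <- words A (t j)) (if W j u then r j u else 0))); last first.
  by move=> j _; rewrite big_mkcond.
rewrite -(big_block_prod t (fun j u => if W j u then r j u else 0)); apply: eq_words => w sw.
case: ifPn => [/forallP h|]; last first.
  by rewrite negb_forall => /existsP[j /negbTE h]; rewrite (bigD1 j)//= h mul0r.
rewrite (block_weight_full _ _ _ (J := K))//.
by apply: eq_bigr => j _; rewrite h.
Qed.

Definition block_support : set (shiftspace A) :=
  [set x | forall j, 0 < r j (win x (block_pos t j) (t j))].

Let null j : set (shiftspace A) := box j.+1 (fun i u => (i == j) ==> (r i u == 0)).

Lemma block_supportE : block_support = ~` \bigcup_j null j.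
Proof.
apply/seteqP; split => x /= h.
  move=> [j _ /(_ j (ltnSn j))]; rewrite eqxx/= => /eqP e.
  by have := h j; rewrite e ltxx.
move=> j; rewrite lt_neqAle r0 andbT; apply/negP => /eqP e; apply: h; exists j => // i ij.
by apply/implyP => /eqP ->; rewrite -e.
Qed.

Lemma measurable_block_support : measurable block_support.
Proof.
rewrite block_supportE; apply: measurableC; apply: bigcup_measurable => j _.
exact: measurable_box.
Qed.

Lemma pr_block_support : pr block_measure block_support = 1.
Proof.
have n0 j : block_measure (null j) = 0%E.
  rewrite prE ?pr_box; last exact: measurable_box.
  rewrite big_ord_recr/= [X in _ * X]big1 ?mulr0// => u; rewrite eqxx/=.
  by move/eqP.
rewrite /pr block_supportE probability_setC; last first.
  by apply: bigcup_measurable => j _; exact: measurable_box.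
rewrite (_ : block_measure (\bigcup_j null j) = 0%E) ?sube0//.
apply/negligibleP; first by apply: bigcup_measurable => j _; exact: measurable_box.
apply: negligible_bigcup => j; apply/negligibleP; first exact: measurable_box.
exact: n0.
Qed.

End CylinderProbability.

(** * Slow growth of the block lengths *)

Section Stages.

(* The stage is increased only when the next block length, times the stage number, is at most the number of blocks. *)
Fixpoint stage (l : nat -> nat) (j : nat) : nat :=
  if j is j'.+1 then
    if (l (stage l j').+1 * (stage l j').+1 <= j'.+1)%N then (stage l j').+1 else stage l j'
  else 0%N.

Lemma stage_mul l j : (l (stage l j) * stage l j <= j)%N.
Proof.
elim: j => [|j IH] /=; first by rewrite muln0.
by case: ifP => // _; rewrite (leq_trans IH).
Qed.

Lemma stage_mono l i j : (i <= j)%N -> (stage l i <= stage l j)%N.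
Proof.
move/subnKC <-; elim: (j - i)%N => [|d IH]; first by rewrite addn0.
by rewrite addnS /=; case: ifP => _; rewrite ?(leq_trans IH).
Qed.

Lemma stage_unbounded l n : exists j0, forall j, (j0 <= j)%N -> (n <= stage l j)%N.
Proof.
suff [j0 H] : exists j0, (n <= stage l j0)%N.
  by exists j0 => j /(stage_mono l); exact: leq_trans.
elim: n => [|n [j0 IH]]; first by exists 0%N.
pose j := maxn j0 (l n.+1 * n.+1).
have h : (n <= stage l j)%N by rewrite (leq_trans IH)// stage_mono// leq_maxl.
have [h1|h1] := ltnP n (stage l j); first by exists j.
exists j.+1; rewrite /=; have -> : stage l j = n by apply/eqP; rewrite eqn_leq h1.
by rewrite (leq_trans (leq_maxr j0 _) (leqnSn _)).
Qed.

Lemma block_find t n : (forall j, 0 < t j)%N ->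
  exists J, (block_pos t J <= n < block_pos t J.+1)%N.
Proof.
move=> t0; elim: n => [|n [J /andP[h1 h2]]].
  by exists 0%N; rewrite block_posS /block_pos big_ord0 t0.
have [h|h] := ltnP n.+1 (block_pos t J.+1); first by exists J; rewrite h (leq_trans h1).
exists J.+1; rewrite h block_posS; have := t0 J.+1; lia.
Qed.

End Stages.

Section StageErrors.
Context {R : realType}.
Variables (l : nat -> nat) (l_gt0 : forall n, (0 < l n)%N).

Let s := stage l.
Let t (j : nat) : nat := l (s j).
Let T J : R := (block_pos t J)%:R.
Let eps (j : nat) : R := (s j).+1%:R^-1.

(** Two errors must be negligible against the total length: the tolerances accumulated by finished
    blocks, and the block in progress, charged [M] per letter. *)
Lemma stage_error (M eta : R) : 0 <= M -> 0 < eta -> exists J0, forall J, (J0 <= J)%N ->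
  \sum_(j < J) (t j)%:R * eps j + M * (t J)%:R <= eta * T J.
Proof.
move=> M0 e0.
have e3 : 0 < eta / 3 by rewrite divr_gt0.
(* From [j1] on the tolerance is at most [eta / 3]; from [j2] on the current block is short enough.
   The blocks before [j1] take the last third once [J] is large. *)
have [j1 j1P] := stage_unbounded l (Num.truncn (eta / 3)^-1).
have [j2 j2P] := stage_unbounded l (Num.truncn (M / (eta / 3))).+1.
have TJ J : J%:R <= T J by rewrite ler_nat leq_block_pos// => j; exact: l_gt0.
exists (maxn j1 (maxn j2 (Num.truncn (T j1 / (eta / 3))).+1)) => J.
rewrite !geq_max => /andP[h1 /andP[h2 h3]].
have b1 : T j1 <= eta / 3 * T J.
  rewrite mulrC -ler_pdivrMr//; apply: le_trans (TJ J).
  by apply: (le_trans (ltW (truncnS_gt _))); rewrite ler_nat.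
have b2 : M * (t J)%:R <= eta / 3 * T J.
  apply: (@le_trans _ _ (eta / 3 * ((t J)%:R * (s J)%:R))); last first.
    rewrite ler_pM2l//; apply: le_trans (TJ J); rewrite -natrM ler_nat; exact: stage_mul.
  rewrite (mulrC _%:R) mulrA ler_wpM2r// mulrC -ler_pdivrMr//.
  by apply: (le_trans (ltW (truncnS_gt _))); rewrite ler_nat j2P.
have eps1 j : eps j <= 1 by rewrite invf_le1 ?ler1n.
have epse j : (j1 <= j)%N -> eps j <= eta / 3.
  move=> /j1P h; rewrite /eps -[eta / 3]invrK lef_pV2 ?posrE ?invr_gt0//.
  by apply: (le_trans (ltW (truncnS_gt _))); rewrite ler_nat.
have b3 : \sum_(j < J) (t j)%:R * eps j <= T j1 + eta / 3 * T J.
  rewrite {1}/T /block_pos natr_sum (big_ord_widen _ (fun j => (t j)%:R) h1) [X in _ <= X + _]big_mkcond/=.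
  rewrite /T /block_pos natr_sum mulr_sumr -big_split/=; apply: ler_sum => j _.
  have tj0 : 0 <= (t j)%:R :> R by exact: ler0n.
  case: (ltnP j j1) => h.
    by apply: ler_wpDr; [exact: mulr_ge0 (ltW e3) tj0 | exact: ler_piMr].
  by rewrite add0r mulrC; apply: ler_wpM2r => //; exact: epse.
have := b1; have := b2; have := b3.
by move: (T J) (T j1) (M * _) (\sum_(j < J) _) => x1 x2 x3 x4; lra.
Qed.

End StageErrors.

Section LowerMeasure.
Context {R : realType} {A : pointedFinType} {B J : finType} (pt : A) (p : A -> B).
Variables (q : seq A -> R) (psi : J -> (nat -> A) -> R) (I : J -> R).
Hypothesis qi : inv_weight q.
Hypothesis uc : forall j, unif_cont (psi j).
Hypothesis qI : forall j, integ pt q (psi j) (I j).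

Definition square (x : nat -> A) (n L : nat) : set (shiftspace A) :=
  [set y | mkseq y n = mkseq x n /\ mkseq (p \o y) L = mkseq (p \o x) L].

Lemma measurable_square x n L : (n <= L)%N -> measurable (square x n L).
Proof.
move=> nL; rewrite (_ : square x n L = cyl L (fun w => (take n w == mkseq x n) &&
   (map p w == mkseq (p \o x) L))); first exact: measurable_cyl.
have e (y : nat -> A) : take n (pfx y L) = mkseq y n.
  by rewrite /pfx /mkseq -map_take take_iota (minn_idPl nL).
apply/seteqP; split => y; rewrite /square /cyl /= e /pfx /mkseq -map_comp.
  by move=> [-> ->]; rewrite !eqxx.
by move=> /andP[/eqP -> /eqP ->].
Qed.

Lemma sum_block_pos (V : nmodType) t (f : nat -> V) K :
  \sum_(i < block_pos t K) f i = \sum_(j < K) \sum_(i < t j) f (block_pos t j + i)%N.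
Proof.
elim: K => [|K IH]; first by rewrite /block_pos !big_ord0.
by rewrite big_ord_recr/= -IH block_posS big_split_ord.
Qed.

Lemma sum_ord_split (V : nmodType) (f : nat -> V) m n : (m <= n)%N ->
  \sum_(i < n) f i = \sum_(i < m) f i + \sum_(i < n - m) f (m + i)%N.
Proof.
move/subnKC => e; rewrite -[in LHS](big_mkord xpredT f) -[in LHS]e big_mkord big_split_ord.
by [].
Qed.

(** One measure serves all observables at once, with rates uniform over the support [E]. The square
    bound keeps [n] and [L] free, so it can be used at the hitting times of any point. *)
Theorem lower_measure : exists (mu : probability (shiftspace A) R) (E : set (shiftspace A)),
  [/\ measurable E, pr mu E = 1,
    forall j eta, 0 < eta -> exists N, forall n x, (N <= n)%N -> E x ->
      `|\sum_(i < n) psi j (fun k => x (i + k)%N) - n%:R * I j| <= n%:R * eta &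
    forall eta, 0 < eta -> exists N, forall n L x, (N <= n)%N -> (n <= L)%N ->
      pr mu (square x n L) <=
      expR (- (n%:R * relh p q + L%:R * hent (marg p q) - L%:R * eta))].
Proof.
set h := hent q; set hv := hent (marg p q).
have hE : h = relh p q + hv by exact: hent_chain.
have [_ relh0 _] := relh_spec p qi.
have [_ hv0 _] := hent_spec (marg_inv_weight p qi).
have /choice[l /choice[rho rhoP]] : forall n : nat, exists (l : nat) (r : seq A -> R),
  [/\ (0 < l)%N, forall w, 0 <= r w, \sum_(w <- words A l) r w = 1,
      forall w, size w = l -> r w <= expR (- (l%:R * (h - n.+1%:R^-1))) &
      (forall z, size z = l ->
         \sum_(w <- words A l | map p w == z) r w <= expR (- (l%:R * (hv - n.+1%:R^-1)))) /\
      (forall j x, 0 < r (mkseq x l) ->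
        `|\sum_(i < l) psi j (fun n => x (i + n)%N) - l%:R * I j| <= l%:R * n.+1%:R^-1)].
  by move=> n; apply: (good_block p qi uc (@qI)); rewrite invr_gt0.
pose s := stage l; pose t j := l (s j); pose r j := rho (s j).
pose eps (j : nat) : R := (s j).+1%:R^-1.
have l_gt0 n : (0 < l n)%N by case: (rhoP n).
have t_gt0 j : (0 < t j)%N by exact: l_gt0.
have r0 j w : 0 <= r j w by have [_ h0 _ _ _] := rhoP (s j); exact: h0.
have r1 j : \sum_(u <- words A (t j)) r j u = 1 by case: (rhoP (s j)).
pose T K : R := (block_pos t K)%:R.
have err M eta : 0 <= M -> 0 < eta -> exists J0, forall K, (J0 <= K)%N ->
  \sum_(j < K) (t j)%:R * eps j + M * (t K)%:R <= eta * T K by exact: stage_error.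
have findP J0 n K : (block_pos t J0 <= n)%N -> (n < block_pos t K.+1)%N -> (J0 <= K)%N.
  move=> h1 h2; rewrite leqNgt; apply/negP => h3.
  by have := block_pos_mono t h3; lia.
exists (block_measure t_gt0 r0 r1), (block_support t r); split.
- exact: measurable_block_support.
- exact: pr_block_support.
- move=> j eta eta0; have [M [M0 MP]] := unif_cont_bounded pt (uc j).
  have MI0 : 0 <= M + `|I j| by rewrite addr_ge0.
  have [J0 J0P] := err _ _ MI0 eta0.
  exists (block_pos t J0) => n x Nn Ex.
  have [K /andP[h1 h2]] := block_find n t_gt0.
  have JK := findP _ _ _ Nn h2.
  pose f i := psi j (fun k => x (i + k)%N).
  have b1 : `|\sum_(i < block_pos t K) f i - T K * I j| <= \sum_(i < K) (t i)%:R * eps i.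
    rewrite sum_block_pos /T /block_pos natr_sum mulr_suml -sumrB.
    apply: (le_trans (ler_norm_sum _ _ _)); apply: ler_sum => i _.
    have [_ _ _ _ [_ g]] := rhoP (s i); have := g j (fun k => x (block_pos t i + k)%N) (Ex i).
    rewrite (eq_bigr (fun i0 : 'I_(l (s i)) => f (block_pos t i + i0)%N))// => i0 _.
    by rewrite /f; congr (psi j _); apply/funext => k; rewrite addnA.
  have b2 : `|\sum_(i < n - block_pos t K) f (block_pos t K + i)%N - (n - block_pos t K)%:R * I j| <=
      (M + `|I j|) * (t K)%:R.
    have -> : (n - block_pos t K)%:R * I j = \sum_(i < n - block_pos t K) I j.
      by rewrite sumr_const card_ord mulr_natl.
    rewrite -sumrB; apply: (le_trans (ler_norm_sum _ _ _)).
    apply: (@le_trans _ _ (\sum_(i < n - block_pos t K) (M + `|I j|))).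
      apply: ler_sum => i _; apply: (le_trans (ler_normB _ _)); rewrite lerD2r; exact: MP.
    rewrite sumr_const card_ord -[leLHS]mulr_natr ler_wpM2l// ler_nat.
    by move: h2; rewrite block_posS; lia.
  have -> : \sum_(i < n) psi j (fun k => x (i + k)%N) = \sum_(i < block_pos t K) f i +
      \sum_(i < n - block_pos t K) f (block_pos t K + i)%N.
    exact: (sum_ord_split f h1).
  have nE : n%:R = T K + (n - block_pos t K)%:R by rewrite /T -natrD subnKC.
  rewrite nE mulrDl opprD addrACA (le_trans (ler_normD _ _))// (le_trans (lerD b1 b2))//.
  by rewrite (le_trans (J0P K JK))// mulrC ler_wpM2r ?(ltW eta0)// lerDl.
- move=> eta eta0; have e2 : 0 < eta / 2 by rewrite divr_gt0.
  (* The block cut by [n] loses up to [relh] per letter and the one cut by [L] up to [hv], which are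
     the two values of [M]. *)
  have [J1 J1P] := err _ _ relh0 e2; have [J2 J2P] := err _ _ hv0 e2.
  exists (block_pos t (maxn J1 J2)) => n L x Nn nL.
  have [J' /andP[a1 a2]] := block_find n t_gt0.
  have [K /andP[b1 b2]] := block_find L t_gt0.
  have JJ := findP _ _ _ Nn a2; have JK := findP _ _ _ (leq_trans a1 nL) b2.
  (* Blocks finished before [n] are prescribed entirely, later ones that finish before [L] only
     through their rows. *)
  pose W j u := if (j < J')%N then u == win x (block_pos t j) (t j)
    else map p u == map p (win x (block_pos t j) (t j)).
  have sub : square x n L `<=` box t K W.
    move=> y [yn yL] j jK; rewrite /W; case: ifP => jJ.
      have le1 : (block_pos t j + t j <= n)%N by rewrite -block_posS (leq_trans _ a1)// block_pos_mono.
      by rewrite -(win_mkseq _ le1) yn win_mkseq.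
    have le2 : (block_pos t j + t j <= L)%N by rewrite -block_posS (leq_trans _ b1)// block_pos_mono.
    by rewrite !map_win -(win_mkseq _ le2) yL win_mkseq.
  apply: (le_trans (pr_le _ (measurable_square _ nL) (measurable_box t K W) sub)).
  rewrite pr_box.
  apply: (@le_trans _ _ (\prod_(j < K) expR (- ((t j)%:R * (hv - eps j) +
      (if (j < J')%N then (t j)%:R * relh p q else 0))))).
    apply: ler_prod => j _; rewrite sumr_ge0//=.
    have [_ _ _ g1 [g2 _]] := rhoP (s j); rewrite /W; case: ifP => jJ.
      rewrite big_mkcond (eq_bigr (fun u => (u == win x (block_pos t j) (t j))%:R * r j u)); last first.
        by move=> u _; case: eqP => _; rewrite ?mul1r ?mul0r.
      rewrite big_words_delta ?size_win// (le_trans (g1 _ _)) ?size_win//.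
      by rewrite ler_expR hE -/(eps j) -/(t j); move: (eps j) (t j)%:R => x1 x2; lra.
    by rewrite addr0; apply: g2; rewrite size_map size_win.
  rewrite -expR_sum ler_expR sumrN lerN2 big_split/= -big_mkcond -(big_ord_widen _ (fun j => (t j)%:R * relh p q) JK).
  rewrite -mulr_suml (eq_bigr (fun j : 'I_K => (t j)%:R * hv - (t j)%:R * eps j)); last first.
    by move=> j _; rewrite mulrBr.
  rewrite sumrB -mulr_suml -!natr_sum -/(block_pos t K) -/(block_pos t J') -/(T K) -/(T J').
  have c1 := J1P J' (leq_trans (leq_maxl _ _) JJ).
  have c2 := J2P K (leq_trans (leq_trans (leq_maxr _ _) JJ) JK).
  have n1 : n%:R <= T J' + (t J')%:R by rewrite /T -natrD -block_posS ler_nat ltnW.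
  have n2 : L%:R <= T K + (t K)%:R by rewrite /T -natrD -block_posS ler_nat ltnW.
  have n3 : T K <= L%:R by rewrite ler_nat.
  have n4 : T J' <= L%:R by rewrite ler_nat (leq_trans a1).
  have n5 : n%:R * relh p q <= (T J' + (t J')%:R) * relh p q by rewrite ler_wpM2r.
  have n6 : L%:R * hv <= (T K + (t K)%:R) * hv by rewrite ler_wpM2r.
  have n7 : eta / 2 * T J' <= eta / 2 * L%:R by rewrite ler_pM2l.
  have n8 : eta / 2 * T K <= eta / 2 * L%:R by rewrite ler_pM2l.
  have n9 : 0 <= \sum_(j < J') (t j)%:R * eps j.
    by apply: sumr_ge0 => j _; rewrite mulr_ge0// invr_ge0.
  move: c1 c2 n5 n6 n7 n8 n9; rewrite !mulrDl -/hv.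
  move: (\sum_(j < J') _) (\sum_(j < K) _) => S1 S2; lra.
Qed.

End LowerMeasure.

(** * Lower bound *)

Section LetterObservables.
Context {R : realType} {A : finType} (pt : A) (l : A -> R) (q : seq A -> R).

Lemma letter_unif_cont : unif_cont (fun x : nat -> A => l (x 0%N)).
Proof. by move=> e e0; exists 1%N => x y xy; rewrite xy// subrr normr0 ltW. Qed.

Lemma letter_integ : weight q -> integ pt q (fun x => l (x 0%N)) (lyap_w l q).
Proof.
move=> qw; apply: (@cvg_trans _ ((fun=> lyap_w l q) @ \oo)); last exact: cvg_cst.
apply: near_eq_cvg; exists 1%N => // -[//|k] _ /=.
rewrite /ev big_wordsS; apply: eq_bigr => a _; rewrite (weight_cat [:: a] k qw) mulr_suml.
by apply: eq_bigr.
Qed.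

End LetterObservables.

Section LowerBound.
Context {R : realType} {A : pointedFinType} {B : finType} (p : A -> B).
Variables (la : A -> R) (lb : B -> R) (l0 l1 : R).
Hypothesis l00 : 0 < l0.
Hypothesis la_bd : forall a, l0 <= la a <= l1.
Hypothesis lb_bd : forall b, l0 <= lb b <= l1.
Hypothesis lb_le : forall a, lb (p a) <= la a.
Implicit Types (x y : nat -> A) (rho : R).

Definition hitA rho x : nat := hit l00 la_bd rho x.
Definition hitB rho x : nat := hit l00 lb_bd rho (p \o x).

Lemma hitA_le_hitB rho x : (hitA rho x <= hitB rho x)%N.
Proof.
apply: hit_min; apply: (le_trans (hitP l00 lb_bd rho (p \o x))).
exact: (LamV_le_Lam lb_le x).
Qed.

(** At the hitting times [n * lam] and [L * lav] are both about [rho], so the exponent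
    [n * rh + L * hv] is about [rho * Dim]. *)
Lemma square_mass (mu : probability (shiftspace A) R) (E : set (nat -> A)) (q : seq A -> R) s :
  inv_weight q -> 0 <= s -> s < Dim p la lb q ->
  (forall eta, 0 < eta -> exists N, forall n x, (N <= n)%N -> E x ->
     `|Lam la x n - n%:R * lyap_w la q| <= n%:R * eta) ->
  (forall eta, 0 < eta -> exists N, forall n x, (N <= n)%N -> E x ->
     `|LamV p lb x n - n%:R * lyap_w (lb \o p) q| <= n%:R * eta) ->
  (forall eta, 0 < eta -> exists N, forall n L x, (N <= n)%N -> (n <= L)%N ->
      pr mu (square p x n L) <=
      expR (- (n%:R * relh p q + L%:R * hent (marg p q) - L%:R * eta))) ->
  exists2 rho0, 0 <= rho0 & forall rho x, rho0 <= rho -> E x ->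
    pr mu (square p x (hitA rho x) (hitB rho x)) <= expR (- (rho * s)).
Proof.
move=> qi s0 sD HA HB Hm; have qw : weight q := qi.
have ls0 := lyapA_gt0 l00 la_bd qw; have lv0 := lyapB_gt0 p l00 lb_bd qw.
have /andP[ls_ge _] := lyap_w_bounds qw la_bd.
have /andP[lv_ge _] := lyap_w_bounds qw (fun a => lb_bd (p a) : l0 <= (lb \o p) a <= l1).
have [_ rh0 _] := relh_spec p qi; have [_ hv0 _] := hent_spec (marg_inv_weight p qi).
set lam := lyap_w la q in HA ls0 ls_ge *; set lav := lyap_w (lb \o p) q in HB lv0 lv_ge *.
set rh := relh p q in Hm rh0 *; set hv := hent (marg p q) in Hm hv0 *.
have DE : Dim p la lb q = rh / lam + hv / lav by [].
set D := Dim p la lb q in DE sD.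
(* [u] is the relative error. After multiplication by [1 + u] the error term costs at most
   [4 * u * rho], and the factor itself costs [u * s * rho]. *)
pose u : R := Num.min 1 ((D - s) / (4 + s)).
have s4 : 0 < 4 + s by rewrite ltr_pwDl.
have u0 : 0 < u by rewrite lt_min ltr01 divr_gt0// subr_gt0.
have u1 : u <= 1 by rewrite ge_min lexx.
have u2 : u * (4 + s) <= D - s by rewrite -ler_pdivlMr// ge_min lexx orbT.
have eta0 : 0 < u * l0 by rewrite mulr_gt0.
have [N1 N1P] := HA _ eta0; have [N2 N2P] := HB _ eta0; have [N3 N3P] := Hm _ eta0.
pose N := maxn N1 (maxn N2 N3).
have l10 : 0 < l1.
  by have /andP[h1 h2] := la_bd point; exact: lt_le_trans l00 (le_trans h1 h2).
exists (N%:R * l1 + l1); first by rewrite addr_ge0// ?mulr_ge0// ltW.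
move=> rho x rhoN Ex.
have Nl0 : 0 <= N%:R * l1 by rewrite mulr_ge0// ltW.
have rho_l1 : l1 <= rho by rewrite (le_trans _ rhoN)// lerDr.
have rho0 : 0 < rho by exact: lt_le_trans rho_l1.
set n := hitA rho x; set L := hitB rho x; have nL : (n <= L)%N by exact: hitA_le_hitB.
have nN : (N <= n)%N.
  rewrite -(ler_nat R) -(ler_pM2r l10); apply: (le_trans _ (hit_ge l00 la_bd rho x)).
  by rewrite (le_trans _ rhoN)// lerDl ltW.
have LN := leq_trans nN nL.
apply: (le_trans (N3P n L x _ nL)).
  by rewrite (leq_trans _ nN)// /N !leq_max leqnn !orbT.
rewrite ler_expR lerN2.
have /ler_normlW a1 := N1P n x (leq_trans (leq_maxl _ _) nN) Ex.
have N2L : (N2 <= L)%N by rewrite (leq_trans _ LN)// /N !leq_max leqnn !orbT.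
have /ler_normlW a2 := N2P L x N2L Ex.
have b1 : rho <= Lam la x n by exact: hitP.
have b2 : rho <= LamV p lb x L by exact: (hitP l00 lb_bd rho (p \o x)).
have b3 : L%:R * l0 <= rho + l1.
  have := hit_le l00 lb_bd (p \o x) (ltW rho0); apply: le_trans.
  by have /andP[] := LamV_bounds p lb_bd x L.
have part c (k : nat) z : l0 <= c -> 0 < c -> 0 <= z -> rho - k%:R * c <= k%:R * (u * l0) ->
    rho * (z / c) <= (1 + u) * (k%:R * z).
  move=> lc c0 z0 h; rewrite mulrA ler_pdivrMr// mulrC.
  have -> : (1 + u) * (k%:R * z) * c = z * ((1 + u) * k%:R * c) by ring.
  rewrite ler_wpM2l//.
  have : k%:R * (u * l0) <= k%:R * (u * c) by rewrite ler_wpM2l// ler_wpM2l// ltW.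
  by move: h; move: (k%:R : R) => k'; lra.
have c1 : rho * (rh / lam) <= (1 + u) * (n%:R * rh).
  by apply: part => //; rewrite (le_trans _ a1)// lerB.
have c2 : rho * (hv / lav) <= (1 + u) * (L%:R * hv).
  by apply: part => //; rewrite (le_trans _ a2)// lerB.
have c3 : L%:R * (u * l0) <= 2 * u * rho.
  have : u * (L%:R * l0) <= u * (rho + l1) by rewrite ler_pM2l.
  have : u * l1 <= u * rho by rewrite ler_pM2l.
  by move: (L%:R : R) => L'; lra.
have u1p : 0 < 1 + u by rewrite addr_gt0.
rewrite -(ler_pM2l u1p) mulrBr mulrDr.
have c4 : (1 + u) * (L%:R * (u * l0)) <= (1 + u) * (2 * u * rho) by rewrite ler_pM2l.
have c5 : rho * (u * u) <= rho * u by rewrite ler_pM2l// ler_piMl// ltW.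
have c6 : rho * (u * (4 + s)) <= rho * (D - s) by rewrite ler_pM2l.
have c7 : rho * D = rho * (rh / lam) + rho * (hv / lav) by rewrite DE mulrDr.
move: c1 c2 c4 c5 c6 c7; move: (rh / lam) (hv / lav) (n%:R * rh) (L%:R * hv) (L%:R * _).
move=> y1 y2 y3 y4 y5; lra.
Qed.

(** * Approximate squares meeting a small set *)

Section Packing.
Variables (Pt : (nat -> A) -> R * R) (cX cY : (nat -> A) -> nat -> R).
Hypothesis cX_near : forall x n, `|(Pt x).1 - cX x n| <= expR (- Lam la x n).
Hypothesis cY_near : forall x n, `|(Pt x).2 - cY x n| <= expR (- LamV p lb x n).
Hypothesis cX_sep : forall x y n n' j, (j < n)%N -> (j < n')%N ->
  (forall i, (i < j)%N -> x i = y i) -> p (x j) = p (y j) -> x j <> y j ->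
  expR (- Lam la x n) <= `|cX x n - cX y n'| \/ expR (- Lam la y n') <= `|cX x n - cX y n'|.
Hypothesis cY_sep : forall x y n n' j, (j < n)%N -> (j < n')%N ->
  (forall i, (i < j)%N -> p (x i) = p (y i)) -> p (x j) <> p (y j) ->
  expR (- LamV p lb x n) <= `|cY x n - cY y n'| \/ expR (- LamV p lb y n') <= `|cY x n - cY y n'|.

(** The corners to be counted lie in an interval of length [4 * exp (- rho)], and the sides of the
    squares are at least the mesh [exp (- (rho + l1))]. *)
Definition ncells : nat := (Num.truncn (4 * expR l1)).+1.

Definition cell (c0 mesh c : R) : nat := Num.truncn ((c - c0) / mesh).

Lemma cell_eq c0 mesh c c' : 0 < mesh -> c0 <= c -> c0 <= c' ->
  cell c0 mesh c = cell c0 mesh c' -> `|c - c'| < mesh.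
Proof.
move=> m0 h h' e; have g c1 : c0 <= c1 -> (cell c0 mesh c1)%:R <= (c1 - c0) / mesh < (cell c0 mesh c1).+1%:R.
  by move=> h1; apply: truncn_itv; rewrite divr_ge0 ?subr_ge0// ltW.
have /andP[a1 a2] := g c h; have /andP[b1 b2] := g c' h'; rewrite -e in b1 b2.
move: a1 a2 b1 b2; rewrite !ler_pdivlMr// !ltr_pdivrMr// -natr1 mulrDl mul1r.
move: ((cell c0 mesh c)%:R * mesh) => z; rewrite ltr_norml; lra.
Qed.

(* Grid cells of the corners separate distinct approximate squares, so boundedly many of them meet [U]. *)
Lemma square_pack (E : set (nat -> A)) U (rho M : R) : 0 <= rho ->
  (diam2 U <= (expR (- rho))%:E)%E ->
  forall mu : probability (shiftspace A) R,
  (forall x, E x -> pr mu (square p x (hitA rho x) (hitB rho x)) <= M) -> 0 <= M ->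
  exists S : set (shiftspace A), [/\ measurable S, E `&` Pt @^-1` U `<=` S &
    pr mu S <= (ncells * ncells)%:R * M].
Proof.
move=> rho0 dU mu HM M0.
have [e|/set0P[z [Ez Uz]]] := eqVneq (E `&` Pt @^-1` U) set0.
  by exists set0; rewrite e; split => //; rewrite /pr measure0 mulr_ge0.
pose r := expR (- rho); pose mesh := expR (- (rho + l1)).
have m0 : 0 < mesh by exact: expR_gt0.
have r0 : 0 < r by exact: expR_gt0.
have rm : 4 * r / mesh = 4 * expR l1.
  by rewrite -mulrA -expRN -expRD; congr (_ * expR _); rewrite opprK; lra.
(* A corner is within [r] of its point, which is within [r] of [Pt z]. *)
pose x0 := (Pt z).1 - 2 * r; pose y0 := (Pt z).2 - 2 * r.
have LamA x : rho <= Lam la x (hitA rho x) <= rho + l1 by rewrite hitP hit_le.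
have LamB x : rho <= LamV p lb x (hitB rho x) <= rho + l1.
  by apply/andP; split; [exact: hitP | exact: (hit_le l00 lb_bd (p \o x) rho0)].
have nearX x : Pt x \in U -> x0 <= cX x (hitA rho x) <= x0 + 4 * r.
  move=> /set_mem Ux; have [h1 _] := norm_le_dist2 (Pt x) (Pt z).
  have h2 := le_trans h1 (diam2_dist dU Ux Uz).
  have h3 : `|(Pt x).1 - cX x (hitA rho x)| <= r.
    by apply: (le_trans (cX_near _ _)); rewrite ler_expR lerN2; have /andP[] := LamA x.
  by move: h2 h3; rewrite -/r !ler_norml /x0; lra.
have nearY x : Pt x \in U -> y0 <= cY x (hitB rho x) <= y0 + 4 * r.
  move=> /set_mem Ux; have [_ h1] := norm_le_dist2 (Pt x) (Pt z).
  have h2 := le_trans h1 (diam2_dist dU Ux Uz).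
  have h3 : `|(Pt x).2 - cY x (hitB rho x)| <= r.
    by apply: (le_trans (cY_near _ _)); rewrite ler_expR lerN2; have /andP[] := LamB x.
  by move: h2 h3; rewrite -/r !ler_norml /y0; lra.
pose kX x := cell x0 mesh (cX x (hitA rho x)); pose kY x := cell y0 mesh (cY x (hitB rho x)).
have cell_lt c c0 : c0 <= c <= c0 + 4 * r -> (cell c0 mesh c < ncells)%N.
  move=> /andP[h1 h2]; rewrite ltnS; apply: le_truncn; rewrite -rm.
  by rewrite ler_pM2r ?invr_gt0// lerBlDl.
have same x y : U (Pt x) -> U (Pt y) -> kX x = kX y -> kY x = kY y ->
    square p x (hitA rho x) (hitB rho x) y.
  move=> Ux Uy eX eY.
  have /andP[x1 _] := nearX _ (mem_set Ux); have /andP[x2 _] := nearX _ (mem_set Uy).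
  have /andP[y1 _] := nearY _ (mem_set Ux); have /andP[y2 _] := nearY _ (mem_set Uy).
  have dX := cell_eq m0 x1 x2 eX; have dY := cell_eq m0 y1 y2 eY.
  have meshA x' : mesh <= expR (- Lam la x' (hitA rho x')).
    by rewrite ler_expR lerN2; have /andP[] := LamA x'.
  have meshB x' : mesh <= expR (- LamV p lb x' (hitB rho x')).
    by rewrite ler_expR lerN2; have /andP[] := LamB x'.
  (* Rows come first: [cX_sep] separates only symbols of the same row, and equality of rows up to
     [hitB] covers the indices below [hitA]. *)
  have eB : mkseq (p \o x) (hitB rho x) = mkseq (p \o y) (hitB rho x).
    apply/eqP; apply/negPn/negP => /hit_diff[j [j1 j2 j3 j4]].
    have [h|h] := cY_sep j1 j2 j3 j4; move: dY; apply/negP; rewrite -leNgt.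
      exact: le_trans (meshB x) h.
    exact: le_trans (meshB y) h.
  split => //; apply/esym/eqP; apply/negPn/negP => /hit_diff[j [j1 j2 j3 j4]].
  have pj : p (x j) = p (y j).
    have jB : (j < hitB rho x)%N by exact: leq_trans j1 (hitA_le_hitB rho x).
    by move/eq_in_map: eB => /(_ j); rewrite mem_iota/= add0n => /(_ jB).
  have [h|h] := cX_sep j1 j2 j3 pj j4; move: dX; apply/negP; rewrite -leNgt.
    exact: le_trans (meshA x) h.
  exact: le_trans (meshA y) h.
have /choice[S SP] : forall c : 'I_ncells * 'I_ncells, exists S : set (shiftspace A),
    [/\ measurable S, pr mu S <= M &
      forall x, E x -> U (Pt x) -> kX x = c.1 -> kY x = c.2 -> S x].
  move=> c; have [[x [Ex Ux x1 x2]]|nx] := pselect (exists x, [/\ E x, U (Pt x), kX x = c.1 & kY x = c.2]).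
    exists (square p x (hitA rho x) (hitB rho x)); split; first by apply: measurable_square; exact: hitA_le_hitB.
      exact: HM.
    by move=> y Ey Uy y1 y2; apply: same; rewrite ?x1 ?x2.
  exists set0; split => //; first by rewrite /pr measure0.
  by move=> x Ex Ux x1 x2; case: nx; exists x.
exists (\big[setU/set0]_(c <- enum {: 'I_ncells * 'I_ncells}) S c); split.
- by apply: bigsetU_measurable => c _; case: (SP c).
- move=> x [Ex Ux]; rewrite -bigcup_seq.
  have hx := cell_lt _ _ (nearX _ (mem_set Ux)); have hy := cell_lt _ _ (nearY _ (mem_set Ux)).
  exists (Ordinal hx, Ordinal hy); first by rewrite /= mem_enum.
  by case: (SP (Ordinal hx, Ordinal hy)) => _ _; apply.
- apply: (le_trans (pr_bigU_le _ _ _)); first by move=> c; case: (SP c).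
  rewrite big_enum/=; apply: (@le_trans _ _ (\sum_(c : 'I_ncells * 'I_ncells) M)).
    by apply: ler_sum => c _; case: (SP c).
  by rewrite sumr_const card_prod card_ord mulr_natl.
Qed.

End Packing.

Variables (Pt : (nat -> A) -> R * R) (cX cY : (nat -> A) -> nat -> R).
Hypothesis cX_near : forall x n, `|(Pt x).1 - cX x n| <= expR (- Lam la x n).
Hypothesis cY_near : forall x n, `|(Pt x).2 - cY x n| <= expR (- LamV p lb x n).
Hypothesis cX_sep : forall x y n n' j, (j < n)%N -> (j < n')%N ->
  (forall i, (i < j)%N -> x i = y i) -> p (x j) = p (y j) -> x j <> y j ->
  expR (- Lam la x n) <= `|cX x n - cX y n'| \/ expR (- Lam la y n') <= `|cX x n - cX y n'|.
Hypothesis cY_sep : forall x y n n' j, (j < n)%N -> (j < n')%N ->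
  (forall i, (i < j)%N -> p (x i) = p (y i)) -> p (x j) <> p (y j) ->
  expR (- LamV p lb x n) <= `|cY x n - cY y n'| \/ expR (- LamV p lb y n') <= `|cY x n - cY y n'|.

Theorem level_measure_neq0 (phi : (nat -> A) -> R) (alpha : R) (q : seq A -> R) t :
  unif_cont phi -> inv_weight q -> integ point q phi alpha -> 0 <= t -> t < Dim p la lb q ->
  hausdorff_measure t (Pt @` [set x | level phi alpha x]) != 0%E.
Proof.
move=> uc qi qI t0 tD; have qw : weight q := qi.
(* Besides [phi] the two exponents are controlled, as Birkhoff sums of functions of one letter;
   [square_mass] needs them to locate the hitting times. *)
pose psi (j : option bool) : (nat -> A) -> R :=
  match j with
  | None => phi
  | Some true => fun x => la (x 0%N)
  | Some false => fun x => (lb \o p) (x 0%N)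
  end.
pose I (j : option bool) : R :=
  match j with None => alpha | Some true => lyap_w la q | Some false => lyap_w (lb \o p) q end.
have psi_uc j : unif_cont (psi j).
  by case: j => [[]|] //; [exact: (letter_unif_cont la) | exact: (letter_unif_cont (lb \o p))].
have psiI j : integ point q (psi j) (I j).
  by case: j => [[]|] //; [exact: (@letter_integ R A point la q qw) | exact: (@letter_integ R A point (lb \o p) q qw)].
have [mu [E [mE PE Hbirk Hm]]] := lower_measure p qi psi_uc (@psiI).
have HA eta : 0 < eta -> exists N, forall n x, (N <= n)%N -> E x ->
     `|Lam la x n - n%:R * lyap_w la q| <= n%:R * eta.
  move=> e0; have [N NP] := Hbirk (Some true) _ e0; exists N => n x Nn Ex.
  have := NP n x Nn Ex; rewrite /psi /=.
  by rewrite /Lam; under eq_bigr do rewrite addn0.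
have HB eta : 0 < eta -> exists N, forall n x, (N <= n)%N -> E x ->
     `|LamV p lb x n - n%:R * lyap_w (lb \o p) q| <= n%:R * eta.
  move=> e0; have [N NP] := Hbirk (Some false) _ e0; exists N => n x Nn Ex.
  have := NP n x Nn Ex; rewrite /psi /=.
  by rewrite /LamV; under eq_bigr do rewrite addn0.
pose s := (t + Dim p la lb q) / 2.
have ts : t < s by rewrite /s; lra.
have sD : s < Dim p la lb q by rewrite /s; lra.
have s0 : 0 < s by exact: le_lt_trans ts.
have [rho0 rho0_ge0 mass] := square_mass qi (ltW s0) sD HA HB Hm.
apply: (@hausdorff_measure_neq0 R _ _ mu E Pt (ncells * ncells)%:R s t (expR (- rho0))) => //.
- exact: expR_gt0.
- move=> r U /andP[r0 rr] dU; pose rho := - ln r.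
  have rE : r = expR (- rho) by rewrite opprK lnK.
  have rho_ge : rho0 <= rho by rewrite lerNr -ler_expR lnK// ltW.
  rewrite rE expR_powR mulrN (mulrC s).
  rewrite rE in dU.
  apply: (square_pack cX_near cY_near cX_sep cY_sep (le_trans rho0_ge0 rho_ge) dU).
    by move=> x Ex; apply: mass.
  exact: expR_ge0.
- move=> _ [x Ex <-]; exists x => //; rewrite /level /=; apply/cvgrPdist_le => e e0.
  have [N NP] := Hbirk None _ e0; exists N.+1 => // n /= Nn.
  have n0 : (0 < n)%N by exact: leq_trans Nn.
  have := NP n x (ltnW Nn) Ex; rewrite /psi /=; set S := \sum_(i < n) _ => h.
  rewrite distrC (_ : n%:R^-1 * S - alpha = n%:R^-1 * (S - n%:R * alpha)); last first.
    by rewrite mulrBr mulKf// pnatr_eq0 -lt0n.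
  by rewrite normrM ger0_norm ?invr_ge0// ler_pdivrMl ?ltr0n.
Qed.
End LowerBound.

(** * Semicontinuity of the spectrum *)

Section Spectrum.
Context {R : realType} {A B : finType} (pt : A) (p : A -> B).
Variables (la : A -> R) (lb : B -> R) (l0 l1 : R).
Hypothesis l00 : 0 < l0.
Hypothesis la_bd : forall a, l0 <= la a <= l1.
Hypothesis lb_bd : forall b, l0 <= lb b <= l1.

Lemma integ_opp (q : seq A -> R) (phi : (nat -> A) -> R) I :
  integ pt q phi I -> integ pt q (fun x => - phi x) (- I).
Proof.
move=> h; rewrite /integ (_ : ev pt q _ = fun k => - ev pt q phi k).
  by apply: cvgN; exact: h.
by apply/funext => k; rewrite /ev -sumrN; apply: eq_bigr => w _; rewrite mulrN.
Qed.

Lemma unif_cont_opp (phi : (nat -> A) -> R) : unif_cont phi -> unif_cont (fun x => - phi x).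
Proof.
by move=> uc e /uc[k ok]; exists k => x y xy; rewrite -opprD normrN; exact: ok.
Qed.

Lemma ev_lim (F : set_system nat) {FF : ProperFilter F} (Q : nat -> seq A -> R) q phi k :
  (forall w, Q^~ w @ F --> q w) -> (fun i => ev pt (Q i) phi k) @ F --> ev pt q phi k.
Proof.
by move=> Qq; apply: cvg_sumr => w _; apply: cvgM; [exact: Qq | exact: cvg_cst].
Qed.

Variable phi : (nat -> A) -> R.
Hypothesis uc : unif_cont phi.

(** Weights with integrals approaching the bound have a limit weight, and integration of a uniformly
    continuous function passes to the limit. *)
Lemma integ_le_attained alpha :
  (forall e, 0 < e -> exists q I, [/\ inv_weight q, integ pt q phi I & I < alpha + e]) ->
  exists q I, [/\ inv_weight q, integ pt q phi I & I <= alpha].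
Proof.
move=> H.
have /choice[Q /choice[I QP]] : forall n : nat, exists q I,
    [/\ inv_weight q, integ pt q phi I & I < alpha + n.+1%:R^-1].
  by move=> n; apply: H; rewrite invr_gt0.
have [F [q [FF oF Qq qi]]] := inv_weight_compact (fun n => let: And3 h _ _ := QP n in h).
have qw : weight q := qi.
have [J qJ] := integ_ex pt qw uc.
exists q, J; split => //; apply/ler_addgt0Pr.
suff H2 (e : R) : 0 < e -> J <= alpha + e by [].
move=> e0; have e3 : 0 < e / 3 by rewrite divr_gt0.
have [k ok] := uc e3.
have h1 := integ_osc qw qJ ok.
have h2 : ev pt q phi k <= alpha + e / 3 + e / 3.
  have c := @ev_lim F FF Q q phi k Qq.
  apply: (cvgr_to_le c); have : \forall n \near F, n.+1%:R^-1 <= e / 3 :> R.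
    apply: oF; exists (Num.truncn (e / 3)^-1) => // n /= h.
    rewrite -[e / 3]invrK lef_pV2 ?posrE ?invr_gt0//.
    by apply: (le_trans (ltW (truncnS_gt _))); rewrite ler_nat.
  apply: filterS => n h; case: (QP n) => Qi QI Il; have Qw : weight (Q n) := Qi.
  have := integ_osc Qw QI ok; rewrite ler_norml => /andP[_ h3]; move: h Il; move: (n.+1%:R^-1) => z h Il; lra.
move: h1; rewrite ler_norml => /andP[h3 h4]; lra.
Qed.

Lemma integ_between q0 q1 I0 I1 alpha : inv_weight q0 -> inv_weight q1 ->
  integ pt q0 phi I0 -> integ pt q1 phi I1 -> I0 <= alpha -> alpha <= I1 ->
  exists q, inv_weight q /\ integ pt q phi alpha.
Proof.
move=> i0 i1 h0 h1 a0 a1; have [E|ne] := eqVneq I0 I1.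
  exists q0; split => //; suff -> : alpha = I0 by [].
  by apply/eqP; rewrite eq_le a0 E a1.
have lt01 : I0 < I1 by rewrite lt_neqAle ne (le_trans a0).
have d0 : 0 < I1 - I0 by rewrite subr_gt0.
pose t := (alpha - I0) / (I1 - I0).
have t0 : 0 <= t by rewrite divr_ge0 ?subr_ge0// ltW.
have t1 : t <= 1 by rewrite ler_pdivrMr// mul1r lerD2r.
exists (mix q0 q1 t); split; first exact: mix_inv_weight.
suff -> : alpha = (1 - t) * I0 + t * I1 by exact: integ_mix.
have tE : t * (I1 - I0) = alpha - I0 by rewrite /t divfK// gt_eqF.
by move: tE; rewrite mulrBr mulrBl; lra.
Qed.

(** Entropies shrink by at most the factor [1 - t], while an exponent grows by at most the factor
    [1 + t * l1 / l0]. *)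
Lemma Dim_mix_ge q0 q1 t : 0 <= t -> t < 1 -> inv_weight q0 -> inv_weight q1 ->
  (1 - t * (1 + l1 / l0)) * Dim p la lb q0 <= Dim p la lb (mix q0 q1 t).
Proof.
move=> t0 t1 i0 i1; apply: le_trans (Dim_mix p l00 la_bd lb_bd t0 t1 i0 i1).
have w0 : weight q0 := i0; have w1 : weight q1 := i1.
have lb_bd' a : l0 <= (lb \o p) a <= l1 by exact: lb_bd.
have [_ rh0 _] := relh_spec p i0; have [_ hv0 _] := hent_spec (marg_inv_weight p i0).
have part z c c' : 0 <= z -> l0 <= c -> c' <= l1 -> 0 <= c' ->
    (1 - t * (1 + l1 / l0)) * (z / c) <= (1 - t) * z / ((1 - t) * c + t * c').
  move=> z0 lc cl c'0; have c0 : 0 < c by exact: lt_le_trans lc.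
  have s1 : 0 < 1 - t by rewrite subr_gt0.
  have m0 : 0 < (1 - t) * c + t * c' by rewrite ltr_pwDl ?mulr_gt0// mulr_ge0.
  set K := l1 / l0; have K0 : 0 <= K by rewrite divr_ge0// ?(ltW l00)// (le_trans c'0).
  rewrite ler_pdivlMr// mulrA mulrAC ler_pdivrMr//.
  have h1 : c' <= K * c.
    apply: (le_trans cl); rewrite /K -[leLHS](divfK (lt0r_neq0 l00)) ler_wpM2l//.
  have [neg|pos] := leP (1 - t * (1 + K)) 0.
    apply: (@le_trans _ _ 0); last by rewrite mulr_ge0 ?(ltW c0)// mulr_ge0// ltW.
    by rewrite -mulrA mulr_le0_ge0// mulr_ge0// ltW.
  have h2 : (1 - t) * c + t * c' <= (1 + t * K) * c.
    have : t * c' <= t * (K * c) by rewrite ler_wpM2l.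
    have : 0 <= t * c by rewrite mulr_ge0// ltW.
    by rewrite mulrBl mulrDl mul1r; lra.
  apply: (@le_trans _ _ ((1 - t * (1 + K)) * z * ((1 + t * K) * c))).
    by rewrite ler_wpM2l// mulr_ge0// ltW.
  have -> : (1 - t * (1 + K)) * z * ((1 + t * K) * c) = (z * c) * ((1 - t * (1 + K)) * (1 + t * K)) by ring.
  have -> : (1 - t) * z * c = (z * c) * (1 - t) by ring.
  rewrite ler_wpM2l ?mulr_ge0 ?(ltW c0)//.
  clearbody K; have K1 : 0 <= 1 + K by rewrite addr_ge0.
  (* The product [(1 - t * (1 + K)) * (1 + t * K)] equals [1 - t - t * t * K * (1 + K)]. *)
  have : 0 <= t * t * K * (1 + K) by rewrite !mulr_ge0.
  lra.
have /andP[a1 a2] := lyap_w_bounds w0 la_bd; have /andP[b1 b2] := lyap_w_bounds w1 la_bd.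
have /andP[a3 a4] := lyap_w_bounds w0 lb_bd'; have /andP[b3 b4] := lyap_w_bounds w1 lb_bd'.
rewrite {1}/Dim mulrDr lerD// part// ?(le_trans (ltW l00))//.
Qed.

Variable g : R -> R.
Variable K : set R.
Hypothesis g_ub : forall alpha q, K alpha -> inv_weight q -> integ pt q phi alpha -> Dim p la lb q <= g alpha.
Hypothesis g_sup : forall alpha e, K alpha -> 0 < e ->
  exists q, [/\ inv_weight q, integ pt q phi alpha & g alpha - e < Dim p la lb q].

Lemma spectrum_usc alpha e : K alpha -> 0 < e -> exists2 dl, 0 < dl &
  forall beta, K beta -> `|beta - alpha| < dl -> g beta < g alpha + e.
Proof.
move=> Ka e0; apply: contrapT => H.
have /choice[b bP] : forall n : nat, exists beta, [/\ K beta, `|beta - alpha| < n.+1%:R^-1 & g alpha + e <= g beta].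
  move=> n; apply: contrapT => /forallNP nb; apply: H; exists n.+1%:R^-1; first by rewrite invr_gt0.
  by move=> beta Kb hb; rewrite ltNge; apply/negP => h; apply: (nb beta).
have e2 : 0 < e / 2 by rewrite divr_gt0.
have /choice[Q QP] : forall n, exists q, [/\ inv_weight q, integ pt q phi (b n) & g (b n) - e / 2 < Dim p la lb q].
  by move=> n; apply: g_sup => //; case: (bP n).
have Qi n : inv_weight (Q n) by case: (QP n).
have [F [q [FF oF Qq qi]]] := inv_weight_compact Qi.
have Qw n : weight (Q n) := Qi n.
have bF d : 0 < d -> \forall n \near F, `|b n - alpha| <= d.
  move=> d0; apply: oF; exists (Num.truncn d^-1) => // n /= h.
  case: (bP n) => _ hb _; rewrite (le_trans (ltW hb))// -[d]invrK lef_pV2 ?posrE ?invr_gt0//.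
  by apply: (le_trans (ltW (truncnS_gt _))); rewrite ler_nat.
have qI : integ pt q phi alpha.
  apply: (integ_lim Qw Qq uc) => k d d0 ok d' d'0.
  apply: filterS (bF _ d'0) => n h; case: (QP n) => _ hI _.
  have -> : ev pt (Q n) phi k - alpha = (ev pt (Q n) phi k - b n) + (b n - alpha) by lra.
  by rewrite (le_trans (ler_normD _ _))// lerD// (integ_osc (Qw n) hI ok).
have : g alpha + e / 2 <= Dim p la lb q.
  apply: (Dim_lim_ge l00 la_bd lb_bd Qw Qq oF Qi qi) => n.
  have k0 : (0 < 2 ^ n)%N by rewrite expn_gt0.
  apply: le_trans (Dim_le_Dk _ l00 la_bd lb_bd (Qi n) k0).
  case: (QP n) => _ _ h; case: (bP n) => _ _ h2; lra.
have := g_ub Ka qi qI; lra.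
Qed.

(** A nearly optimal weight at [alpha] is mixed with some weight at [beta1]; the integral moves
    linearly towards [beta1] while [Dim] drops by at most a constant times [t]. *)
Lemma spectrum_lsc_toward alpha beta1 e : K alpha -> K beta1 -> beta1 != alpha -> 0 < e ->
  exists2 dl, 0 < dl & forall beta, K beta -> 0 <= (beta - alpha) / (beta1 - alpha) ->
    `|beta - alpha| < dl -> g alpha - e < g beta.
Proof.
move=> Ka Kb ne e0; have e2 : 0 < e / 2 by rewrite divr_gt0.
have [q0 [i0 h0 D0]] := g_sup Ka e2; have [q1 [i1 h1 _]] := g_sup Kb e2.
set D := Dim p la lb q0 in D0.
have Dge : 0 <= D by exact: (Dim_ge0 p l00 la_bd lb_bd i0).
have d0 : 0 < `|beta1 - alpha| by rewrite normr_gt0 subr_eq0.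
pose C := (1 + l1 / l0) * (D + 1).
have l10 : 0 <= l1 by have /andP[h1' h2'] := la_bd pt; exact: le_trans (ltW l00) (le_trans h1' h2').
have C0 : 0 < C.
  by apply: mulr_gt0; [apply: ltr_pwDl => //; rewrite divr_ge0// ltW | apply: ltr_wpDl].
pose t0 := Num.min 1 (e / 2 / C).
have t00 : 0 < t0 by rewrite lt_min ltr01 divr_gt0.
exists (t0 * `|beta1 - alpha|); first by rewrite mulr_gt0.
move=> beta Kbeta t_ge hb; pose t := (beta - alpha) / (beta1 - alpha).
have tE : t = `|beta - alpha| / `|beta1 - alpha| by rewrite -normf_div ger0_norm.
have tge : 0 <= t by exact: t_ge.
have tlt : t < t0 by rewrite tE ltr_pdivrMr.
have t1 : t < 1 by rewrite (lt_le_trans tlt)// ge_min lexx.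
have iI : integ pt (mix q0 q1 t) phi beta.
  suff -> : beta = (1 - t) * alpha + t * beta1 by exact: integ_mix.
  have : t * (beta1 - alpha) = beta - alpha by rewrite /t divfK// subr_eq0.
  by rewrite mulrBr mulrBl; lra.
have := g_ub Kbeta (mix_inv_weight tge (ltW t1) i0 i1) iI.
have := Dim_mix_ge tge t1 i0 i1; rewrite -/D.
have : t * C <= e / 2.
  by rewrite -ler_pdivlMr// (le_trans (ltW tlt))// ge_min lexx orbT.
have : 0 <= t * (1 + l1 / l0) by rewrite mulr_ge0// addr_ge0// divr_ge0// ltW.
rewrite /C; move: (1 + l1 / l0) => k h2 h3 h4 h5.
move: h3 h4 h5; move: (Dim p la lb (mix q0 q1 t)) => D'; rewrite mulrBl mulrA mulrDr; lra.
Qed.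

Lemma spectrum_lsc alpha e : K alpha -> 0 < e -> exists2 dl, 0 < dl &
  forall beta, K beta -> `|beta - alpha| < dl -> g alpha - e < g beta.
Proof.
move=> Ka e0.
(* The sign of [s] selects a side of [alpha]. If [K] has no point strictly on that side, only
   [beta = alpha] remains. *)
have side (s : R) : s != 0 -> exists2 dl, 0 < dl & forall beta, K beta -> 0 <= (beta - alpha) * s ->
    `|beta - alpha| < dl -> g alpha - e < g beta.
  move=> s0; have [[b1 [Kb1 b1s]]|nb] := pselect (exists b1, K b1 /\ 0 < (b1 - alpha) * s); last first.
    exists 1 => // beta Kb bs _; have : (beta - alpha) * s = 0.
      by apply/eqP; rewrite eq_le bs andbT leNgt; apply/negP => h; apply: nb; exists beta.
    move=> /eqP; rewrite mulf_eq0 (negbTE s0) orbF subr_eq0 => /eqP ->.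
    by rewrite ltrBlDr ltrDl.
  have ne : b1 != alpha by apply/eqP => E; move: b1s; rewrite E subrr mul0r ltxx.
  have [dl dl0 H] := spectrum_lsc_toward Ka Kb1 ne e0; exists dl => // beta Kb bs; apply: H => //.
  have -> : (beta - alpha) / (b1 - alpha) = ((beta - alpha) * s) / ((b1 - alpha) * s).
    by field; rewrite s0 subr_eq0.
  by rewrite divr_ge0// ltW.
have [d1 d10 H1] := side 1 (oner_neq0 _).
have [d2 d20 H2] : exists2 dl, 0 < dl & forall beta, K beta -> 0 <= (beta - alpha) * -1 ->
    `|beta - alpha| < dl -> g alpha - e < g beta by apply: side; rewrite oppr_eq0 oner_neq0.
exists (Num.min d1 d2); first by rewrite lt_min d10.
move=> beta Kb; rewrite lt_min => /andP[h1 h2].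
have [h|/ltW h] := leP alpha beta; first by apply: H1 => //; rewrite mulr1 subr_ge0.
by apply: H2 => //; rewrite mulrN1 opprB subr_ge0.
Qed.

End Spectrum.

Lemma integ_exists {R : realType} {A : finType} (pt : A) (phi : (nat -> A) -> R) alpha : unif_cont phi ->
  (forall e, 0 < e -> exists q I, [/\ inv_weight q, integ pt q phi I & I < alpha + e]) ->
  (forall e, 0 < e -> exists q I, [/\ inv_weight q, integ pt q phi I & alpha - e < I]) ->
  exists q, inv_weight q /\ integ pt q phi alpha.
Proof.
move=> uc /(integ_le_attained uc)[q0 [I0 [i0 h0 a0]]] H.
have /(integ_le_attained (unif_cont_opp uc))[q1 [I1 [i1 h1 a1]]] : forall e, 0 < e ->
    exists q I, [/\ inv_weight q, integ pt q (fun x => - phi x) I & I < - alpha + e].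
  move=> e /H[q [I [qi qI h]]]; exists q, (- I); split => //; first exact: integ_opp.
  by rewrite ltrNl opprD opprK.
have h1' : integ pt q1 phi (- I1).
  have := integ_opp h1; rewrite (_ : (fun x => - - phi x) = phi)//.
  by apply/funext => x; rewrite opprK.
by apply: (integ_between i0 i1 h0 h1' a0); rewrite lerNr.
Qed.

(** * Lalley-Gatzouras carpets *)

Section AffineCodings.
Context {R : realType} {C : Type} (r s : C -> R).
Hypothesis r_gt0 : forall c, 0 < r c.
Hypothesis s_ge0 : forall c, 0 <= s c.
Hypothesis sr_le1 : forall c, s c + r c <= 1.
Implicit Types (x y : nat -> C).

(** In one coordinate, the composition of the first [n] maps along [x] sends [z] to
    [scale x n * z + corner x n]. *)
Definition scale x n : R := \prod_(i < n) r (x i).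
Definition corner x n : R := \sum_(k < n) scale x k * s (x k).

Lemma scaleS x n : scale x n.+1 = scale x n * r (x n).
Proof. by rewrite /scale big_ord_recr. Qed.

Lemma cornerS x n : corner x n.+1 = corner x n + scale x n * s (x n).
Proof. by rewrite /corner big_ord_recr. Qed.

Lemma scale_gt0 x n : 0 < scale x n.
Proof. by apply: prodr_gt0. Qed.

Lemma corner_mono x n m : (n <= m)%N -> corner x n <= corner x m.
Proof.
move/subnKC <-; elim: (m - n)%N => [|d IH]; first by rewrite addn0.
by rewrite addnS cornerS (le_trans IH)// lerDl mulr_ge0// ltW// scale_gt0.
Qed.

Lemma end_mono x n m : (n <= m)%N -> corner x m + scale x m <= corner x n + scale x n.
Proof.
move/subnKC <-; elim: (m - n)%N => [|d IH]; first by rewrite addn0.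
rewrite addnS cornerS scaleS (le_trans _ IH)// -addrA lerD2l -mulrDr.
by rewrite ler_piMr// ltW// scale_gt0.
Qed.

Lemma scale_eq x y n : (forall i, (i < n)%N -> x i = y i) -> scale x n = scale y n.
Proof. by move=> xy; apply: eq_bigr => i _; rewrite xy. Qed.

Lemma corner_eq x y n : (forall i, (i < n)%N -> x i = y i) -> corner x n = corner y n.
Proof.
move=> xy; apply: eq_bigr => k _; rewrite xy// (@scale_eq x y)// => i ik.
by rewrite xy// (ltn_trans ik).
Qed.

(** The intervals of generation [j.+1] are ordered and disjoint; later ones are nested in them, so
    the gap between left ends is at least the length of the left interval. *)
Lemma corner_sep x y j n n' : (j < n)%N -> (j < n')%N -> (forall i, (i < j)%N -> x i = y i) ->
  s (x j) + r (x j) <= s (y j) -> scale x n <= `|corner x n - corner y n'|.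
Proof.
move=> jn jn' xy h; have h1 := end_mono x jn; have h2 := corner_mono y jn'.
suff : corner x j.+1 + scale x j.+1 <= corner y j.+1.
  by move=> h3; rewrite distrC; apply: le_trans (ler_norm _); lra.
rewrite !cornerS scaleS (corner_eq xy) (scale_eq xy) -addrA lerD2l -mulrDr.
by rewrite ler_wpM2l// ltW// scale_gt0.
Qed.

Definition limit_point x : R := sup (range (corner x)).

Lemma limit_point_itv x n : corner x n <= limit_point x <= corner x n + scale x n.
Proof.
have ub : ubound (range (corner x)) (corner x n + scale x n).
  move=> _ [k _ <-]; have [h|/ltnW h] := leqP n k.
    by apply: le_trans (end_mono x h); rewrite lerDl ltW// scale_gt0.
  by rewrite (le_trans (corner_mono x h))// lerDl ltW// scale_gt0.
have ne : (range (corner x)) !=set0 by exists (corner x n), n.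
apply/andP; split; last exact: ge_sup.
by apply: ub_le_sup; [exists (corner x n + scale x n) | exists n].
Qed.

End AffineCodings.

Section Carpet.
Context {R : realType} {p : nat} {m : 'I_p.+1 -> nat}.
Variables (a c : LGdigit m -> R) (b d : 'I_p.+1 -> R).
Hypothesis hyp : LG_hyp a c b d.

Lemma digit_bounds (ij : LGdigit m) :
  [/\ 0 < a ij, a ij <= b (tag ij), b (tag ij) < 1, 0 <= c ij & 0 <= d (tag ij)].
Proof.
case: hyp => h1 [h2 [h3 _]]; have /andP[a0 ab] := (h3 ij).1; have b1 := (h3 ij).2.
have /andP[c0 _] := (h1 ij).2; have /andP[d0 _] := (h2 (tag ij)).2; by split.
Qed.

Lemma row_gt0 i : 0 < b i.
Proof.
have [a0 ab _ _ _] := digit_bounds (@Tagged _ i (fun i => 'I_(m i).+1) ord0).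
exact: lt_le_trans ab.
Qed.

Lemma row_lt1 i : b i < 1.
Proof. by have [_ _ h _ _] := digit_bounds (@Tagged _ i (fun i => 'I_(m i).+1) ord0). Qed.

Lemma row_ge0 i : 0 <= d i.
Proof. by have [_ _ _ _ h] := digit_bounds (@Tagged _ i (fun i => 'I_(m i).+1) ord0). Qed.

Lemma row_sep (i i' : 'I_p.+1) : (i < i')%N -> d i + b i <= d i'.
Proof.
move=> ii'; case: hyp => _ [_ [_ [h4 [_ [h6 _]]]]].
have i1 : (i.+1 < p.+1)%N by exact: leq_ltn_trans (ltn_ord i').
have := h6 i (Ordinal i1) erefl; have := h4 (Ordinal i1) i' ii'; lra.
Qed.

Lemma row_le1 i : d i + b i <= 1.
Proof.
case: hyp => _ [_ [_ [_ [h5 [_ [h7 _]]]]]].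
have [lt|ge] := ltnP i p; first by apply: (le_trans (@row_sep i ord_max lt)); exact: ltW.
have -> : i = ord_max by apply/val_inj/eqP; rewrite eqn_leq ge -ltnS ltn_ord.
by rewrite addrC.
Qed.

Lemma col_sep i (j j' : 'I_(m i).+1) : (j < j')%N ->
  c (Tagged (fun i => 'I_(m i).+1) j) + a (Tagged (fun i => 'I_(m i).+1) j) <= c (Tagged (fun i => 'I_(m i).+1) j').
Proof.
move=> jj'; case: hyp => _ [_ [_ [_ [_ [_ [_ /(_ i)[h1 [_ [h3 _]]]]]]]]].
have j1 : (j.+1 < (m i).+1)%N by exact: leq_ltn_trans (ltn_ord j').
have := h3 j (Ordinal j1) erefl; have := h1 (Ordinal j1) j' jj'; lra.
Qed.

Lemma col_le1 (ij : LGdigit m) : c ij + a ij <= 1.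
Proof.
case: ij => i j; case: hyp => _ [_ [_ [_ [_ [_ [_ /(_ i)[_ [h2 [_ h4]]]]]]]]].
have [lt|ge] := ltnP j (m i).
  by apply: (le_trans (@col_sep i j ord_max lt)); exact: ltW.
have -> : j = ord_max by apply/val_inj/eqP; rewrite eqn_leq ge -ltnS ltn_ord.
by rewrite addrC.
Qed.

Let a_gt0 (ij : LGdigit m) : 0 < a ij. Proof. by case: (digit_bounds ij). Qed.
Let c_ge0 (ij : LGdigit m) : 0 <= c ij. Proof. by case: (digit_bounds ij). Qed.

Definition rows (w : nat -> LGdigit m) : nat -> 'I_p.+1 := fun k => tag (w k).

Lemma ScompE (w : Sigma) n z : Scomp a c b d w n z =
  (scale a w n * z.1 + corner a c w n, scale b (rows w) n * z.2 + corner b d (rows w) n).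
Proof.
elim: n z => [|n IH] z.
  by rewrite /= /scale /corner !big_ord0 !mul1r !addr0; case: z.
rewrite [LHS]/= IH /Smap /= !scaleS !cornerS /rows.
by congr (_, _); ring.
Qed.

(** The limit points of the corners belong to all the rectangles, so [xget] returns a point of the
    intersection and not its default. *)
Lemma Pi_rect (w : Sigma) n :
  (corner a c w n <= (Pi a c b d w).1 <= corner a c w n + scale a w n) /\
  (corner b d (rows w) n <= (Pi a c b d w).2 <= corner b d (rows w) n + scale b (rows w) n).
Proof.
have ex : [set z | forall n, z \in Scomp a c b d w n @` unit_square] (Pi a c b d w).
  apply: xgetPex; exists (limit_point a c w, limit_point b d (rows w)) => k; apply/mem_set.
  have /andP[x1 x2] := limit_point_itv a_gt0 c_ge0 col_le1 w k.
  have /andP[y1 y2] := limit_point_itv row_gt0 row_ge0 row_le1 (rows w) k.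
  have ax := scale_gt0 a_gt0 w k; have bx := scale_gt0 row_gt0 (rows w) k.
  exists ((limit_point a c w - corner a c w k) / scale a w k,
          (limit_point b d (rows w) - corner b d (rows w) k) / scale b (rows w) k).
    split => /=; rewrite divr_ge0 ?subr_ge0 ?(ltW ax) ?(ltW bx)//= ler_pdivrMr// mul1r lerBlDl//.
  by rewrite ScompE /= !(mulrC (scale _ _ _)) !divfK ?gt_eqF// !subrK.
have /set_mem[u [/andP[u0 u1] /andP[v0 v1]] <-] := ex n.
have ax := scale_gt0 a_gt0 w n; have bx := scale_gt0 row_gt0 (rows w) n.
rewrite ScompE /=; split; rewrite addrC lerDl lerD2l.
  by rewrite mulr_ge0 ?(ltW ax)//= ler_piMr// ltW.
by rewrite mulr_ge0 ?(ltW bx)//= ler_piMr// ltW.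
Qed.

Definition la (ij : LGdigit m) : R := - ln (a ij).
Definition lb (i : 'I_p.+1) : R := - ln (b i).

Lemma scale_la (w : nat -> LGdigit m) n : scale a w n = expR (- \sum_(i < n) la (w i)).
Proof.
rewrite -sumrN expR_sum; apply: eq_bigr => i _.
by rewrite /la opprK lnK// posrE a_gt0.
Qed.

Lemma scale_lb (v : nat -> 'I_p.+1) n : scale b v n = expR (- \sum_(i < n) lb (v i)).
Proof.
rewrite -sumrN expR_sum; apply: eq_bigr => i _.
by rewrite /lb opprK lnK// posrE row_gt0.
Qed.

Lemma lb_gt0 i : 0 < lb i.
Proof. by rewrite /lb oppr_gt0 ln_lt0// row_gt0 row_lt1. Qed.

Lemma lb_le_la (ij : LGdigit m) : lb (tag ij) <= la ij.
Proof.
by rewrite /lb /la lerN2 ler_ln ?posrE ?row_gt0//; case: (digit_bounds ij).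
Qed.

Lemma log_bounds : exists l0 l1 : R, [/\ 0 < l0, forall ij, l0 <= la ij <= l1 & forall i, l0 <= lb i <= l1].
Proof.
pose S := \sum_i (lb i)^-1.
have S0 : 0 <= S by apply: sumr_ge0 => i _; rewrite invr_ge0 ltW// lb_gt0.
have la0 ij : 0 < la ij by exact: lt_le_trans (lb_gt0 _) (lb_le_la ij).
have lb1 i : (1 + S)^-1 <= lb i.
  rewrite -[lb i]invrK lef_pV2 ?posrE ?invr_gt0 ?lb_gt0 ?ltr_pwDl//.
  rewrite /S (bigD1 i)//= addrCA lerDl addr_ge0// sumr_ge0// => j _.
  by rewrite invr_ge0 ltW// lb_gt0.
(* Sums replace the extrema: [1 + S] exceeds every inverse of a [lb i], and the total sum exceeds
   every single term. *)
exists (1 + S)^-1, (\sum_ij la ij + \sum_i lb i); split.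
- by rewrite invr_gt0 ltr_pwDl.
- move=> ij; rewrite (le_trans (lb1 (tag ij)) (lb_le_la ij))/= (bigD1 ij)//= -addrA lerDl.
  by rewrite addr_ge0// sumr_ge0// => *; rewrite ltW// lb_gt0.
- move=> i; rewrite lb1/= [X in _ + X](bigD1 i)//= addrCA lerDl.
  by rewrite addr_ge0// sumr_ge0// => *; rewrite ltW// lb_gt0.
Qed.

Lemma Pi_near_x (w : Sigma) n : `|(Pi a c b d w).1 - corner a c w n| <= expR (- \sum_(i < n) la (w i)).
Proof.
have [/andP[h1 h2] _] := Pi_rect w n.
by rewrite -scale_la ger0_norm ?subr_ge0// lerBlDl.
Qed.

Lemma Pi_near_y (w : Sigma) n :
  `|(Pi a c b d w).2 - corner b d (rows w) n| <= expR (- \sum_(i < n) lb (tag (w i))).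
Proof.
have [_ /andP[h1 h2]] := Pi_rect w n.
by rewrite -(scale_lb (rows w)) ger0_norm ?subr_ge0// lerBlDl.
Qed.

Lemma norm_rect (u v k s : R) : k <= u <= k + s -> k <= v <= k + s -> `|u - v| <= s.
Proof. by rewrite ler_norml => /andP[? ?] /andP[? ?]; apply/andP; split; lra. Qed.

Lemma Pi_prefix_x n (w w' : Sigma) : mkseq w n = mkseq w' n ->
  `|(Pi a c b d w).1 - (Pi a c b d w').1| <= expR (- \sum_(i < n) la (w i)).
Proof.
move=> /eq_in_map e.
have ww i : (i < n)%N -> w i = w' i by move=> h; apply: e; rewrite mem_iota.
have [h1 _] := Pi_rect w n; have [h2 _] := Pi_rect w' n.
rewrite -(corner_eq _ _ ww) -(scale_eq _ ww) in h2.
by rewrite -scale_la; exact: norm_rect h1 h2.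
Qed.

Lemma Pi_prefix_y n (w w' : Sigma) : mkseq (rows w) n = mkseq (rows w') n ->
  `|(Pi a c b d w).2 - (Pi a c b d w').2| <= expR (- \sum_(i < n) lb (tag (w i))).
Proof.
move=> /eq_in_map e.
have ww i : (i < n)%N -> rows w i = rows w' i by move=> h; apply: e; rewrite mem_iota.
have [_ h1] := Pi_rect w n; have [_ h2] := Pi_rect w' n.
rewrite -(corner_eq _ _ ww) -(scale_eq _ ww) in h2.
by rewrite -(scale_lb (rows w)); exact: norm_rect h1 h2.
Qed.

(** Columns of one row are ordered and disjoint; the sequence whose digit lies further left decides
    which alternative holds. *)
Lemma corner_sep_x (x y : nat -> LGdigit m) n n' j : (j < n)%N -> (j < n')%N ->
  (forall i, (i < j)%N -> x i = y i) -> tag (x j) = tag (y j) -> x j <> y j ->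
  expR (- \sum_(i < n) la (x i)) <= `|corner a c x n - corner a c y n'| \/
  expR (- \sum_(i < n') la (y i)) <= `|corner a c x n - corner a c y n'|.
Proof.
move=> jn jn' xy t ne; rewrite -!scale_la.
have : c (x j) + a (x j) <= c (y j) \/ c (y j) + a (y j) <= c (x j).
  move: t ne; case: (x j) => i k; case: (y j) => i' k' /= E; case: i' / E k' => k' ne.
  have [h|h|h] := ltngtP k k'; [left|right|]; try exact: col_sep.
  by case: ne; congr existT; exact: val_inj.
case=> h; first by left; exact: (corner_sep a_gt0 c_ge0 col_le1 jn jn' xy h).
right; rewrite distrC; apply: (corner_sep a_gt0 c_ge0 col_le1 jn' jn _ h) => i ij.
by rewrite xy.
Qed.

Lemma corner_sep_y (x y : nat -> LGdigit m) n n' j : (j < n)%N -> (j < n')%N ->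
  (forall i, (i < j)%N -> tag (x i) = tag (y i)) -> tag (x j) <> tag (y j) ->
  expR (- \sum_(i < n) lb (tag (x i))) <= `|corner b d (rows x) n - corner b d (rows y) n'| \/
  expR (- \sum_(i < n') lb (tag (y i))) <= `|corner b d (rows x) n - corner b d (rows y) n'|.
Proof.
move=> jn jn' xy ne; rewrite -(scale_lb (rows x)) -(scale_lb (rows y)).
have [h|h|h] := ltngtP (tag (x j)) (tag (y j)); last by case: ne; exact: val_inj.
  by left; apply: (corner_sep row_gt0 row_ge0 row_le1 jn jn' xy); exact: row_sep.
right; rewrite distrC; apply: (corner_sep row_gt0 row_ge0 row_le1 jn' jn).
  by move=> i ij; rewrite /rows xy.
exact: row_sep.
Qed.

End Carpet.

HB.instance Definition _ (p : nat) (m : 'I_p.+1 -> nat) :=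
  Finite.copy (LGdigit m) {i : 'I_p.+1 & 'I_(m i).+1}.
HB.instance Definition _ (p : nat) := Finite.copy (vrow p) 'I_p.+1.

(** * From measures on the carpet to weights *)

Section LedrappierYoung.
Context {R : realType} {p : nat} {m : 'I_p.+1 -> nat}.
Variables (a c : LGdigit m -> R) (b d : 'I_p.+1 -> R).
Hypothesis hyp : LG_hyp a c b d.

Definition row_of (ij : LGdigit m) : vrow p := tag ij.

Notation slaw mu := (@shift_law R (LGdigit m : pointedFinType) mu).

Lemma measurable_piv : measurable_fun setT (@piv p m).
Proof.
apply: (@measurability _ _ _ (Sigma_v (p := p)) setT (@piv p m) (@cylinders (vrow p))) => //.
move=> _ [_ [n [w ->]] <-]; rewrite setTI.
rewrite (_ : _ @^-1` _ = cyl n (fun u : seq (LGdigit m : pointedFinType) => map row_of u == mkseq w n)).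
  exact: measurable_cyl.
apply/seteqP; split => x /=.
  move=> xw; rewrite /cyl /= /pfx /mkseq -map_comp; apply/eqP/eq_in_map => i.
  by rewrite mem_iota /= add0n => /xw.
rewrite /cyl /= /pfx /mkseq -map_comp => /eqP/eq_in_map xw k kn.
by have := xw k; rewrite mem_iota add0n => /(_ kn).
Qed.

(** The generator theorem is applied on the row shift to the image of [mu], whose cylinder weights
    are the row marginals. *)
Lemma ent_vE (mu : probability (@Sigma p m) R) : is_invariant mu sshift ->
  ent_v mu 1 = hent (marg row_of (slaw mu)).
Proof.
move=> inv; pose nu := push_probability mu measurable_piv.
have nuE (B : set (@Sigma_v p)) : nu B = mu (@piv p m @^-1` B) by [].
have inu : is_invariant nu sshift.
  move=> B mB; rewrite !nuE.
  have mB' : measurable (@piv p m @^-1` B) by rewrite -[X in measurable X]setTI; exact: measurable_piv.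
  by rewrite -(inv _ mB').
rewrite (_ : marg row_of (slaw mu) = shift_law (A := vrow p) nu); last first.
  apply/funext => z; rewrite /shift_law /law /pr nuE itinE.
  rewrite (_ : _ @^-1` _ = cyl (size z) (fun u : seq (LGdigit m : pointedFinType) => map row_of u == z)).
    by rewrite -/(pr mu _) pr_cyl.
  by apply/seteqP; split => x /=; rewrite /cyl /= /pfx /mkseq -map_comp => /eqP.
by rewrite -(ks_entropy_shift inu).
Qed.

Lemma entE (mu : probability (@Sigma p m) R) : is_invariant mu sshift ->
  ent mu 1 = hent (slaw mu).
Proof. by move=> inv; rewrite -(ks_entropy_shift inv). Qed.

Lemma lyap_letter (mu : probability (@Sigma p m) R) (f : LGdigit m -> R) : is_invariant mu sshift ->
  - fine (\int[mu]_w (ln (\prod_(k < 1) f (w k)))%:E)%E = lyap_w (fun ij => - ln (f ij)) (slaw mu).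
Proof.
move=> inv; have qw : weight (slaw mu) := shift_law_inv_weight inv.
under eq_integral do rewrite big_ord1.
rewrite (integral_integ _ (@letter_integ R _ point (fun ij => ln (f ij)) _ qw))/=.
  by rewrite /lyap_w -sumrN; apply: eq_bigr => ij _; rewrite mulrN.
exact: (letter_unif_cont (fun ij => ln (f ij))).
Qed.

(** Substituting the chain rule [h = relh + hv] cancels the row entropy divided by the larger
    exponent. *)
Lemma DLY_Dim (mu : probability (@Sigma p m) R) : is_invariant mu sshift ->
  DLY a b mu = Dim row_of (la a) (lb b : vrow p -> R) (slaw mu).
Proof.
move=> inv; rewrite /DLY /DLYn entE// ent_vE// /lyap /lyap_v.
rewrite (lyap_letter a inv) (lyap_letter (fun ij => b (tag ij)) inv) /Dim.
by rewrite (hent_chain row_of (shift_law_inv_weight inv)) mulrDl mulrBl; lra.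
Qed.

Lemma iter_sshift (w : @Sigma p m) l : iter l sshift w = (fun i => w (l + i)%N).
Proof. by elim: l => //= l ->; apply/funext => i; rewrite /sshift addSnnS. Qed.

Lemma Lambda_levelE (phi : @Sigma p m -> R) alpha :
  Lambda_level a c b d phi alpha = Pi a c b d @` [set x | level phi alpha x].
Proof.
rewrite /Lambda_level; congr (_ @` _); apply/seteqP; split => x /=; rewrite /level.
  by under [X in X @ _ --> _ -> _]eq_fun => n do under eq_bigr do rewrite iter_sshift.
by under [X in _ -> X @ _ --> _]eq_fun => n do under eq_bigr do rewrite iter_sshift.
Qed.

Variable phi : @Sigma p m -> R.
Hypothesis sc : seq_continuous phi.

Let uc : unif_cont (phi : (nat -> (LGdigit m : pointedFinType)) -> R).
Proof. by apply: seq_continuous_unif => //; exact: sc. Qed.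

Definition in_class alpha q := inv_weight q /\ integ (point : LGdigit m) q phi alpha.

Lemma measure_in_class (mu : probability (@Sigma p m) R) : is_invariant mu sshift ->
  exists2 I, (\int[mu]_w (phi w)%:E)%E = I%:E & in_class I (slaw mu).
Proof.
move=> inv; have qi := shift_law_inv_weight inv; have qw : weight (slaw mu) := qi.
by have [I qI] := integ_ex point qw uc; exists I; rewrite ?(integral_integ uc qI).
Qed.

Lemma class_measure alpha q : in_class alpha q -> exists mu : probability (@Sigma p m) R,
  [/\ is_invariant mu sshift, (\int[mu]_w (phi w)%:E)%E = alpha%:E & slaw mu = q].
Proof.
move=> [qi qI]; exists (weight_measure qi).
have lw : slaw (weight_measure qi) = q by exact: weight_measure_law.
split => //; first exact: weight_measure_invariant.
by apply: (integral_integ uc); rewrite lw.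
Qed.

Definition alpha_range : set R := [set alpha | (alpha_min phi <= alpha%:E <= alpha_max phi)%E].

(** Compactness supplies weights with integrals on both sides of [alpha], and mixing them reaches
    [alpha] exactly. *)
Lemma class_nonempty alpha : alpha_range alpha -> exists q, in_class alpha q.
Proof.
move=> /andP[h1 h2]; apply: integ_exists => // e e0.
  have : (alpha_min phi < (alpha + e)%:E)%E by rewrite (le_lt_trans h1)// lte_fin ltrDl.
  move=> /ereal_inf_lt[_ [mu inv <-] lt].
  have [I E [qi qI]] := measure_in_class inv; exists (slaw mu), I; split => //.
  by move: lt; rewrite E lte_fin.
have : ((alpha - e)%:E < alpha_max phi)%E by rewrite (lt_le_trans _ h2)// lte_fin ltrBlDr ltrDl.
move=> /ereal_sup_gt[_ [mu inv <-] lt].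
have [I E [qi qI]] := measure_in_class inv; exists (slaw mu), I; split => //.
by move: lt; rewrite E lte_fin.
Qed.

Notation D := (Dim row_of (la a) (lb b : vrow p -> R)).

Lemma spectrum alpha : alpha_range alpha -> exists S : R,
  [/\ hausdorff_dim (Lambda_level a c b d phi alpha) = S%:E,
      forall q, in_class alpha q -> D q <= S,
      forall e, 0 < e -> exists2 q, in_class alpha q & S - e < D q &
      ereal_sup [set (DLY a b mu)%:E
                | mu in [set mu : probability (@Sigma p m) R |
                          is_invariant mu sshift /\
                          (\int[mu]_w (phi w)%:E)%E = alpha%:E]] = S%:E].
Proof.
move=> /class_nonempty[q0 c0].
have [l0 [l1 [l00 la_bd lb_bd]]] := log_bounds hyp.
have lb_bd' (i : vrow p) : l0 <= lb b i <= l1 by exact: lb_bd.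
have [M MP] := Dim_bounded row_of l00 la_bd lb_bd'.
pose V := [set D q | q in [set q | in_class alpha q]].
have V0 : V !=set0 by exists (D q0), q0.
have Vb : has_ubound V by exists M => _ [q [qi _] <-]; exact: MP.
have hV : has_sup V by [].
pose S := sup V.
have SP q : in_class alpha q -> D q <= S by move=> cq; apply: ub_le_sup => //; exists q.
have SA e : 0 < e -> exists2 q, in_class alpha q & S - e < D q.
  by move=> e0; have [_ [q cq <-] h] := sup_adherent e0 hV; exists q.
have S0 : 0 <= S.
  have c0i : inv_weight q0 by case: c0.
  by apply: le_trans (SP _ c0); exact: (Dim_ge0 row_of l00 la_bd lb_bd' c0i).
exists S; split => //.
- rewrite Lambda_levelE; apply/eqP; rewrite eq_le; apply/andP; split.
    apply/lee_addgt0Pr => e e0; rewrite -EFinD; apply: hausdorff_dim_le; first by rewrite addr_ge0// ltW.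
    apply: (level_measure0 (pt := point) l00 la_bd lb_bd' (lb_le_la hyp) uc (Pi_prefix_x hyp)
      (Pi_prefix_y hyp) S0 _ _); first by rewrite ltrDl.
    by move=> q qi qI; apply: SP.
  apply: le_ereal_inf_tmp => _ [s [s0 Hs] <-]; rewrite lee_fin.
  apply: ge_sup => // _ [q [qi qI] <-]; rewrite leNgt; apply/negP => sD.
  have := level_measure_neq0 l00 la_bd lb_bd' (lb_le_la hyp) (Pi_near_x hyp) (Pi_near_y hyp)
    (corner_sep_x hyp) (corner_sep_y hyp) uc qi qI s0 sD.
  by rewrite Hs eqxx.
- apply/eqP; rewrite eq_le; apply/andP; split.
    apply: ge_ereal_sup => _ [mu [inv I] <-]; rewrite lee_fin DLY_Dim//; apply: SP.
    have [J E cJ] := measure_in_class inv.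
    by move: I; rewrite E => -[<-].
  apply/lee_addgt0Pr => e e0; have [q cq h] := SA _ e0.
  have [mu [inv I lq]] := class_measure cq.
  rewrite -leeBlDr// -EFinB; apply: (@le_trans _ _ (DLY a b mu)%:E).
    by rewrite lee_fin DLY_Dim// lq ltW.
  by apply: ereal_sup_ubound; exists mu.
Qed.

Lemma spectrum_continuous :
  {within alpha_range, continuous (fun alpha => hausdorff_dim (Lambda_level a c b d phi alpha))}.
Proof.
have [l0 [l1 [l00 la_bd lb_bd]]] := log_bounds hyp.
have lb_bd' (i : vrow p) : l0 <= lb b i <= l1 by exact: lb_bd.
pose F alpha := hausdorff_dim (Lambda_level a c b d phi alpha).
pose g alpha := fine (F alpha).
have Fg alpha : alpha_range alpha -> F alpha = (g alpha)%:E.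
  by move=> /spectrum[S [h _ _ _]]; rewrite /g /F h.
have g_ub alpha q : alpha_range alpha -> inv_weight q -> integ (point : LGdigit m) q phi alpha ->
    D q <= g alpha.
  by move=> /spectrum[S [h h2 _ _]] qi qI; rewrite /g /F h; exact: h2.
have g_sup alpha e : alpha_range alpha -> 0 < e -> exists q,
    [/\ inv_weight q, integ (point : LGdigit m) q phi alpha & g alpha - e < D q].
  by move=> /spectrum[S [h _ h2 _]] e0; have [q [qi qI] lt] := h2 e e0; exists q; rewrite /g /F h.
apply/subspace_continuousP => alpha Ka.
change (F beta @[beta --> within alpha_range (nbhs alpha)] --> F alpha); rewrite (Fg _ Ka).
apply: (@cvg_trans _ ((EFin \o g) beta @[beta --> within alpha_range (nbhs alpha)])).
  apply: near_eq_cvg.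
  by apply/nbhs_ballP; exists 1 => //= beta _ Kb; rewrite Fg.
apply: cvg_EFin; first exact: nearW.
apply/cvgrPdist_lt => e e0.
have [d1 d10 H1] := spectrum_usc (pt := point) (p := row_of) l00 la_bd lb_bd' uc g_ub g_sup Ka e0.
have [d2 d20 H2] := spectrum_lsc (pt := point) (p := row_of) l00 la_bd lb_bd' g_ub g_sup Ka e0.
have d0 : 0 < Num.min d1 d2 by rewrite lt_min d10.
apply/nbhs_ballP; exists (Num.min d1 d2) => //= beta /=.
rewrite /ball /= distrC lt_min => /andP[h1 h2] Kb.
have := H1 beta Kb h1; have := H2 beta Kb h2.
by move=> u v; rewrite ltr_distlC u v.
Qed.

End LedrappierYoung.

Theorem mainTheorem1 (R : realType) (p : nat) (m : 'I_p.+1 -> nat)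
    (a c : LGdigit m -> R) (b d : 'I_p.+1 -> R) (phi : @Sigma p m -> R) :
  LG_hyp a c b d ->
  seq_continuous phi ->
  (forall alpha : R,
      (alpha_min phi <= alpha%:E <= alpha_max phi)%E ->
      hausdorff_dim (Lambda_level a c b d phi alpha) =
      ereal_sup [set (DLY a b mu)%:E
                | mu in [set mu : probability (@Sigma p m) R |
                          is_invariant mu sshift /\
                          (\int[mu]_w (phi w)%:E)%E = alpha%:E]])
  /\
  {within [set alpha : R | (alpha_min phi <= alpha%:E <= alpha_max phi)%E],
     continuous (fun alpha : R => hausdorff_dim (Lambda_level a c b d phi alpha))}.
Proof.
move=> hyp sc; split; last exact: (spectrum_continuous hyp sc).
by move=> alpha /(spectrum hyp sc)[S [-> _ _ ->]].
Qed.
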